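(* Let $X$ be a complex Banach space, let $\alpha\in\mathbb{C}$ with $0<\operatorname{Re}\alpha<1$, and let $A$ be a non-negative (not necessarily densely defined) linear operator in $X$. Put $D:=\overline{\mathcal{D}(A)}$ and suppose that $-A_D$ generates a bounded $C_0$-semigroup $(T(t))_{t\ge 0}$ on $D$. Let $c_\alpha:=\frac{\Gamma(1-\alpha)}{2^{2\alpha-1}\Gamma(\alpha)}$, let $\overline{J^\alpha_A}$ be the Balakrishnan operator with power $\alpha$ and base $A$, and let $\overline{T_\alpha}$ be the generalised Dirichlet-to-Neumann operator (the closure of $T_\alpha$). Then $$c_\alpha\,\overline{J^\alpha_A}=\overline{T_\alpha},$$ as an equality of linear operators in $X$ (including equality of domains).
   Context: A linear operator $A$ in $X$ with domain $\mathcal{D}(A)\subseteq X$ is non-negative if $(-\infty,0)\subseteq\rho(A)$ and $\sup_{\lambda>0}\|\lambda(\lambda+A)^{-1}\|<\infty$, where $\rho(A)$ is the set of $\lambda\in\mathbb{C}$ such that $\lambda-A$ is injective and $(\lambda-A)^{-1}$ is a bounded linear operator defined on all of $X$. It is not required that $0\in\rho(A)$ or that $\mathcal{D}(A)$ be dense. For a closed subspace $D\subseteq X$, the part $A_D$ of $A$ in $D$ is given by $\mathcal{D}(A_D):=\{x\in\mathcal{D}(A)\cap D : Ax\in D\}$, $A_Dx:=Ax$. Complex powers of $t>0$ are $t^{z}=e^{z\ln t}$. The operator $J^\alpha_A$ has domain $\mathcal{D}(J^\alpha_A)=\mathcal{D}(A)$ and is defined by the (convergent) Bochner integral $$J^\alpha_Ax:=\frac{\sin(\alpha\pi)}{\pi}\int_0^\infty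 t^{\alpha-1}(t+A)^{-1}Ax\,dt .$$ It is closable in $X$, and its closure $\overline{J^\alpha_A}$ is called the Balakrishnan operator with power $\alpha$ and base $A$. For $x\in D$ put $U(0)x:=x$ and, for $t>0$, $$U(t)x:=\frac{1}{\Gamma(\alpha)}\Big(\frac t2\Big)^{2\alpha}\int_0^\infty r^{-\alpha}e^{-\frac{t^2}{4r}}T(r)x\,\frac{dr}{r}.$$ The map $t\mapsto U(t)x$ is infinitely differentiable on $(0,\infty)$ with values in $D$; $U'(t)x$ denotes its derivative. The operator $T_\alpha$ in $X$ is defined by $$\mathcal{D}(T_\alpha):=\Big\{x\in D : \lim_{t\to0+}-t^{1-2\alpha}U'(t)x\text{ exists (in norm)}\Big\},\qquad T_\alpha x:=\lim_{t\to0+}-t^{1-2\alpha}U'(t)x .$$ The operator $T_\alpha$ is closable, and its closure $\overline{T_\alpha}$ is called the generalised Dirichlet-to-Neumann operator. *)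

(* Defs.v *)
From HB Require Import structures.
From mathcomp Require Import all_boot all_order all_algebra.
From mathcomp Require Import complex.
From mathcomp Require Import all_classical all_reals all_analysis.

Set Implicit Arguments.
Unset Strict Implicit.
Unset Printing Implicit Defensive.

Import Order.TTheory GRing.Theory Num.Theory.
Import numFieldNormedType.Exports.

Local Open Scope classical_set_scope.
Local Open Scope ring_scope.
Local Open Scope complex_scope.

(** A possibly unbounded operator is a domain together with a total function
    whose values outside the domain are irrelevant; [op_eq] is equality of
    operators, i.e. equality of domains and of values on the domain. *)
Record operator (X : Type) := Operator { opdom : set X; opapp :> X -> X }.

Definition op_eq (X : Type) (A B : operator X) : Prop :=
  opdom A = opdom B /\ forall x, opdom A x -> A x = B x.

Section Operators.
Context {K : numFieldType} {X : normedModType K}.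
Implicit Types (A B : operator X) (D : set X) (a : K).

Definition linear_operator A : Prop :=
  opdom A 0 /\
  forall a x y, opdom A x -> opdom A y ->
    opdom A (a *: x + y) /\ A (a *: x + y) = a *: A x + A y.

Definition scale_op a A : operator X := Operator (opdom A) (fun x => a *: A x).

Definition shift_op a A : operator X :=
  Operator (opdom A) (fun x => a *: x + A x).

Definition part_op A D : operator X :=
  Operator [set x | [/\ opdom A x, D x & D (A x)]] A.

Definition op_injective A : Prop :=
  forall x y, opdom A x -> opdom A y -> A x = A y -> x = y.

Definition inv_op A : operator X :=
  Operator (A @` opdom A) (fun y => get [set x | opdom A x /\ A x = y]).

(** [rho(A)]: here [shift_op a (scale_op (-1) A)] is [a - A]. *)
Definition resolvent_set A : set K :=
  [set a | let B := shift_op a (scale_op (-1) A) in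
    [/\ op_injective B,
        opdom (inv_op B) = setT &
        exists M : K, forall x, `|inv_op B x| <= M * `|x| ] ].

Definition op_graph A : set (X * X) :=
  [set p | opdom A p.1 /\ p.2 = A p.1].

(** The closure of a closable operator: its graph is the closure of the graph
    (closability makes the chosen value unique). *)
Definition closure_op A : operator X :=
  Operator [set x | exists y, closure (op_graph A) (x, y)]
           (fun x => get [set y | closure (op_graph A) (x, y)]).

End Operators.

Section Bochner.
Context (d : measure_display) (T : measurableType d) (R : realType)
        (X : normedModType R[i]).
Variables (mu : {measure set T -> \bar R}) (D : set T).

(** The norm of [X] takes (real) values in [R[i]]. *)
Definition rnorm (x : X) : R := complex.Re `|x|.

Definition simple_function (s : T -> X) : Prop :=
  [/\ finite_set (range s),
      forall x, measurable (s @^-1` [set x]) &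
      forall x, x != 0 -> (mu (D `&` s @^-1` [set x]) < +oo)%E].

Definition simple_integral (s : T -> X) : X :=
  \sum_(x \in range s) (fine (mu (D `&` s @^-1` [set x])))%:C *: x.

Definition bochner_approx (f : T -> X) (s : nat -> T -> X) : Prop :=
  [/\ forall n, simple_function (s n),
      {ae mu, forall t, D t -> s n t @[n --> \oo] --> f t} &
      (\int[mu]_(t in D) (rnorm (f t - s n t))%:E)%E @[n --> \oo] --> 0%E].

(** Total: the value is the point of [X] if [f] is not Bochner integrable. *)
Definition bochner_integral (f : T -> X) : X :=
  get [set v | exists2 s, bochner_approx f s &
                 simple_integral (s n) @[n --> \oo] --> v].

End Bochner.

Section Scalars.
Context {R : realType}.
Implicit Types (z : R[i]) (t : R).

Definition cexp z : R[i] :=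
  (expR (complex.Re z))%:C * (cos (complex.Im z) +i* sin (complex.Im z)).

Definition csin z : R[i] := (cexp ('i%C * z) - cexp (- ('i%C * z))) / (2 * 'i%C).

(** [t ^ z] for [t > 0]. *)
Definition cpow t z : R[i] := cexp (z * (ln t)%:C).

(** Integral over [(0, oo)] with respect to Lebesgue measure. *)
Definition integral_pos {X : normedModType R[i]} (f : R -> X) : X :=
  bochner_integral (@lebesgue_measure R) `]0, +oo[ f.

(** Euler's integral, for [Re z > 0]. *)
Definition cGamma z : R[i] :=
  integral_pos (fun t => cpow t (z - 1) * (expR (- t))%:C : R[i]^o).

Definition c_ (alpha : R[i]) : R[i] :=
  cGamma (1 - alpha) / (cpow 2 (2 * alpha - 1) * cGamma alpha).

Definition real_derive {X : normedModType R[i]} (f : R -> X) t : X :=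
  lim ((h^-1)%:C *: (f (t + h) - f t) @[h --> 0^']).

End Scalars.

Section BalakrishnanDirichletNeumann.
Context {R : realType} {X : normedModType R[i]}.
Implicit Types (A : operator X) (D : set X) (T : R -> X -> X) (alpha : R[i]).

Definition resolvent A (t : R) : operator X := inv_op (shift_op t%:C A).

Definition nonnegative A : Prop :=
  (forall t : R, t < 0 -> resolvent_set A t%:C) /\
  exists M : R, forall (t : R) (x : X), 0 < t ->
    `|t%:C *: resolvent A t x| <= M%:C * `|x|.

Definition bounded_C0_semigroup D T : Prop :=
  [/\ forall t a x y, 0 <= t -> D x -> D y ->
        D (T t x) /\ T t (a *: x + y) = a *: T t x + T t y,
      forall x, D x -> T 0 x = x,
      forall s t x, 0 <= s -> 0 <= t -> D x -> T (s + t) x = T s (T t x),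
      forall x, D x -> T t x @[t --> 0^'+] --> x &
      exists M : R, forall t x, 0 <= t -> D x -> `|T t x| <= M%:C * `|x| ].

Definition generator D T : operator X :=
  let q x (h : R) := (h^-1)%:C *: (T h x - x) in
  Operator [set x | D x /\ cvg (q x h @[h --> 0^'+])]
           (fun x => lim (q x h @[h --> 0^'+])).

Definition J alpha A : operator X :=
  Operator (opdom A) (fun x =>
    (csin (alpha * pi%:C) / pi%:C) *:
      integral_pos (fun t => cpow t (alpha - 1) *: resolvent A t (A x))).

Definition U alpha T (t : R) (x : X) : X :=
  if t == 0 then x else
  ((cGamma alpha)^-1 * cpow (t / 2) (2 * alpha)) *:
    integral_pos (fun r =>
      (cpow r (- alpha) * (expR (- (t ^+ 2 / (4 * r))))%:C * (r^-1)%:C)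
        *: T r x).

Definition DtN alpha D T : operator X :=
  let g x (t : R) :=
    - (cpow t (1 - 2 * alpha) *: real_derive (fun s => U alpha T s x) t) in
  Operator [set x | D x /\ cvg (g x t @[t --> 0^'+])]
           (fun x => lim (g x t @[t --> 0^'+])).

End BalakrishnanDirichletNeumann.

(* Main.v *)
Require Import Defs.
From HB Require Import structures.
From mathcomp Require Import all_boot all_order all_algebra.
From mathcomp Require Import complex.
From mathcomp Require Import all_classical all_reals all_analysis.
From mathcomp Require Import measurable_realfun ring lra.

Set Implicit Arguments.
Unset Strict Implicit.
Unset Printing Implicit Defensive.

Import Order.TTheory GRing.Theory Num.Theory.
Import numFieldNormedType.Exports.
Local Open Scope classical_set_scope.
Local Open Scope ring_scope.
Local Open Scope complex_scope.

(** Put R(t) := (t + A)^-1 and V x := int_0^oo r^(-alpha-1) (x - T(r) x) dr.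

    For x in D(A) the orbit is Lipschitz, so V x converges. Writing
    R(t) A x = int_0^oo t e^(-ts) (x - T(s) x) ds and exchanging the integrals,
    J x = (sin (alpha pi) / pi) Gamma(alpha + 1) V x. On the other side,
    differentiating U(t) x under the integral gives, for every x in D,
      - t^(1-2 alpha) U'(t) x = - K int_0^oo m_t(r) T(r) x dr,
      m_t(r) := (2 alpha - t^2/(2r)) r^(-alpha-1) e^(-t^2/(4r)),
    with K = 2^(-2 alpha) / Gamma(alpha). As m_t is the derivative of
    -2 r^(-alpha) e^(-t^2/(4r)), it has integral zero, so T(r) x may be replaced by
    T(r) x - x, and for x in D(A) the limit as t -> 0+ is 2 alpha K V x. Euler's
    reflection formula turns this into T_alpha x = c_alpha J x on D(A).

    For arbitrary x in D(T_alpha), the elements l R(l) x of D(A) converge to x as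
    l -> oo, and T_alpha (l R(l) x) = l R(l) T_alpha x converges to T_alpha x, hence
    the two closures have the same graph. They are single-valued because R(1) J is
    bounded and R(1) is injective.

    Integrals of vector functions are computed through real-linear bounded
    functionals, which separate points by a Zorn argument on sublinear functions.
    The reflection formula comes from
    W_n(alpha) := int_0^oo cos (2 alpha atan s) (1 + s^2)^(-n-1) ds: the recursion of
    these integrals makes
    W_n(alpha) / W_n(0) * Gamma(n + 1 + alpha) Gamma(n + 1 - alpha) / n!^2
    independent of n, with limit 1 as n -> oo; n = 0 is the formula. *)

(** * Norms, functionals and integrals on the half line *)

(** The integrands below are continuous on (0, oo) and bounded by a multiple of r^(a-1) near 0 and
    of r^(-a-1) near oo, for some a > 0. This one condition, [dominated], gives existence of the
    Bochner integral as a limit of dyadic step functions, and sums and bounded linear maps preserve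
    it up to the constants. The scalars are treated as the Banach space [Cx R], so that Gamma and
    the Wallis-type integrals fall under the same theory, and only calculus in a real variable is
    used.

    Whatever involves A x is therefore rewritten through R(t) A x = x - t R(t) x, which asks only
    for x in D, or is reached by approximating x by l R(l) x. *)

Definition cabs {R : realType} (a : R[i]) : R := complex.Re `|a|.

Section Rnorm.
Context {R : realType} {X : normedModType R[i]}.
Implicit Types (x y : X) (r : R) (a : R[i]).

Lemma norm_rnorm x : `|x| = (rnorm x)%:C.
Proof. by rewrite /rnorm RRe_real // ger0_real. Qed.

Lemma rnorm_ge0 x : 0 <= rnorm x.
Proof. by rewrite -ler0c -norm_rnorm. Qed.

Lemma rnorm_le x r : (rnorm x <= r) = (`|x| <= r%:C).
Proof. by rewrite norm_rnorm lecR. Qed.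

Lemma rnorm_lt x r : (rnorm x < r) = (`|x| < r%:C).
Proof. by rewrite norm_rnorm ltcR. Qed.

Lemma rnorm0 : rnorm (0 : X) = 0.
Proof. by rewrite /rnorm normr0. Qed.

Lemma rnormN x : rnorm (- x) = rnorm x.
Proof. by rewrite /rnorm normrN. Qed.

Lemma rnorm_distC x y : rnorm (x - y) = rnorm (y - x).
Proof. by rewrite -rnormN opprB. Qed.

Lemma rnormD x y : rnorm (x + y) <= rnorm x + rnorm y.
Proof. by rewrite rnorm_le rmorphD /= -!norm_rnorm ler_normD. Qed.

Lemma rnormB x y : rnorm (x - y) <= rnorm x + rnorm y.
Proof. by rewrite (le_trans (rnormD _ _)) // rnormN. Qed.

Lemma rnorm_eq0 x : rnorm x = 0 -> x = 0.
Proof. by move=> h; apply/eqP; rewrite -normr_eq0 norm_rnorm h. Qed.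

Lemma rnormZ a x : rnorm (a *: x) = cabs a * rnorm x.
Proof.
apply: (@complexI R); rewrite rmorphM /= -norm_rnorm normrZ norm_rnorm.
by rewrite /cabs [in RHS]RRe_real // ger0_real.
Qed.

Lemma cabs_real r : cabs r%:C = `|r|.
Proof.
by rewrite /cabs normc_def /= expr0n /= addr0 sqrtr_sqr.
Qed.

Lemma rnormZR r x : rnorm (r%:C *: x) = `|r| * rnorm x.
Proof. by rewrite rnormZ cabs_real. Qed.

Lemma rnorm_triangle x y z : rnorm (x - z) <= rnorm (x - y) + rnorm (y - z).
Proof. by rewrite -{1}(subrKA y) rnormD. Qed.

(** A positive element of [R[i]] is real, so real tolerances suffice. *)
Lemma cvgr_rnormP {T} (F : set_system T) {FF : Filter F} (f : T -> X) l :
  f @ F --> l <-> forall e : R, 0 < e -> \forall t \near F, rnorm (f t - l) <= e.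
Proof.
split=> [/cvgrPdist_le h e e0|h].
  have e0' : 0 < e%:C by rewrite ltcR.
  by apply: filterS (h _ e0') => t; rewrite rnorm_le distrC.
apply/cvgrPdist_le => e e0.
have eE : e = (complex.Re e)%:C by rewrite RRe_real // gtr0_real.
rewrite eE in e0 *; move: e0; rewrite ltcR => e0.
by apply: filterS (h _ e0) => t; rewrite rnorm_le distrC.
Qed.

Lemma cvgr_rnorm0 {T} (F : set_system T) {FF : Filter F} (f : T -> X) l :
  rnorm (f t - l) @[t --> F] --> (0 : R) <-> f @ F --> l.
Proof.
split=> [/cvgr0Pnorm_le h|].
  apply/cvgr_rnormP => e e0; apply: filterS (h _ e0) => t.
  by rewrite ger0_norm ?rnorm_ge0.
move=> /cvgr_rnormP h; apply/cvgr0Pnorm_le => e e0.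
by apply: filterS (h _ e0) => t; rewrite ger0_norm ?rnorm_ge0.
Qed.

Lemma squeeze_rnorm {T} (F : set_system T) {FF : Filter F} (f : T -> X) (g : T -> R) l :
  (\forall t \near F, rnorm (f t - l) <= g t) -> g @ F --> (0 : R) -> f @ F --> l.
Proof.
move=> h hg; apply/cvgr_rnorm0.
apply: (squeeze_cvgr (f := fun=> 0)) hg; last exact: cvg_cst.
by apply: filterS h => t ->; rewrite rnorm_ge0.
Qed.

Lemma rnorm_cvg {T} (F : set_system T) {FF : Filter F} (f : T -> X) l :
  f @ F --> l -> rnorm (f t) @[t --> F] --> rnorm l.
Proof.
move=> /cvgr_rnormP h; apply/cvgrPdist_le => e e0.
apply: filterS (h _ e0) => t; apply: le_trans.
have := rnorm_triangle (f t) l 0; have := rnorm_triangle l (f t) 0.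
by rewrite !subr0 (rnorm_distC l) ler_norml => h1 h2; apply/andP; split; lra.
Qed.

Lemma closure_rnormP (S : set X) x :
  closure S x <-> forall e : R, 0 < e -> exists2 y, S y & rnorm (y - x) <= e.
Proof.
split=> [h e e0|h].
  have e0' : 0 < e%:C by rewrite ltcR.
  have [y [Sy]] := h _ (nbhsx_ballx x _ e0').
  rewrite -ball_normE /= => hy; exists y => //.
  by rewrite rnorm_le distrC ltW.
move=> B /nbhs_ballP[e /= e0 hB].
have eE : e = (complex.Re e)%:C by rewrite RRe_real // gtr0_real.
have e0' : 0 < complex.Re e by rewrite -ltcR -eE.
have [y Sy hy] := h (complex.Re e / 2) (divr_gt0 e0' (ltr0Sn _ 1)).
exists y; split=> //; apply: hB; rewrite -ball_normE /= distrC eE -rnorm_lt.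
by apply: le_lt_trans hy _; rewrite ltr_pdivrMr // ltr_pMr // ltr1n.
Qed.

Lemma closed_cvg_mem {T} (F : set_system T) {FF : ProperFilter F} (S : set X) (f : T -> X) l :
  (\forall t \near F, closure S (f t)) -> f @ F --> l -> closure S l.
Proof.
move=> h /cvgr_rnormP hl; apply/closure_rnormP => e e0.
have e2 : 0 < e / 2 by rewrite divr_gt0.
have [t [h1 /closure_rnormP h2]] := filter_ex (filterI (hl _ e2) h).
have [y Sy hy] := h2 _ e2; exists y => //.
by rewrite (le_trans (rnorm_triangle y (f t) l)) // (splitr e) lerD.
Qed.

(** Real-linearity is enough: such functionals separate points, Re is one of them on the scalars,
    and a complex factor is absorbed by passing to x |-> phi (a x). *)
Definition rfunctional (phi : X -> R) :=
  (forall r x y, phi (r%:C *: x + y) = r * phi x + phi y) /\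
  exists C, forall x, `|phi x| <= C * rnorm x.

End Rnorm.

(** * Norming functionals by minimal sublinear functionals *)

Section NormingFunctional.
Context {R : realType} {X : normedModType R[i]} (v : X).

Let sublinear (p : X -> R) :=
  [/\ forall x y, p (x + y) <= p x + p y,
      forall (t : R) x, 0 <= t -> p (t%:C *: x) = t * p x,
      forall x, p x <= rnorm x & p (- v) <= - rnorm v].

(** From 0 = p 0 <= p x + p (- x). The bound makes the infimum over a chain of sublinear functionals
    finite. *)
Lemma sublinear_lower p : sublinear p -> forall x, - rnorm x <= p x.
Proof.
move=> [pD pZ pn _] x.
have p0 : p 0 = 0 by have := pZ 0 0 (lexx 0); rewrite scaler0 mul0r.
have := pD x (- x); rewrite subrr p0 => h.
have := pn (- x); rewrite rnormN; lra.
Qed.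

(** For sublinear p, the choice t = 1 at [- w] shows [dent p w (- w)] <= - p w: the dent is a
    sublinear functional below p that is odd in the direction w. A minimal p equals all its dents,
    which makes it linear. *)
Let dent (p : X -> R) w x := inf [set p (x + t%:C *: w) - t * p w | t in [set t : R | 0 <= t]].

Lemma dentP p w : (forall x y, p (x + y) <= p x + p y) ->
  (forall (t : R) x, 0 <= t -> p (t%:C *: x) = t * p x) -> (forall x, p x <= rnorm x) ->
  [/\ forall x y, dent p w (x + y) <= dent p w x + dent p w y,
      forall t x, 0 <= t -> dent p w (t%:C *: x) = t * dent p w x,
      forall x t, 0 <= t -> dent p w x <= p (x + t%:C *: w) - t * p w &
      forall x, dent p w x <= p x].
Proof.
move=> pD pZ pn.
have p0 : p 0 = 0 by have := pZ 0 0 (lexx 0); rewrite scaler0 mul0r.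
have lb x : lbound [set p (x + t%:C *: w) - t * p w | t in [set t : R | 0 <= t]] (- rnorm x).
  move=> _ [t /= t0 <-]; have := pD (x + t%:C *: w) (- x).
  rewrite addrAC subrr add0r pZ // => h; have := pn (- x); rewrite rnormN; lra.
have hl x t : 0 <= t -> dent p w x <= p (x + t%:C *: w) - t * p w.
  by move=> t0; apply: ge_inf; [exists (- rnorm x); exact: lb|exists t].
have ne x : [set p (x + t%:C *: w) - t * p w | t in [set t : R | 0 <= t]] !=set0.
  by exists (p (x + (0 : R)%:C *: w) - 0 * p w); exists 0 => //=.
have hg x c : (forall t, 0 <= t -> c <= p (x + t%:C *: w) - t * p w) -> c <= dent p w x.
  by move=> h; apply: lb_le_inf => // _ [t t0 <-]; exact: h.
have hle t x : 0 <= t -> dent p w (t%:C *: x) <= t * dent p w x.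
  rewrite le_eqVlt => /orP[/eqP<-|t0].
    rewrite mul0r scale0r; apply: le_trans (hl 0 0 (lexx _)) _.
    by rewrite scale0r addr0 p0 mul0r subrr.
  rewrite mulrC -ler_pdivrMr //; apply: (hg) => s s0; rewrite ler_pdivrMr //.
  apply: le_trans (hl _ (t * s) (mulr_ge0 (ltW t0) s0)) _.
  have -> : t%:C *: x + (t * s)%:C *: w = t%:C *: (x + s%:C *: w).
    by rewrite scalerDr scalerA -rmorphM.
  have -> : p (t%:C *: (x + s%:C *: w)) = t * p (x + s%:C *: w) := pZ t _ (ltW t0).
  by lra.
split=> //.
- move=> x y; rewrite -lerBlDr; apply: (hg) => s s0; rewrite lerBlDl -lerBlDr.
  apply: (hg) => t t0; rewrite lerBlDl.
  apply: le_trans (hl _ _ (addr_ge0 s0 t0)) _.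
  have -> : x + y + (s + t)%:C *: w = (x + s%:C *: w) + (y + t%:C *: w).
    by rewrite rmorphD /= scalerDl addrACA.
  by have := pD (x + s%:C *: w) (y + t%:C *: w); rewrite mulrDl; lra.
- move=> t x t0; apply/eqP; rewrite eq_le hle //=.
  case: (ltgtP 0 t) t0 => // [t0 _|<- _]; last first.
    rewrite mul0r scale0r; apply: (hg) => s s0.
    by rewrite add0r pZ // subrr.
  (* The reverse inequality is [hle] with the factor t^-1, applied to t x. *)
  rewrite mulrC -ler_pdivlMr // mulrC.
  have := hle t^-1 (t%:C *: x) _; rewrite invr_ge0 (ltW t0) => /(_ isT).
  by rewrite scalerA -rmorphM mulVf ?scale1r // gt_eqF.
- move=> x; have := hl x 0 (lexx _).
  by rewrite scale0r addr0 mul0r subr0.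
Qed.

(* A pointwise minimal sublinear functional below the norm is linear; one that
   takes a value at most [- rnorm v] at [- v] is norming for [v]. *)
Lemma norming_functional : exists phi : X -> R,
  [/\ rfunctional phi, forall x, `|phi x| <= rnorm x & phi v = rnorm v].
Proof.
have rnZ (t : R) (x : X) : 0 <= t -> rnorm (t%:C *: x) = t * rnorm x.
  by move=> t0; rewrite rnormZR ger0_norm.
have [d1 d2 d3 d4] := dentP v rnormD rnZ (fun x => lexx (rnorm x)).
pose T := {p | sublinear p}.
(* The norm itself violates the condition at [- v]; its dent in the direction v satisfies it, by t =
   1. *)
have sp0 : sublinear (dent (@rnorm R X) v).
  split=> //; have := d3 (- v) 1 ler01.
  by rewrite scale1r addNr rnorm0 mul1r sub0r.
pose t0 : T := exist _ _ sp0.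
(* The order is reversed, so that a maximal element is a pointwise minimal functional. *)
pose ge (p q : T) : bool := `[< forall x, sval q x <= sval p x >].
have [|p q r /asboolP h1 /asboolP h2|p q /asboolP h1 /asboolP h2|C tC|[q sq] qmin] :=
    @Zorn T ge.
- by move=> p; apply/asboolP.
- by apply/asboolP => x; exact: le_trans (h2 x) (h1 x).
- case: p q h1 h2 => [p sp] [q sq] /= h1 h2.
  have pq : p = q by apply/funext => x; apply/eqP; rewrite eq_le h1 h2.
  by subst q; congr exist; exact: Prop_irrelevance.
- have [[c0 Cc0]|C0] := pselect (C !=set0); last first.
    by exists t0 => s Cs; exfalso; apply: C0; exists s.
  pose E x := [set sval c x | c in C].
  have lb x : lbound (E x) (- rnorm x).
    by move=> _ [c Cc <-]; exact: sublinear_lower (svalP c) x.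
  have ne x : E x !=set0 by exists (sval c0 x); exists c0.
  have hl x c : C c -> inf (E x) <= sval c x.
    by move=> Cc; apply: ge_inf; [exists (- rnorm x); exact: lb|exists c].
  have hg x k : (forall c, C c -> k <= sval c x) -> k <= inf (E x).
    by move=> h; apply: lb_le_inf => // _ [c Cc <-]; exact: h.
  (* Subadditivity of the infimum uses the chain: of two members c and d, the smaller one serves for
     both terms. *)
  have ss : sublinear (fun x => inf (E x)).
    split.
    + move=> x y; rewrite -lerBlDr; apply: (hg) => c Cc; rewrite lerBlDl -lerBlDr.
      apply: (hg) => d Cd; rewrite lerBlDl.
      have [/asboolP h|/asboolP h] := tC _ _ Cc Cd.
      * apply: le_trans (hl _ _ Cd) _; have [sD _ _ _] := svalP d.
        by apply: le_trans (sD _ _) _; rewrite lerD2r; exact: h.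
      * apply: le_trans (hl _ _ Cc) _; have [sD _ _ _] := svalP c.
        by apply: le_trans (sD _ _) _; rewrite lerD2l; exact: h.
    + move=> t x; rewrite le_eqVlt => /orP[/eqP<-|tp].
        rewrite mul0r; apply/eqP; rewrite eq_le; apply/andP; split.
          have [_ sZ _ _] := svalP c0.
          by apply: le_trans (hl _ _ Cc0) _; rewrite sZ // mul0r.
        by apply: (hg) => c Cc; have [_ sZ _ _] := svalP c; rewrite sZ // mul0r.
      apply/eqP; rewrite eq_le; apply/andP; split.
        rewrite mulrC -ler_pdivrMr //; apply: (hg) => c Cc; rewrite ler_pdivrMr //.
        have [_ sZ _ _] := svalP c; apply: le_trans (hl _ _ Cc) _.
        by rewrite sZ ?(ltW tp) // mulrC.
      apply: (hg) => c Cc; have [_ sZ _ _] := svalP c.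
      by rewrite sZ ?(ltW tp) // ler_pM2l // hl.
    + move=> x; apply: le_trans (hl _ _ Cc0) _.
      by have [_ _ + _] := svalP c0; apply.
    + apply: le_trans (hl _ _ Cc0) _.
      by have [_ _ _] := svalP c0.
  exists (exist _ _ ss) => s Cs; apply/asboolP => x /=; exact: hl.
have [qD qZ qn qv] := sq.
have q0 : q 0 = 0 by have := qZ 0 0 (lexx 0); rewrite scaler0 mul0r.
(* By minimality. With w = y and t = 1 this yields q x <= q (x + y) - q y, the missing half of
   additivity. *)
have dq w : dent q w = q.
  have [e1 e2 e3 e4] := dentP w qD qZ qn.
  have se : sublinear (dent q w).
    by split=> // [x|]; [apply: le_trans (e4 x) _|apply: le_trans (e4 _) _].
  have h : ge (exist _ q sq) (exist _ _ se) by apply/asboolP.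
  by case: (qmin (exist _ _ se) h).
have qadd x y : q (x + y) = q x + q y.
  apply/eqP; rewrite eq_le qD /= -lerBrDr.
  have [_ _ e3 _] := dentP y qD qZ qn.
  by have := e3 x 1 ler01; rewrite dq scale1r mul1r.
have qN x : q (- x) = - q x by apply/eqP; rewrite -addr_eq0 -qadd addNr q0.
have qb x : `|q x| <= rnorm x.
  by rewrite ler_norml qn (sublinear_lower sq).
exists q; split=> //.
  split; last by exists 1 => x; rewrite mul1r.
  move=> r x y; rewrite qadd; congr (_ + _).
  have [r0|r0] := leP 0 r; first exact: qZ.
  rewrite -[r in LHS]opprK rmorphN scaleNr qN qZ ?mulNr ?opprK //; lra.
by apply/eqP; rewrite eq_le qn /= -lerN2 -qN.
Qed.

End NormingFunctional.

(** * Integrals of continuous functions on (0, oo) and power weights *)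

Section IntegralsOnHalfLine.
Context {R : realType}.
Implicit Types (f g h F : R -> R) (a C r : R).
Local Notation mu := (@lebesgue_measure R).
Local Notation pos := (`]0, +oo[%classic : set (measurableTypeR R)).

Definition cont_pos {V : topologicalType} (f : R -> V) :=
  forall r, 0 < r -> f x @[x --> r] --> f r.

Lemma posP r : pos r <-> 0 < r.
Proof. by rewrite /= in_itv /= andbT. Qed.

Lemma near_pos r : 0 < r -> \forall x \near r, 0 < x.
Proof. exact: lt_nbhsr. Qed.

Lemma measurable_cont_pos f : cont_pos f -> measurable_fun pos f.
Proof.
move=> cf; apply: open_continuous_measurable_fun => //.
by move=> x; rewrite inE => /posP; exact: cf.
Qed.

(** The offset 2 keeps every interval nondegenerate, as the fundamental theorem of calculus on a
    segment requires. *)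
Lemma pos_bigcup : pos = \bigcup_n `[(n.+2%:R)^-1, n.+2%:R]%classic.
Proof.
apply/seteqP; split=> [x /posP x0|x [n _] /=]; last first.
  rewrite !in_itv /= andbT => /andP[h _]; apply: lt_le_trans h.
  by rewrite invr_gt0.
have [n hn] : exists n : nat, x <= n.+2%:R /\ x^-1 <= n.+2%:R.
  exists (Num.trunc (Num.max x x^-1)).
  have h : Num.max x x^-1 <= (Num.trunc (Num.max x x^-1)).+2%:R.
    rewrite (le_trans (ltW (truncnS_gt _))) // ler_nat //.
  by split; apply: le_trans h; rewrite le_max lexx ?orbT.
exists n => //=; rewrite in_itv /= hn.1 andbT.
by rewrite -[leRHS]invrK lef_pV2 ?posrE ?invr_gt0 // hn.2.
Qed.

(** Nonnegativity permits monotone convergence along the exhausting segments, so integrability is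
    not assumed but follows. *)
Lemma ge0_FTC_pos f F l0 l1 : cont_pos f -> (forall r, 0 < r -> 0 <= f r) ->
  (forall r : R, 0 < r -> is_derive r 1 F (f r)) ->
  F x @[x --> 0^'+] --> l0 -> F x @[x --> +oo] --> l1 ->
  (\int[mu]_(x in pos) (f x)%:E)%E = (l1 - l0)%:E.
Proof.
move=> cf f0 dF F0 F1.
have gt0 n : 0 < (n.+2%:R : R)^-1 by rewrite invr_gt0.
have inpos n x : x \in `[(n.+2%:R)^-1, n.+2%:R] -> 0 < x :> R.
  by rewrite in_itv /= => /andP[h _]; apply: lt_le_trans h.
pose I n : set (measurableTypeR R) := `[(n.+2%:R)^-1, n.+2%:R]%classic.
have e n : (\int[mu]_(x in I n) (f x)%:E)%E =
   (F n.+2%:R - F (n.+2%:R)^-1)%:E.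
  have cF (x : R) : 0 < x -> F y @[y --> x] --> F x.
    by move=> x0; apply: differentiable_continuous; apply/derivable1_diffP; case: (dF x x0).
  rewrite EFinB; apply: continuous_FTC2.
  - by rewrite (@lt_trans _ _ 1) ?invf_lt1 ?ltr1n.
  - by apply: continuous_in_subspaceT => x /set_mem /inpos; exact: cf.
  - split.
    + by move=> x /subset_itv_oo_cc /inpos x0; case: (dF x x0).
    + by apply: cvg_at_right_filter; exact: cF.
    + by apply: cvg_at_left_filter; apply: cF.
  - by move=> x /subset_itv_oo_cc /inpos x0; rewrite derive1E; case: (dF x x0).
have := @ge0_nondecreasing_set_cvg_integral _ _ R I (EFin \o f) mu.
rewrite -pos_bigcup => h.
suff h2 : (\int[mu]_(x in I n) (f x)%:E)%E @[n --> \oo] --> (l1 - l0)%:E.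
  apply: (cvg_unique (@ereal_hausdorff R) _ h2); apply: h.
  - move=> m n mn; apply/subsetPset => x /=; rewrite /I /= !in_itv /= => /andP[h1 h3].
    apply/andP; split; [apply: le_trans h1|apply: (le_trans h3)].
      by rewrite lef_pV2 ?posrE // ler_nat ltnS ltnS.
    by rewrite ler_nat ltnS ltnS.
  - by move=> n; exact: measurable_itv.
  - move=> n; apply/measurable_EFinP; apply: measurable_funS (measurable_cont_pos cf) => //.
    by move=> x /inpos /posP.
  - by move=> n x /inpos x0; rewrite lee_fin f0.
under eq_fun do rewrite e.
apply: cvg_EFin; first exact: nearW.
have nat2 : (fun n : nat => n.+2%:R : R) @ \oo --> +oo.
  apply/cvgryPge => A; near=> n.
  have h1 : A <= n%:R by near: n; exact: nbhs_infty_ger.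
  by apply: le_trans h1 _; rewrite ler_nat (@leq_trans n.+1).
apply: cvgB; first exact: cvg_comp nat2 F1.
move/cvg_at_rightP : F0 => /(_ (fun n : nat => (n.+2%:R : R)^-1)); apply; split=> //.
by apply/gtr0_cvgV0 => //; apply: nearW => n.
Unshelve. all: by end_near.
Qed.

(* [r ^ (a - 1)] for [r <= 1] and [r ^ (- a - 1)] for [r >= 1]. *)
Definition wt a r := r^-1 * expR (- a * `|ln r|).

Lemma wt_gt0 a r : 0 < r -> 0 < wt a r.
Proof. by move=> r0; rewrite mulr_gt0 ?invr_gt0 ?expR_gt0. Qed.

Lemma cont_ln r : 0 < r -> ln x @[x --> r] --> ln r.
Proof. exact: continuous_ln. Qed.

Lemma cont_pos_wt a : cont_pos (wt a).
Proof.
move=> r r0; apply: cvgM; first by apply: cvgV; [rewrite gt_eqF|exact: cvg_id].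
apply: continuous_comp; last exact: continuous_expR.
by apply: cvgM; [exact: cvg_cst|apply: cvg_norm; exact: cont_ln].
Qed.

Lemma near0_pos P : (forall r, 0 < r -> P r) -> \forall r \near (0 : R)^'+, P r.
Proof. by move=> h; near=> r; apply: h; near: r; exact: nbhs_right_gt. Unshelve. all: by end_near. Qed.

Lemma neary_pos P : (forall r, 0 < r -> P r) -> \forall r \near (+oo : set_system R), P r.
Proof. by move=> h; near=> r; apply: h; near: r; exact: nbhs_pinfty_gt. Unshelve. all: by end_near. Qed.

Lemma expR_absln_cvg0 a : 0 < a ->
  expR (- a * `|ln r|) @[r --> (0 : R)^'+] --> (0 : R) /\
  expR (- a * `|ln r|) @[r --> +oo] --> (0 : R).
Proof.
move=> a0; have h e : 0 < e -> forall t, `|ln e| / a <= `|t| -> `|expR (- a * `|t|)| <= e.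
  move=> e0 t; rewrite ler_pdivrMr // => h.
  rewrite ger0_norm ?expR_ge0 // -[leRHS](lnK e0) ler_expR.
  by have := ler_norm (- ln e); rewrite normrN; lra.
split; apply/cvgr0Pnorm_le => e e0.
  near=> r; apply: h => //.
  have r0 : 0 < r by near: r; exact: nbhs_right_gt.
  have : ln r <= - (`|ln e| / a).
    rewrite -ler_expR lnK //; apply: ltW; near: r; apply: nbhs_right_lt.
    exact: expR_gt0.
  by have := ler_norm (- ln r); rewrite normrN; lra.
near=> r; apply: h => //.
have r0 : 0 < r by near: r; exact: nbhs_pinfty_gt.
have : expR (`|ln e| / a) < r by near: r; exact: nbhs_pinfty_gt.
by move=> h1; apply: le_trans (ler_norm _); rewrite -ler_expR lnK // ltW.
Unshelve. all: by end_near.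
Qed.

(** A smooth substitute for [wt a]: with u = r^a it is r^-1 u / (1 + u)^2, comparable to r^-1 min(u,
    1/u), and it has the elementary primitive [Swt a]. *)
Definition swt a r := r^-1 * expR (a * ln r) / (1 + expR (a * ln r)) ^+ 2.
Definition Swt a r := - (a^-1 / (1 + expR (a * ln r))).

(** With u = r^a, the factor 4 comes from (1 + u)^2 <= 4 max(1, u^2). *)
Lemma wt_le_swt a r : 0 <= a -> 0 < r -> wt a r <= 4 * swt a r.
Proof.
move=> a0 r0; rewrite /wt /swt -mulrA mulrCA ler_pM2l ?invr_gt0 //.
have E0 := expR_gt0 (a * ln r).
have key (m E : R) : 0 < m -> 0 < E -> (m = E /\ E <= 1 \/ m * E = 1 /\ 1 <= E) -> m <= 4 * (E / (1 + E) ^+ 2).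
  move=> m0 e0; rewrite mulrA ler_pdivlMr; last by rewrite exprn_gt0 // addr_gt0.
  move=> [[-> h]|[h1 h]].
    rewrite [leLHS]mulrC ler_pM2r //.
    by have : E * E <= 1; [rewrite mulr_ile1 // ltW|nra].
  by nra.
apply: key => //; first exact: expR_gt0.
have [l0|l0] := leP 0 (ln r); [right|left].
  rewrite ger0_norm // -expRD mulNr addNr expR0; split=> //.
  by rewrite -expR0 ler_expR mulr_ge0.
rewrite ltr0_norm // mulrNN; split=> //.
by rewrite -expR0 ler_expR mulr_ge0_le0 // ltW.
Qed.

Lemma is_derive_Swt a r : a != 0 -> 0 < r -> is_derive r 1 (Swt a) (swt a r).
Proof.
move=> a0 r0; rewrite /Swt.
have e0 : 1 + expR (a * ln r) != 0 by rewrite gt_eqF // addr_gt0 ?expR_gt0.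
have dl := is_derive1_ln r0.
apply: is_derive_eq.
rewrite /swt /GRing.scale /=; field.
by rewrite a0 e0 gt_eqF.
Qed.

Lemma swt_ge0 a r : 0 < r -> 0 <= swt a r.
Proof.
by move=> r0; rewrite !mulr_ge0 ?invr_ge0 ?exprn_ge0 ?addr_ge0 ?expR_ge0 // ltW.
Qed.

Lemma cont_pos_swt a : cont_pos (swt a).
Proof.
move=> r r0.
have cE : expR (a * ln x) @[x --> r] --> expR (a * ln r).
  apply: continuous_comp; last exact: continuous_expR.
  by apply: cvgM; [exact: cvg_cst|exact: cont_ln].
apply: cvgM; first by apply: cvgM => //; apply: cvgV; [rewrite gt_eqF|exact: cvg_id].
apply: cvgV; first by rewrite gt_eqF // exprn_gt0 // addr_gt0 ?expR_gt0.
by rewrite expr2; apply: cvgM; apply: cvgD => //; exact: cvg_cst.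
Qed.

Lemma cvg_Swt0 a : 0 < a -> Swt a r @[r --> 0^'+] --> - a^-1.
Proof.
move=> a0; have [h _] := expR_absln_cvg0 a0.
have -> : - a^-1 = - (a^-1 * (1 + 0)^-1) by rewrite addr0 invr1 mulr1.
apply: cvgN; apply: cvgM; first exact: cvg_cst.
apply: cvgV; first by rewrite addr0.
apply: cvgD; first exact: cvg_cst.
apply: cvg_trans h; apply: near_eq_cvg; near=> r.
have r0 : 0 < r by near: r; exact: nbhs_right_gt.
have r1 : r <= 1 by near: r; exact: nbhs_right_le.
by rewrite ler0_norm ?ln_le0 // mulrNN.
Unshelve. all: by end_near.
Qed.

Lemma cvg_Swty a : 0 < a -> Swt a r @[r --> +oo] --> (0 : R).
Proof.
move=> a0; have [_ h] := expR_absln_cvg0 a0.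
apply: (squeeze_cvgr (f := fun r => - (a^-1 * expR (- a * `|ln r|))) (h := fun=> 0)).
- near=> r; have r1 : 1 <= r by near: r; exact: nbhs_pinfty_ge.
  rewrite /Swt lerN2 oppr_le0 ler_pM2l ?invr_gt0 // mulr_ge0 ?invr_ge0 ?(ltW a0) //; rewrite ?addr_ge0 ?expR_ge0 // andbT.
  rewrite ger0_norm ?ln_ge0 // mulNr expRN lef_pV2 ?posrE ?addr_gt0 ?expR_gt0 //.
  by rewrite lerDr.
- by rewrite -oppr0; apply: cvgN; rewrite -[X in _ --> X](mulr0 a^-1); apply: cvgM => //; exact: cvg_cst.
- exact: cvg_cst.
Unshelve. all: by end_near.
Qed.

Lemma integral_swt a : 0 < a -> (\int[mu]_(x in pos) (swt a x)%:E)%E = (a^-1)%:E.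
Proof.
move=> a0; have dS r : 0 < r -> is_derive r 1 (Swt a) (swt a r).
  by move=> r0; apply: is_derive_Swt => //; rewrite gt_eqF.
have h := ge0_FTC_pos (@cont_pos_swt a) (@swt_ge0 a) dS (cvg_Swt0 a0) (cvg_Swty a0).
by rewrite h sub0r opprK.
Qed.

Lemma integrable_swt a : 0 < a -> mu.-integrable pos (EFin \o swt a).
Proof.
move=> a0; apply/integrableP; split.
  by apply/measurable_EFinP; apply: measurable_cont_pos; exact: cont_pos_swt.
under eq_integral => x /set_mem /posP x0 do rewrite /= ger0_norm ?swt_ge0 //.
by rewrite integral_swt // ltry.
Qed.

Lemma integrable_swtZ c a : 0 < a -> mu.-integrable pos (EFin \o (fun r => c * swt a r)).
Proof.
move=> a0; have mp : measurable pos by exact: measurable_itv.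
exact: (integrableZl mp c (integrable_swt a0)).
Qed.

Lemma integrable_dominated C a h : 0 < a -> cont_pos h ->
  (forall r, 0 < r -> `|h r| <= C * wt a r) -> mu.-integrable pos (EFin \o h).
Proof.
move=> a0 ch hb; apply: (@le_integrable _ _ _ mu pos _ _ (EFin \o (fun r => C * 4 * swt a r))) => //.
- by apply/measurable_EFinP; exact: measurable_cont_pos.
- move=> r /posP r0; rewrite lee_fin (le_trans (hb _ r0)) // -mulrA.
  have C0 : 0 <= C by rewrite -(pmulr_lge0 _ (wt_gt0 a r0)) (le_trans _ (hb _ r0)).
  by rewrite (le_trans _ (ler_norm _)) // ler_wpM2l // wt_le_swt // ltW.
- exact: integrable_swtZ.
Qed.

Definition rint h := (\int[mu]_(x in pos) h x)%R.

(** 4 / a bounds the integral of [wt a]: 4 is the factor of [wt_le_swt] and 1 / a the integral of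
    [swt a]. *)
Lemma rint_dominated C a h : 0 < a -> 0 <= C -> cont_pos h ->
  (forall r, 0 < r -> `|h r| <= C * wt a r) -> `|rint h| <= C * (4 / a).
Proof.
move=> a0 C0 ch hb; have ih := integrable_dominated a0 ch hb.
apply: le_trans (le_normr_Rintegral _ ih) _ => //.
have -> : C * (4 / a) = rint (fun r => C * 4 * swt a r).
  rewrite /rint RintegralZl //; last exact: integrable_swt.
  by rewrite /Rintegral integral_swt //= mulrA.
apply: le_Rintegral => //.
- exact: integrable_norm.
- exact: integrable_swtZ.
- move=> r /posP r0; rewrite (le_trans (hb _ r0)) // -mulrA.
  by rewrite ler_wpM2l // wt_le_swt // ltW.
Qed.

(** Adding the majorant 4 C [swt a], whose primitive is known, makes the integrand nonnegative and
    reduces the claim to [ge0_FTC_pos]. *)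
Lemma FTC_pos C a h F l0 l1 : 0 < a -> cont_pos h ->
  (forall r, 0 < r -> `|h r| <= C * wt a r) ->
  (forall r : R, 0 < r -> is_derive r 1 F (h r)) ->
  F x @[x --> 0^'+] --> l0 -> F x @[x --> +oo] --> l1 -> rint h = l1 - l0.
Proof.
move=> a0 ch hb dF F0 F1.
have C0 : 0 <= C by rewrite -(pmulr_lge0 _ (wt_gt0 a ltr01)) (le_trans _ (hb _ ltr01)).
pose g r := C * 4 * swt a r; pose G r := C * 4 * Swt a r.
have cg : cont_pos g by move=> r r0; apply: cvgM; [exact: cvg_cst|exact: cont_pos_swt].
have hg r : 0 < r -> `|h r| <= g r.
  by move=> r0; rewrite (le_trans (hb _ r0)) // /g -mulrA ler_wpM2l // wt_le_swt // ltW.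
have ig : mu.-integrable pos (EFin \o g).
  exact: integrable_swtZ.
have ih := integrable_dominated a0 ch hb.
have Eg : rint g = C * 4 * a^-1.
  rewrite /rint RintegralZl //; last exact: integrable_swt.
  by rewrite /Rintegral integral_swt.
suff e : rint (fun r => h r + g r) = (l1 + 0) - (l0 + C * 4 * (- a^-1)).
  by move: e; rewrite /rint RintegralD // -/(rint h) -/(rint g) Eg; lra.
rewrite /rint /Rintegral.
have -> : (\int[mu]_(x in pos) (h x + g x)%:E)%E = ((l1 + 0) - (l0 + C * 4 * (- a^-1)))%:E; last by [].
apply: (@ge0_FTC_pos (fun r => h r + g r) (F \+ G)).
- by move=> r r0; apply: cvgD; [exact: ch|exact: cg].
- by move=> r r0; have := hg r r0; rewrite ler_norml => /andP[]; lra.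
- move=> r r0; have dFr := dF r r0.
  have dS : is_derive r 1 (Swt a) (swt a r) by apply: is_derive_Swt => //; rewrite gt_eqF.
  by apply: is_derive_eq.
- by apply: cvgD => //; apply: cvgM; [exact: cvg_cst|exact: cvg_Swt0].
- apply: cvgD => //; rewrite -[X in _ --> X](mulr0 (C * 4)).
  by apply: cvgM; [exact: cvg_cst|exact: cvg_Swty].
Qed.

End IntegralsOnHalfLine.

Section ComplexComplete.
Context {R : realType}.

Implicit Types z w : R[i].

Lemma cabs_rnorm z : rnorm (z : R[i]^o) = cabs z.
Proof. by []. Qed.

Lemma cabs_ge0 z : 0 <= cabs z.
Proof. exact: (@rnorm_ge0 R (R[i]^o)). Qed.

Lemma cabsM z w : cabs (z * w) = cabs z * cabs w.
Proof. exact: (@rnormZ R (R[i]^o)). Qed.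

Lemma cabsD z w : cabs (z + w) <= cabs z + cabs w.
Proof. exact: (@rnormD R (R[i]^o)). Qed.

Lemma cabsN z : cabs (- z) = cabs z.
Proof. exact: (@rnormN R (R[i]^o)). Qed.

Lemma cabs0 : cabs (0 : R[i]) = 0.
Proof. exact: (@rnorm0 R (R[i]^o)). Qed.

Lemma cabs1 : cabs (1 : R[i]) = 1.
Proof. by rewrite /cabs normr1. Qed.

Lemma cabs_i : cabs ('i : R[i]) = 1.
Proof. by rewrite /cabs normc_def /= !expr0n /= add0r expr1n sqrtr1. Qed.

Lemma cabs_eq0 z : cabs z = 0 -> z = 0.
Proof. exact: (@rnorm_eq0 R (R[i]^o)). Qed.

Lemma cabs_Re z : `|complex.Re z| <= cabs z.
Proof. by rewrite -lecR -cabs_rnorm -norm_rnorm; exact: normc_ge_Re. Qed.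

Lemma cabs_Im z : `|complex.Im z| <= cabs z.
Proof.
have -> : complex.Im z = complex.Re (- 'i * z) by case: z => x y /=; ring.
by apply: le_trans (cabs_Re _) _; rewrite cabsM cabsN cabs_i mul1r.
Qed.

Lemma cabs_le z : cabs z <= `|complex.Re z| + `|complex.Im z|.
Proof.
have {1}-> : z = (complex.Re z)%:C + (complex.Im z)%:C * 'i :> R[i] by case: z => x y; simpc.
by rewrite (le_trans (cabsD _ _)) // cabsM !cabs_real cabs_i mulr1.
Qed.

Lemma complex_complete (F : set_system R[i]^o) : ProperFilter F -> cauchy F -> cvg F.
Proof.
move=> FF /cauchyP cF.
have ccomp (p : R[i]^o -> R) : (forall z w, `|p z - p w| <= cabs (z - w)) -> cvg (p @ F).
  move=> hp; apply: R_complete; apply: cauchy_exP => e e0.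
  have [z hz] := cF e%:C (ltac:(by rewrite ltcR)).
  exists (p z); apply: (@filterS _ F _ (ball z e%:C)) hz => w; rewrite -!ball_normE /= => h.
  by rewrite (le_lt_trans (hp _ _)) // -cabs_rnorm rnorm_lt.
have /cvg_ex [a ha] : cvg (@complex.Re R @ F).
  by apply: ccomp => z w; rewrite -raddfB /=; exact: cabs_Re.
have /cvg_ex [b hb] : cvg (@complex.Im R @ F).
  by apply: ccomp => z w; rewrite -raddfB /=; exact: cabs_Im.
apply/cvg_ex; exists (a +i* b); apply/cvgr_rnormP => e e0.
have e2 : 0 < e / 2 by rewrite divr_gt0.
move/cvgrPdistC_le : ha => /(_ _ e2) h1; move/cvgrPdistC_le : hb => /(_ _ e2) h2.
apply: filterS2 h1 h2 => z h1 h2; rewrite (le_trans (cabs_le _)) // (splitr e) lerD //.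
- by case: z h1 h2.
- by case: z h1 h2.
Qed.

End ComplexComplete.

(* The canonical key of [R[i]^o] for complete spaces is taken by [R^o]. *)
Definition Cx (R : realType) : completeNormedModType R[i] :=
  HB.pack (R[i]^o) (Uniform_isComplete.Build (R[i]^o) (@complex_complete R)).

Section Rfunctional.
Context {R : realType} {X : normedModType R[i]}.
Implicit Types (phi : X -> R).

Lemma rfunctional0 phi : rfunctional phi -> phi 0 = 0.
Proof. by move=> [h _]; have := h 1 0 0; rewrite scaler0 addr0 mul1r; lra. Qed.

Lemma rfunctionalZ phi r x : rfunctional phi -> phi (r%:C *: x) = r * phi x.
Proof. by move=> hp; have := hp.1 r x 0; rewrite addr0 rfunctional0 // addr0. Qed.

Lemma rfunctionalD phi x y : rfunctional phi -> phi (x + y) = phi x + phi y.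
Proof. by move=> hp; have := hp.1 1 x y; rewrite scale1r mul1r. Qed.

Lemma rfunctionalN phi x : rfunctional phi -> phi (- x) = - phi x.
Proof.
by move=> hp; have := rfunctionalZ (-1) x hp; rewrite rmorphN scaleN1r mulN1r.
Qed.

Lemma rfunctionalB phi x y : rfunctional phi -> phi (x - y) = phi x - phi y.
Proof. by move=> hp; rewrite rfunctionalD // rfunctionalN. Qed.

Lemma rfunctional_sum phi I (s : seq I) (f : I -> X) : rfunctional phi ->
  phi (\sum_(i <- s) f i) = \sum_(i <- s) phi (f i).
Proof.
move=> hp; apply: (big_morph phi) => [x y|]; [exact: rfunctionalD|exact: rfunctional0].
Qed.

Lemma rfunctional_bound phi : rfunctional phi ->
  exists2 C : R, 0 <= C & forall x, `|phi x| <= C * rnorm x.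
Proof.
move=> [_ [C hC]]; exists `|C| => // x; apply: le_trans (hC x) _.
by rewrite ler_wpM2r ?rnorm_ge0 // ler_norm.
Qed.

Lemma rfunctional_cvg phi {T} (F : set_system T) {FF : Filter F} (f : T -> X) l :
  rfunctional phi -> f @ F --> l -> phi (f t) @[t --> F] --> phi l.
Proof.
move=> hp /cvgr_rnormP h; have [C C0 hC] := rfunctional_bound hp.
apply/cvgrPdistC_le => e e0.
have e1 : 0 < e / (C + 1) by rewrite divr_gt0 // ltr_wpDl.
apply: filterS (h _ e1) => t ht; rewrite -rfunctionalB // (le_trans (hC _)) //.
move: ht; rewrite ler_pdivlMr ?ltr_wpDl // => ht.
by have := rnorm_ge0 (f t - l); nra.
Qed.

Lemma rfunctional_ext x y : (forall phi, rfunctional phi -> phi x = phi y) -> x = y.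
Proof.
move=> h; have [phi [hp _ e]] := norming_functional (x - y).
apply/eqP; rewrite -subr_eq0; apply/eqP; apply: rnorm_eq0.
by rewrite -e rfunctionalB // h // subrr.
Qed.

Lemma rfunctional_scale phi (a : R[i]) : rfunctional phi -> rfunctional (fun x => phi (a *: x)).
Proof.
move=> hp; split.
  move=> r x y; rewrite scalerDr rfunctionalD // scalerA mulrC -scalerA.
  by rewrite rfunctionalZ.
have [C C0 hC] := rfunctional_bound hp.
by exists (C * cabs a) => x; rewrite (le_trans (hC _)) // rnormZ mulrA.
Qed.

(** Separates the scalar from the vector. The Fubini kernel thereby becomes a sum of products of
    functions of one variable times an exponential, hence jointly measurable. *)
Lemma rfunctional_scaleE phi (a : R[i]) x : rfunctional phi ->
  phi (a *: x) = complex.Re a * phi x + complex.Im a * phi ('i *: x).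
Proof.
move=> hp; rewrite -!rfunctionalZ // -rfunctionalD // scalerA -scalerDl.
by congr (phi (_ *: x)); case: a => b c; simpc.
Qed.

End Rfunctional.

Lemma rfunctional_comp {R : realType} {X Y : normedModType R[i]} (phi : Y -> R) (L : X -> Y) (C : R) :
  rfunctional phi ->
  (forall (a : R[i]) x y, L (a *: x + y) = a *: L x + L y) ->
  (forall x, rnorm (L x) <= C * rnorm x) -> rfunctional (phi \o L).
Proof.
move=> hp hL hC; split=> [r x y|]; first by rewrite /= hL hp.1.
have [D D0 hD] := rfunctional_bound hp.
by exists (D * C) => x /=; rewrite (le_trans (hD _)) // -mulrA ler_wpM2l.
Qed.

(** * Bochner integrals *)

Section SimpleFunctions.
Context {R : realType} {X : normedModType R[i]}.
Local Notation mu := (@lebesgue_measure R).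
Local Notation pos := (`]0, +oo[%classic : set (measurableTypeR R)).
Implicit Types (f s : measurableTypeR R -> X) (A : set (measurableTypeR R)).

Lemma integrable_indic_pos A : measurable A -> (mu (pos `&` A) < +oo)%E ->
  mu.-integrable pos (fun t => (\1_A t)%:E) /\
  (\int[mu]_(t in pos) (\1_A t)%:E)%E = (fine (mu (pos `&` A)))%:E.
Proof.
move=> mA fA; have mp : measurable pos by exact: measurable_itv.
have e : (\int[mu]_(t in pos) (\1_A t)%:E)%E = mu (pos `&` A).
  by rewrite integral_indic // setIC.
split; last first.
  by rewrite e fineK // ge0_fin_numE // measure_ge0.
apply/integrableP; split; first by apply/measurable_EFinP; exact: measurable_indic.
under eq_integral => t _ do rewrite gee0_abs ?lee_fin //.
by rewrite e.
Qed.

Lemma simple_integral_functional phi s : rfunctional phi ->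
  simple_function mu pos s ->
  mu.-integrable pos (EFin \o (phi \o s)) /\
  phi (simple_integral mu pos s) = rint (phi \o s).
Proof.
move=> hp [fs ms finx].
have mp : measurable pos by exact: measurable_itv.
pose I x t : \bar R := (\1_(s @^-1` [set x]) t)%:E.
pose g x t := ((phi x)%:E * I x t)%E.
have ig x : mu.-integrable pos (g x) /\
    (\int[mu]_(t in pos) g x t)%E = (fine (mu (pos `&` s @^-1` [set x])) * phi x)%:E.
  (* The value 0 may be taken on a set of infinite measure; its term vanishes because phi 0 = 0. *)
  have [->|x0] := eqVneq x 0.
    have g0 : g 0 = cst 0%E by apply/funext => t; rewrite /g rfunctional0 // mul0e.
    rewrite g0 rfunctional0 // mulr0; split; first exact: integrable0.
    by rewrite integral0.
  have [h1 h2] := integrable_indic_pos (ms x) (finx _ x0).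
  split; first exact: integrableZl.
  by rewrite /g integralZl // h2 -EFinM mulrC.
have sE : (EFin \o (phi \o s)) = (fun t => \sum_(x <- finmap.enum_fset (fset_set (range s))) g x t)%E.
  apply/funext => t /=.
  rewrite (finmap.big_fsetD1 (s t)) /=; last by rewrite in_fset_set // inE; exists t.
  rewrite big1_seq /=; last first.
    move=> x; rewrite finmap.in_fsetD1 => /andP[/eqP xs _].
    rewrite /g /I indicE memNset ?mule0 // => /= h; exact/xs/esym.
  by rewrite adde0 /g /I indicE mem_set // mule1.
split; first by rewrite sE; apply: integrable_sum => // x _; case: (ig x).
rewrite /rint /Rintegral -/(EFin \o (phi \o s)).
have -> : (\int[mu]_(t in pos) (EFin \o (phi \o s)) t)%E =
   (\sum_(x <- finmap.enum_fset (fset_set (range s))) fine (mu (pos `&` s @^-1` [set x])) * phi x)%:E.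
  rewrite sE integral_sum //; last by move=> x; case: (ig x).
  by rewrite -sumEFin; apply: eq_bigr => x _; case: (ig x).
rewrite /= /simple_integral fsbig_finite // rfunctional_sum //.
by apply: eq_bigr => x _; rewrite rfunctionalZ.
Qed.

Lemma cont_pos_rnormB f x : cont_pos f -> cont_pos (fun t => rnorm (f t - x)).
Proof.
by move=> cf r r0; apply: rnorm_cvg; apply: cvgB; [exact: cf|exact: cvg_cst].
Qed.

Lemma measurable_rnormB f s : cont_pos f -> simple_function mu pos s ->
  measurable_fun pos (fun t => rnorm (f t - s t)).
Proof.
move=> cf [fs ms _] mp Y mY.
have -> : pos `&` (fun t => rnorm (f t - s t)) @^-1` Y =
  \bigcup_(x in range s) ((pos `&` (fun t => rnorm (f t - x)) @^-1` Y) `&` s @^-1` [set x]).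
  apply/seteqP; split=> [t /= [pt Yt]|t [_ [u _ <-]] /= [[pt Yt] e]].
    by exists (s t) => //; exists t.
  by split=> //; rewrite e.
apply: fin_bigcup_measurable => // x _; apply: measurableI => //.
exact: (measurable_cont_pos (cont_pos_rnormB (x := x) cf) mp mY).
Qed.

Lemma simple_integral_dist phi C f s : rfunctional phi -> 0 <= C ->
  (forall x, `|phi x| <= C * rnorm x) -> cont_pos f ->
  simple_function mu pos s -> mu.-integrable pos (EFin \o (phi \o f)) ->
  (`|phi (simple_integral mu pos s) - rint (phi \o f)|%:E <=
  C%:E * \int[mu]_(t in pos) (rnorm (f t - s t))%:E)%E.
Proof.
move=> hp C0 hC cf ss i2.
have mp : measurable pos by exact: measurable_itv.
have [i1 ->] := simple_integral_functional hp ss.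
have mrn : measurable_fun pos (EFin \o (fun t => rnorm (f t - s t))).
  by apply/measurable_EFinP; exact: measurable_rnormB.
have iB : mu.-integrable pos (EFin \o (fun t => phi (s t) - phi (f t))).
  exact: (integrableB mp i1 i2).
rewrite /rint -RintegralB // EFin_normr_Rintegral //.
apply: le_trans (le_abse_integral _ _ _) _ => //; first by case/integrableP : iB.
rewrite -ge0_integralZl //; last by move=> t _; rewrite lee_fin rnorm_ge0.
apply: ge0_le_integral => //.
- by apply: measurableT_comp => //; case/integrableP : iB.
- by apply: measurable_funeM.
- move=> t _ /=; rewrite -EFinM lee_fin -rfunctionalB // rnorm_distC.
  exact: hC.
Qed.

(** Valid for every approximating sequence, so the value picked by [get] can be computed without
    knowing which sequence produced it. *)
Lemma bochner_functional phi f (s : nat -> measurableTypeR R -> X) v : rfunctional phi -> cont_pos f ->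
  mu.-integrable pos (EFin \o (phi \o f)) -> bochner_approx mu pos f s ->
  simple_integral mu pos (s n) @[n --> \oo] --> v -> phi v = rint (phi \o f).
Proof.
move=> hp cf i2 [ss _ hs] hv.
have [C C0 hC] := rfunctional_bound hp.
have h1 : phi (simple_integral mu pos (s n)) @[n --> \oo] --> phi v by exact: rfunctional_cvg hp hv.
have h2 : (`|phi (simple_integral mu pos (s n)) - rint (phi \o f)|%:E)%E @[n --> \oo] --> 0%E.
  apply: (@squeeze_cvge _ _ _ _ (fun=> 0%E) _
    (fun n => (C%:E * \int[mu]_(t in pos) (rnorm (f t - s n t))%:E)%E)).
  - by apply: nearW => n; rewrite lee_fin normr_ge0 simple_integral_dist.
  - exact: cvg_cst.
  - by rewrite -[X in _ --> X](mule0 C%:E); apply: cvgeZl.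
have h3 : `|phi v - rint (phi \o f)| = 0.
  move/fine_cvgP : h2 => [_ h2]; apply: cvg_unique h2 => //.
  by apply: cvg_norm; exact: cvgB h1 (cvg_cst _).
by apply/eqP; rewrite -subr_eq0 -normr_eq0 h3.
Qed.

End SimpleFunctions.

(** * Dyadic step functions and existence of the Bochner integral *)

Section BochnerExistence.
Context {R : realType} {X : completeNormedModType R[i]}.
Local Notation mu := (@lebesgue_measure R).
Local Notation pos := (`]0, +oo[%classic : set (measurableTypeR R)).
Implicit Types (f : measurableTypeR R -> X) (C a t q : R) (n j : nat).

Definition dyad_index n t := Num.trunc (t * 2 ^+ n).
Definition dyad_cell n j : set (measurableTypeR R) :=
  `[j%:R / 2 ^+ n, j.+1%:R / 2 ^+ n[%classic.
(** The value at the left endpoint of the cell. It is 0 on the first cell, whose left endpoint 0 is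
    outside the domain of interest, and from 2^n = 4^n / 2^n on, so that the range is finite and the
    support has finite measure. *)
Definition dyad_val f n j : X := if (0 < j < 4 ^ n)%N then f (j%:R / 2 ^+ n) else 0.
Definition dyad_approx f n (t : measurableTypeR R) : X := dyad_val f n (dyad_index n t).

(** Cell 0 is excluded because [Num.trunc] also sends negative numbers to 0. *)
Lemma dyad_cellP n j t : dyad_cell n j.+1 t <-> dyad_index n t = j.+1.
Proof.
rewrite /dyad_cell /= in_itv /= ler_pdivrMr ?exprn_gt0 // ltr_pdivlMr ?exprn_gt0 //.
split=> [h|/eqP].
  by apply/eqP; rewrite eqn_leq truncn_le_nat truncn_gt_nat andbC.
by rewrite eqn_leq truncn_le_nat truncn_gt_nat andbC.
Qed.

Lemma simple_dyad f n : simple_function mu pos (dyad_approx f n).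
Proof.
have fin (P : set nat) : finite_set (P `&` `I_(4 ^ n)).
  by apply: sub_finite_set (finite_II (4 ^ n)) => j [].
have mc j : measurable (dyad_cell n j) by exact: measurable_itv.
have pre0 x : x != 0 -> dyad_approx f n @^-1` [set x] =
    \bigcup_(j in [set j | (0 < j)%N /\ dyad_val f n j = x] `&` `I_(4 ^ n)) dyad_cell n j.
  move=> x0; apply/seteqP; split=> [t /= tx|t [[|j] [[//= _ jx] jn] /dyad_cellP e]]; last first.
    by rewrite /= /dyad_approx e.
  move: tx x0; rewrite /dyad_approx {1}/dyad_val; case: ifP => [/andP[k0 kn] fx _|_ <-]; last by rewrite eqxx.
  exists (dyad_index n t); first by split=> //=; split=> //; rewrite /dyad_val k0 kn.
  by rewrite -(prednK k0); apply/dyad_cellP; rewrite (prednK k0).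
have ms x : measurable (dyad_approx f n @^-1` [set x]).
  have [->|x0] := eqVneq x 0; last first.
    by rewrite pre0 //; exact: fin_bigcup_measurable.
  (* The value 0 is also taken outside all cells, so its preimage is obtained as the complement of
     the others. *)
  have -> : dyad_approx f n @^-1` [set 0] =
    ~` (\bigcup_(j in [set j | (0 < j)%N /\ dyad_val f n j != 0] `&` `I_(4 ^ n)) dyad_cell n j).
    apply/seteqP; split=> [t /= t0 [[|j] [[//= _ /eqP jx] jn] /dyad_cellP e]|t h /=].
      by apply: jx; rewrite -e.
    apply: contrapT => /eqP t0; apply: h.
    have : (dyad_approx f n @^-1` [set dyad_approx f n t]) t by [].
    rewrite pre0 // => -[j [[j0 jx] jn] jt]; exists j => //; split=> //; split=> //.
    by rewrite jx.
  by apply: measurableC; exact: fin_bigcup_measurable.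
split=> // [|x x0].
  apply: (@sub_finite_set _ _ (dyad_val f n @` `I_(4 ^ n))); last exact/finite_image/finite_II.
  move=> _ [t _ <-]; rewrite /dyad_approx.
  have [h|h] := ltnP (dyad_index n t) (4 ^ n); first by exists (dyad_index n t).
  exists 0%N; first by rewrite /= expn_gt0.
  by rewrite /dyad_val /= (ltnNge _ (4 ^ n)) h andbF.
have mI : measurable (`[0, (4 ^ n)%:R]%classic : set (measurableTypeR R)) by exact: measurable_itv.
apply: (@le_lt_trans _ _ (mu (`[0, (4 ^ n)%:R]%classic : set R))).
  apply: le_measure; rewrite ?inE //; first by apply: measurableI => //; exact: measurable_itv.
  move=> t [/posP t0]; rewrite pre0 // => -[j [_ /= jn] ] /=; rewrite !in_itv /= => /andP[_ h].
  rewrite (ltW t0) /=; apply: (le_trans (ltW h)); rewrite ler_pdivrMr ?exprn_gt0 //.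
  apply: (@le_trans _ _ ((4 ^ n)%:R * 1)); first by rewrite mulr1 ler_nat.
  by rewrite ler_wpM2l // exprn_ege1 // ler1n.
by rewrite lebesgue_measure_itv /=; case: ifP => // _; rewrite -EFinB ltry.
Qed.

Lemma cvg_dyad_index t : 0 < t ->
  (\forall n \near \oo, (0 < dyad_index n t < 4 ^ n)%N) /\
  (dyad_index n t)%:R / 2 ^+ n @[n --> \oo] --> t.
Proof.
move=> t0.
have c0 : ((2 : R) ^+ n)^-1 @[n --> \oo] --> (0 : R).
  under eq_fun do rewrite -exprVn.
  by apply: cvg_expr; rewrite ger0_norm ?invr_ge0 // invf_lt1 // ltr1n.
have cy : (2 : R) ^+ n @[n --> \oo] --> +oo.
  by apply/gtr0_cvgV0 => //; apply: nearW => n; rewrite exprn_gt0.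
split.
  near=> n; rewrite truncn_gt0 truncn_lt_nat; last by rewrite mulr_ge0 ?exprn_ge0 // ltW.
  apply/andP; split.
    rewrite -ler_pdivrMl // mulr1; near: n.
    by move/cvgryPge : cy; exact.
  rewrite -[(4 : nat)]/((2 * 2)%N) expnMn natrM natrX ltr_pM2r ?exprn_gt0 //.
  by near: n; move/cvgryPgt : cy; exact.
apply: (squeeze_cvgr (f := fun n => t - (2 ^+ n)^-1) (h := fun=> t)).
- apply: nearW => n; have /truncn_itv : 0 <= t * 2 ^+ n.
    by rewrite mulr_ge0 ?exprn_ge0 // ltW.
  rewrite -/(dyad_index n t) => /andP[h1 h2].
  rewrite [in X in _ && X]ler_pdivrMr ?exprn_gt0 // h1 andbT.
  rewrite ler_pdivlMr ?exprn_gt0 // mulrBl mulVf ?gt_eqF ?exprn_gt0 //.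
  by rewrite lerBlDr natr1 ltW.
- by rewrite -[X in _ --> X]subr0; apply: cvgB => //; exact: cvg_cst.
- exact: cvg_cst.
Unshelve. all: by end_near.
Qed.

(** Here q is the left endpoint of a dyadic cell of positive index containing t. Hence t <= 2 q, and
    the weight at q exceeds that at t by a bounded factor only. *)
Lemma wt_double a q t : 0 <= a -> 0 < q -> q <= t -> t <= 2 * q ->
  wt a q <= 2 * expR (a * ln 2) * wt a t.
Proof.
move=> a0 q0 qt t2; have t0 := lt_le_trans q0 qt.
have h0 : q^-1 <= 2 * t^-1.
  by rewrite ler_pdivlMr // -ler_pdivlMl ?invr_gt0 // invrK mulrC.
rewrite /wt mulrACA ler_pM ?invr_ge0 ?expR_ge0 ?(ltW q0) //.
rewrite -expRD ler_expR mulNr.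
have h1 : ln q <= ln t by rewrite ler_ln.
have h2 : ln t <= ln 2 + ln q by rewrite -lnM ?posrE // ler_ln ?posrE ?mulr_gt0.
have h3 : `|ln t| <= `|ln q| + ln 2.
  have l2 : 0 <= ln (2 : R) by rewrite ln_ge0 // ler1n.
  have := ler_norm (ln q); have := ler_norm (- ln q); rewrite normrN ler_norml => ? ?.
  by apply/andP; split; lra.
by nra.
Qed.

Lemma dyad_dominated f C a n t : 0 <= a -> 0 <= C -> 0 < t ->
  (forall r, 0 < r -> rnorm (f r) <= C * wt a r) ->
  rnorm (f t - dyad_approx f n t) <= C * (1 + 2 * expR (a * ln 2)) * wt a t.
Proof.
move=> a0 C0 t0 hf; apply: le_trans (rnormB _ _) _.
rewrite mulrDr mulr1 mulrDl lerD //; first exact: hf.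
rewrite /dyad_approx /dyad_val; case: ifP => [/andP[k0 _]|_]; last first.
  by rewrite rnorm0 !mulr_ge0 ?expR_ge0 ?invr_ge0 // ltW.
have q0 : 0 < (dyad_index n t)%:R / 2 ^+ n :> R by rewrite divr_gt0 ?exprn_gt0 ?ltr0n.
apply: le_trans (hf _ q0) _; rewrite -mulrA ler_wpM2l // wt_double //.
  rewrite ler_pdivrMr ?exprn_gt0 // /dyad_index truncn_le.
  by rewrite mulr_ge0 ?exprn_ge0 // ltW.
rewrite mulrA ler_pdivlMr ?exprn_gt0 //; apply: (le_trans (ltW (truncnS_gt _))).
by rewrite -natrM ler_nat mul2n -addnn -[leqLHS]addn1 leq_add2l.
Qed.

Lemma bochner_approx_dyad f C a : 0 < a -> cont_pos f ->
  (forall r, 0 < r -> rnorm (f r) <= C * wt a r) ->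
  bochner_approx mu pos f (dyad_approx f).
Proof.
move=> a0 cf hf.
have C0 : 0 <= C by rewrite -(pmulr_lge0 _ (wt_gt0 a ltr01)) (le_trans _ (hf _ ltr01)) // rnorm_ge0.
have ptw t : 0 < t -> dyad_approx f n t @[n --> \oo] --> f t.
  move=> t0; have [h1 h2] := cvg_dyad_index t0.
  apply: cvg_trans (cvg_comp _ _ h2 (cf t t0)); apply: near_eq_cvg.
  by apply: filterS h1 => n h; rewrite /dyad_approx /dyad_val h.
split; [exact: simple_dyad|by apply: aeW => t /posP; exact: ptw|].
pose g t := C * (1 + 2 * expR (a * ln 2)) * wt a t.
have ig : mu.-integrable pos (EFin \o g).
  apply: (@integrable_dominated _ (C * (1 + 2 * expR (a * ln 2))) a) => //.
    by move=> r r0; apply: cvgM; [exact: cvg_cst|exact: cont_pos_wt].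
  move=> r r0; rewrite ger0_norm // !mulr_ge0 ?addr_ge0 ?mulr_ge0 ?expR_ge0 ?invr_ge0 //.
  exact: ltW.
have mp : measurable pos by exact: measurable_itv.
have := @dominated_convergence _ _ _ mu pos mp
  (fun n t => (rnorm (f t - dyad_approx f n t))%:E) (cst 0%E) (EFin \o g).
case=> //.
- move=> n; apply/measurable_EFinP; apply: measurable_rnormB => //; exact: simple_dyad.
- apply: aeW => t /posP t0; apply: cvg_EFin; first exact: nearW.
  rewrite -[X in _ --> X](@rnorm0 R X) -(subrr (f t)).
  by apply: rnorm_cvg; apply: cvgB; [exact: cvg_cst|exact: ptw].
- apply: aeW => t n /posP t0; rewrite /= lee_fin ger0_norm ?rnorm_ge0 //.
  by apply: dyad_dominated => //; exact: ltW.
by rewrite integral0.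
Qed.

(** The Cauchy property is tested on a norming functional of the difference of two step integrals:
    it sends both close to the same number [rint (phi \o f)]. *)
Lemma bochner_cvg_dyad f C a : 0 < a -> cont_pos f ->
  (forall r, 0 < r -> rnorm (f r) <= C * wt a r) ->
  exists v : X, simple_integral mu pos (dyad_approx f n) @[n --> \oo] --> v.
Proof.
move=> a0 cf hf.
have ha := bochner_approx_dyad a0 cf hf; have [ss _ h] := ha.
have ip phi : rfunctional phi -> mu.-integrable pos (EFin \o (phi \o f)).
  move=> hp; have [D D0 hD] := rfunctional_bound hp.
  apply: (@integrable_dominated _ (D * C) a) => //.
    by move=> r r0; apply: rfunctional_cvg => //; exact: cf.
  by move=> r r0; rewrite (le_trans (hD _)) // -mulrA ler_wpM2l // hf.
suff : cvg (simple_integral mu pos (dyad_approx f n) @[n --> \oo]) by move/cvg_ex.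
apply: cauchy_cvg; apply: cauchy_exP => e e0.
have eE : e = (complex.Re e)%:C by rewrite RRe_real // gtr0_real.
rewrite eE in e0 *; move: e0; rewrite ltcR => e0.
set e' := complex.Re e in e0 *.
have e4 : 0 < e' / 4 by rewrite divr_gt0.
have [N _ hN] : \forall n \near \oo, (\int[mu]_(t in pos) (rnorm (f t - dyad_approx f n t))%:E <= (e' / 4)%:E)%E.
  move/fine_cvgP : h => [h1 /cvgr0Pnorm_le /(_ _ e4) h2].
  apply: filterS2 h1 h2 => n h1 h2.
  by rewrite -(fineK h1) lee_fin (le_trans (ler_norm _)).
exists (simple_integral mu pos (dyad_approx f N)).
exists N => // n /= Nn; rewrite -ball_normE /= -rnorm_lt.
set v := simple_integral _ _ _; set w := simple_integral _ _ _.
have [phi [hp h1 h2]] := norming_functional (v - w).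
have bd m : (N <= m)%N -> `|phi (simple_integral mu pos (dyad_approx f m)) - rint (phi \o f)| <= e' / 4.
  move=> Nm; rewrite -lee_fin.
  apply: le_trans (simple_integral_dist (C := 1) hp ler01 _ cf (ss m) (ip _ hp)) _.
    by move=> x; rewrite mul1r.
  by rewrite mul1e; exact: hN.
rewrite -h2 rfunctionalB //.
have := bd _ (leqnn N); have := bd _ Nn; rewrite -/v -/w !ler_norml => /andP[? ?] /andP[? ?].
lra.
Qed.

End BochnerExistence.

Section IntegralPos.
Context {R : realType} {X : completeNormedModType R[i]}.
Implicit Types (f : R -> X) (C a t : R).

Definition dominated C a f := [/\ 0 < a, cont_pos f & forall r, 0 < r -> rnorm (f r) <= C * wt a r].

Lemma integral_pos_functional C a f phi : dominated C a f -> rfunctional phi ->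
  phi (integral_pos f) = rint (phi \o f).
Proof.
move=> [a0 cf hf] hp.
have hp' := rfunctional_bound hp.
have [v hv] := bochner_cvg_dyad a0 cf hf.
have : [set v | exists2 s, bochner_approx (@lebesgue_measure R) `]0, +oo[ f s &
    simple_integral lebesgue_measure `]0, +oo[ (s n) @[n --> \oo] --> v] (integral_pos f).
  apply: (@getPex _ [set v | exists2 s, bochner_approx (@lebesgue_measure R) `]0, +oo[ f s &
    simple_integral lebesgue_measure `]0, +oo[ (s n) @[n --> \oo] --> v]).
  by exists v; exists (dyad_approx f) => //; exact: bochner_approx_dyad a0 cf hf.
move=> [s hs1 hs2]; apply: (bochner_functional hp cf _ hs1 hs2).
case: hp' => D D0 hD; apply: (@integrable_dominated _ (D * C) a) => //.
  by move=> r r0; apply: rfunctional_cvg => //; exact: cf.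
by move=> r r0; rewrite (le_trans (hD _)) // -mulrA ler_wpM2l // hf.
Qed.

Lemma integral_pos_mem C a f (S : set X) : dominated C a f -> S 0 ->
  (forall (b : R[i]) x y, S x -> S y -> S (b *: x + y)) ->
  (forall t, 0 < t -> S (f t)) -> closure S (integral_pos f).
Proof.
move=> df S0 SD Sf; have [a0 cf hf] := df.
have [v hv] := bochner_cvg_dyad a0 cf hf.
(* [integral_pos] is a choice by [get]; functionals identify it with the limit of the dyadic sums,
   which are combinations of values of f. *)
have -> : integral_pos f = v.
  apply: rfunctional_ext => phi hp; rewrite (integral_pos_functional df hp); apply/esym.
  apply: (bochner_functional hp cf _ _ hv); last exact: bochner_approx_dyad a0 cf hf.
  have [D D0 hD] := rfunctional_bound hp; apply: (@integrable_dominated _ (D * C) a) => //.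
    by move=> r r0; apply: rfunctional_cvg => //; exact: cf.
  by move=> r r0; rewrite (le_trans (hD _)) // -mulrA ler_wpM2l // hf.
apply: closed_cvg_mem hv; apply: nearW => n; apply: subset_closure.
have [fs _ _] := simple_dyad f n.
rewrite /simple_integral fsbig_finite //.
rewrite big_seq; apply: big_rec => // x y; rewrite in_fset_set // inE => -[t _ <-] Sy.
apply: SD => //; rewrite /dyad_approx /dyad_val; case: ifP => // /andP[k0 _].
by apply: Sf; rewrite divr_gt0 ?exprn_gt0 ?ltr0n.
Qed.

Lemma rnorm_integral_pos C a f : dominated C a f -> rnorm (integral_pos f) <= C * (4 / a).
Proof.
move=> df; have [a0 cf hf] := df.
have C0 : 0 <= C by rewrite -(pmulr_lge0 _ (wt_gt0 a ltr01)) (le_trans _ (hf _ ltr01)) // rnorm_ge0.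
have [phi [hp h1 h2]] := norming_functional (integral_pos f).
rewrite -h2 (integral_pos_functional df hp); apply: le_trans (ler_norm _) _.
apply: rint_dominated => //.
  by move=> r r0; apply: rfunctional_cvg => //; exact: cf.
by move=> r r0; apply: le_trans (h1 _) (hf _ r0).
Qed.

End IntegralPos.

Section Domination.
Context {R : realType}.
Implicit Types (a p q r C m : R).

Lemma wt_anti a b r : a <= b -> 0 < r -> wt b r <= wt a r.
Proof.
move=> ab r0; rewrite /wt ler_pM2l ?invr_gt0 // ler_expR !mulNr lerN2.
by rewrite ler_wpM2r.
Qed.

Lemma wt_le1 p a r : a <= p + 1 -> 0 < r -> r <= 1 -> expR (p * ln r) <= wt a r.
Proof.
move=> ap r0 r1; rewrite /wt -[r in r^-1](lnK r0) -expRN -expRD ler_expR.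
by have := ln_le0 r1 => l0; rewrite ler0_norm //; nra.
Qed.

Lemma wt_ge1 q a r : a <= - q - 1 -> 1 <= r -> expR (q * ln r) <= wt a r.
Proof.
move=> ap r1; have r0 : 0 < r by rewrite (lt_le_trans _ r1).
rewrite /wt -[r in r^-1](lnK r0) -expRN -expRD ler_expR.
by have := ln_ge0 r1 => l0; rewrite ger0_norm //; nra.
Qed.

(** The bound e^(-x) <= (m / x)^m, from ln (x / m) <= x / m - 1. *)
Lemma expRN_le_pow m (x : R) : 0 < m -> 0 < x -> expR (- x) <= expR (m * ln m) * expR (- (m * ln x)).
Proof.
move=> m0 x0; rewrite -expRD ler_expR.
have xm : 0 < x / m by rewrite divr_gt0.
have h : ln (x / m) <= x / m - 1.
  by have := @le_ln1Dx R (x / m - 1); rewrite addrCA subrr addr0; apply; lra.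
have : m * ln (x / m) <= x - m.
  by have := ler_wpM2l (ltW m0) h; rewrite mulrBr mulr1 mulrCA divff ?mulr1 // gt_eqF.
by rewrite ln_div ?posrE // mulrBr; lra.
Qed.

End Domination.

Section DominatedVectors.
Context {R : realType} {X : completeNormedModType R[i]}.
Implicit Types (f g F : R -> X) (a p q r C t : R).

Definition dom f := exists C a, dominated C a f.

(** p + 1 and - q - 1 are the parameters a for which [wt a] is r^p near 0 and r^q near oo; the
    smaller one gives the larger weight. *)
Lemma dominatedI C p q f : -1 < p -> q < -1 -> cont_pos f ->
  (forall r, 0 < r -> r <= 1 -> rnorm (f r) <= C * expR (p * ln r)) ->
  (forall r, 1 <= r -> rnorm (f r) <= C * expR (q * ln r)) ->
  dominated C (Num.min (p + 1) (- q - 1)) f.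
Proof.
move=> hp hq cf h1 h2; split=> //.
  by rewrite lt_min; apply/andP; split; lra.
have C0 : 0 <= C.
  have := h2 1 (lexx 1); rewrite ln1 mulr0 expR0 mulr1; apply: le_trans.
  exact: rnorm_ge0.
move=> r r0; have [r1|r1] := leP r 1.
  by apply: le_trans (h1 _ r0 r1) _; rewrite ler_wpM2l // wt_le1 // ge_min lexx.
apply: le_trans (h2 _ (ltW r1)) _.
rewrite ler_wpM2l //; apply: wt_ge1; last exact: ltW.
by rewrite ge_min lexx orbT.
Qed.

Lemma dominated_ge0 C a f : dominated C a f -> 0 <= C.
Proof.
move=> [a0 _ hf].
by rewrite -(pmulr_lge0 _ (wt_gt0 a ltr01)) (le_trans _ (hf _ ltr01)) // rnorm_ge0.
Qed.

Lemma domD f g : dom f -> dom g -> dom (fun t => f t + g t).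
Proof.
move=> [C [a hf]] [D [b hg]]; have C0 := dominated_ge0 hf; have D0 := dominated_ge0 hg.
have [a0 cf bf] := hf; have [b0 cg bg] := hg.
exists (C + D), (Num.min a b); split; first by rewrite lt_min a0.
  by move=> r r0; apply: cvgD; [exact: cf|exact: cg].
move=> r r0; apply: le_trans (rnormD _ _) _; rewrite mulrDl; apply: lerD.
  by apply: le_trans (bf _ r0) _; rewrite ler_wpM2l // wt_anti // ge_min lexx.
by apply: le_trans (bg _ r0) _; rewrite ler_wpM2l // wt_anti // ge_min lexx orbT.
Qed.

Lemma bounded_linear_cvg {Y : normedModType R[i]} {T} (F : set_system T) {FF : Filter F}
  (L : X -> Y) (K : R) (f : T -> X) l :
  (forall (a : R[i]) x y, L (a *: x + y) = a *: L x + L y) ->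
  (forall x, rnorm (L x) <= K * rnorm x) -> f @ F --> l -> L (f t) @[t --> F] --> L l.
Proof.
move=> hL hK /cvgr_rnorm0 h.
apply: (@squeeze_rnorm _ _ _ _ _ _ (fun x => K * rnorm (f x - l))).
  apply: nearW => x; have -> : L (f x) - L l = L (f x - l).
    by rewrite addrC -scaleN1r -hL scaleN1r addrC.
  exact: hK.
by rewrite -[X in _ --> X](mulr0 K); apply: cvgM => //; exact: cvg_cst.
Qed.

Lemma dom_linear {Y : completeNormedModType R[i]} (L : X -> Y) (K : R) f :
  (forall (a : R[i]) x y, L (a *: x + y) = a *: L x + L y) ->
  (forall x, rnorm (L x) <= K * rnorm x) -> dom f -> exists C a, dominated C a (L \o f).
Proof.
move=> hL hK [C [a [a0 cf bf]]].
exists (`|K| * C), a; split=> // r r0.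
  by apply: bounded_linear_cvg => //; exact: cf.
apply: le_trans (hK _) _; apply: (@le_trans _ _ (`|K| * rnorm (f r))).
  by rewrite ler_wpM2r ?rnorm_ge0 // ler_norm.
by rewrite -mulrA ler_wpM2l // bf.
Qed.

Lemma integral_pos_linear {Y : completeNormedModType R[i]} (L : X -> Y) (K : R) f :
  (forall (a : R[i]) x y, L (a *: x + y) = a *: L x + L y) ->
  (forall x, rnorm (L x) <= K * rnorm x) -> dom f ->
  integral_pos (L \o f) = L (integral_pos f).
Proof.
move=> hL hK df; have [C [a hf]] := df; have [C' [a' hLf]] := dom_linear hL hK df.
apply: rfunctional_ext => phi hp; rewrite (integral_pos_functional hLf hp).
by rewrite -[RHS]/((phi \o L) _) (integral_pos_functional hf (rfunctional_comp hp hL hK)).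
Qed.

Lemma domZ (c : R[i]) f : dom f -> dom (fun t => c *: f t).
Proof.
move=> df; apply: (@dom_linear _ (fun x => c *: x) (cabs c)) df => [b x y|x].
  by rewrite scalerDr !scalerA mulrC.
by rewrite rnormZ.
Qed.

Lemma domN f : dom f -> dom (fun t => - f t).
Proof.
by move=> /(domZ (-1)); under eq_fun do rewrite scaleN1r.
Qed.

Lemma integral_posZ (c : R[i]) f : dom f ->
  integral_pos (fun t => c *: f t) = c *: integral_pos f.
Proof.
move=> df; apply: (@integral_pos_linear _ (fun x => c *: x) (cabs c)) df => [b x y|x].
  by rewrite scalerDr !scalerA mulrC.
by rewrite rnormZ.
Qed.

Lemma rint_eq (g h : R -> R) : (forall r, 0 < r -> g r = h r) -> rint g = rint h.
Proof.
by move=> gh; apply: eq_Rintegral => r; rewrite inE => /posP; exact: gh.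
Qed.

Lemma integrable_functional phi f : dom f -> rfunctional phi ->
  (@lebesgue_measure R).-integrable `]0, +oo[ (EFin \o (phi \o f)).
Proof.
move=> [C [a [a0 cf hf]]] hp; have [D D0 hD] := rfunctional_bound hp.
apply: (@integrable_dominated _ (D * C) a) => //.
  by move=> r r0; apply: rfunctional_cvg => //; exact: cf.
by move=> r r0; rewrite (le_trans (hD _)) // -mulrA ler_wpM2l // hf.
Qed.

Lemma integral_posD f g : dom f -> dom g ->
  integral_pos (fun t => f t + g t) = integral_pos f + integral_pos g.
Proof.
move=> df dg; have [C [a hf]] := df; have [D [b hg]] := dg.
have [E [c hfg]] := domD df dg.
apply: rfunctional_ext => phi hp; rewrite rfunctionalD //.
apply: (etrans (integral_pos_functional hfg hp)).
have -> : phi (integral_pos f) = rint (phi \o f) := integral_pos_functional hf hp.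
have -> : phi (integral_pos g) = rint (phi \o g) := integral_pos_functional hg hp.
rewrite -(RintegralD _ (integrable_functional df hp) (integrable_functional dg hp)) //.
by apply: rint_eq => r r0; rewrite /= rfunctionalD.
Qed.

Lemma domB f g : dom f -> dom g -> dom (fun t => f t - g t).
Proof. by move=> df dg; apply: domD => //; exact: domN. Qed.

Lemma integral_posB f g : dom f -> dom g ->
  integral_pos (fun t => f t - g t) = integral_pos f - integral_pos g.
Proof.
move=> df dg; rewrite integral_posD //; last exact: domN.
congr (_ + _); under eq_fun do rewrite -scaleN1r.
by rewrite integral_posZ // scaleN1r.
Qed.

Lemma cont_pos_eq {V : topologicalType} (f g : R -> V) :
  (forall r, 0 < r -> f r = g r) -> cont_pos f -> cont_pos g.
Proof.
move=> fg cf r r0; rewrite -fg //; apply: cvg_trans (cf r r0).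
by apply: near_eq_cvg; near=> s; apply: fg; near: s; exact: near_pos.
Unshelve. all: by end_near.
Qed.

Lemma dominated_eq C a f g : (forall r, 0 < r -> f r = g r) -> dominated C a f -> dominated C a g.
Proof.
move=> fg [a0 cf bf]; split=> //; first exact: cont_pos_eq cf.
by move=> r r0; rewrite -fg // bf.
Qed.

Lemma dom_eq f g : (forall r, 0 < r -> f r = g r) -> dom f -> dom g.
Proof. by move=> fg [C [a h]]; exists C, a; exact: dominated_eq h. Qed.

Lemma integral_pos_eq f g : (forall r, 0 < r -> f r = g r) -> dom f ->
  integral_pos f = integral_pos g.
Proof.
move=> fg df; have dg := dom_eq fg df.
case: df => C [a hf]; case: dg => D [b hg].
apply: rfunctional_ext => phi hp; apply: (etrans (integral_pos_functional hf hp)).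
apply: etrans (esym (integral_pos_functional hg hp)).
by apply: rint_eq => r r0; rewrite /= fg.
Qed.

(** The derivative in a real variable with values in a space over [R[i]]. It is a relation, since
    [real_derive] is a [lim] and says nothing unless the limit exists. *)
Definition vderive F t (l : X) :=
  (h^-1)%:C *: (F (t + h) - F t) @[h --> (0 : R)^'] --> l.

Lemma vderive_functional F t l phi : vderive F t l -> rfunctional phi ->
  is_derive t 1 (phi \o F) (phi l).
Proof.
move=> hF hp.
have h : h^-1 *: ((phi \o F) (h *: 1 + t) - (phi \o F) t) @[h --> 0^'] --> phi l.
  have h1 : phi ((h^-1)%:C *: (F (t + h) - F t)) @[h --> (0 : R)^'] --> phi l by exact: rfunctional_cvg hp hF.
  apply: cvg_trans h1; apply: near_eq_cvg.
  apply: nearW => h; rewrite /= rfunctionalZ // rfunctionalB //.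
  by rewrite [X in phi (F (X + t))](_ : _ = h) ?[t + h]addrC // /GRing.scale /= mulr1.
apply: DeriveDef; first by apply/cvg_ex; exists (phi l).
exact: cvg_lim h.
Qed.

Lemma real_derive_vderive F t l : vderive F t l -> real_derive F t = l.
Proof. by move=> h; apply: cvg_lim h. Qed.

Lemma FTC_integral_pos f F l0 l1 : dom f -> (forall r, 0 < r -> vderive F r (f r)) ->
  F x @[x --> (0 : R)^'+] --> l0 -> F x @[x --> +oo] --> l1 -> integral_pos f = l1 - l0.
Proof.
move=> [C [a hf]] dF F0 F1; apply: rfunctional_ext => phi hp.
rewrite (integral_pos_functional hf hp) rfunctionalB //.
have [a0 cf bf] := hf; have [D D0 hD] := rfunctional_bound hp.
apply: (@FTC_pos _ (D * C) a _ (phi \o F)) => //.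
- by move=> r r0; apply: rfunctional_cvg => //; exact: cf.
- by move=> r r0; rewrite (le_trans (hD _)) // -mulrA ler_wpM2l // bf.
- by move=> r r0; apply: vderive_functional => //; exact: dF.
- exact: rfunctional_cvg.
- exact: rfunctional_cvg.
Qed.

Lemma cvg0_expR_absln C a F : 0 < a ->
  (forall r, 0 < r -> rnorm (F r) <= C * expR (- a * `|ln r|)) ->
  F x @[x --> (0 : R)^'+] --> 0 /\ F x @[x --> +oo] --> 0.
Proof.
move=> a0 hF; have [h1 h2] := expR_absln_cvg0 a0.
have z : (0 : R) = C * 0 by rewrite mulr0.
split; apply: (@squeeze_rnorm _ _ _ _ _ _ (fun r => C * expR (- a * `|ln r|))).
- by apply: near0_pos => r r0; rewrite subr0 hF.
- by rewrite [X in _ --> X]z; apply: cvgM => //; exact: cvg_cst.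
- by apply: neary_pos => r r0; rewrite subr0 hF.
- by rewrite [X in _ --> X]z; apply: cvgM => //; exact: cvg_cst.
Qed.

End DominatedVectors.

(** * Vector and complex calculus *)

Lemma cvg_near_eq {T} {V : topologicalType} (F : set_system T) {FF : Filter F} (f g : T -> V) (l : V) :
  (\forall x \near F, f x = g x) -> f @ F --> l -> g @ F --> l.
Proof. by move=> fg; apply: cvg_trans; exact: near_eq_cvg. Qed.

Lemma cvg_real {R : realType} {T} (F : set_system T) {FF : Filter F} (f : T -> R) (l : R) :
  f @ F --> l -> ((f t)%:C : Cx R) @[t --> F] --> (l%:C : Cx R).
Proof.
move=> /cvgrPdistC_le hf; apply/cvgr_rnormP => e e0.
apply: filterS (hf _ e0) => t h.
by rewrite -[X in rnorm X]/((f t)%:C - l%:C : R[i]) -rmorphB /= cabs_rnorm cabs_real.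
Qed.

Section CvgScale.
Context {R : realType} {X : normedModType R[i]}.

Lemma cvg_scale {T} (F : set_system T) {FF : Filter F} (c : T -> Cx R) (f : T -> X) (c0 : Cx R) l :
  c @ F --> c0 -> f @ F --> l -> (c t : R[i]) *: f t @[t --> F] --> (c0 : R[i]) *: l.
Proof.
move=> hc hf; apply: (@squeeze_rnorm _ _ _ _ _ _
  (fun t => rnorm (c t - c0) * rnorm (f t) + cabs c0 * rnorm (f t - l))).
  apply: nearW => t.
  have -> : (c t : R[i]) *: f t - (c0 : R[i]) *: l = (c t - c0 : R[i]) *: f t + (c0 : R[i]) *: (f t - l).
    by rewrite scalerBl scalerBr addrA subrK.
  by apply: le_trans (rnormD _ _) _; rewrite !rnormZ.
have -> : (0 : R) = 0 * rnorm l + cabs c0 * 0 by rewrite mul0r mulr0 addr0.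
apply: cvgD; apply: cvgM; [exact/cvgr_rnorm0|exact: rnorm_cvg|exact: cvg_cst|exact/cvgr_rnorm0].
Qed.

Lemma cvg_realP {T} (F : set_system T) {FF : Filter F} (f : T -> X) (r : R) (l : X) :
  f @ F --> l -> r%:C *: f t @[t --> F] --> r%:C *: l.
Proof. by move=> hf; apply: (cvg_scale (c := fun=> r%:C)) => //; exact: cvg_cst. Qed.

End CvgScale.

Section Vderive.
Context {R : realType} {X : completeNormedModType R[i]}.
Implicit Types (F G : R -> X) (c : R -> Cx R) (t h : R) (l : X).

Lemma near0_neq P : (forall h : R, h != 0 -> P h) -> \forall h \near (0 : R)^', P h.
Proof. by move=> H; near=> h; apply: H; near: h; exact: nbhs_dnbhs_neq. Unshelve. all: by end_near. Qed.

Lemma cvg_shift0 t : t + h @[h --> (0 : R)^'] --> t.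
Proof.
rewrite -[X in _ --> X]addr0; apply: cvgD; first exact: cvg_cst.
exact: cvg_within.
Qed.

Lemma vderive_continuous F t l : vderive F t l -> F x @[x --> t] --> F t.
Proof.
move=> hF; have h1 : F (t + h) @[h --> (0 : R)^'] --> F t.
  have z : F t = (0 : R)%:C *: l + F t by rewrite scale0r add0r.
  rewrite [X in _ --> X]z.
  have : (h%:C : R[i]) *: ((h^-1)%:C *: (F (t + h) - F t)) + F t @[h --> (0 : R)^'] --> (0 : R)%:C *: l + F t.
    apply: cvgD; last exact: cvg_cst.
    apply: (cvg_scale (c := fun h => h%:C)) => //.
    by apply: (cvg_real (f := id) (l := 0)); apply: cvg_within.
  apply: cvg_trans; apply: near_eq_cvg; apply: near0_neq => h h0.
  by rewrite scalerA -rmorphM divff // scale1r subrK.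
move/cvgr_rnormP : h1 => h1; apply/cvgr_rnormP => e e0.
have := h1 _ e0; rewrite !near_withinE => h2.
have h3 : \forall h \near (0 : R), rnorm (F (t + h) - F t) <= e.
  apply: filterS h2 => h; have [->|h0] := eqVneq h 0; last by apply.
  by move=> _; rewrite addr0 subrr rnorm0 ltW.
have h4 : \forall x \near t, rnorm (F x - F t) <= e; last exact: h4.
have -> := near_shift 0 t (fun x => rnorm (F x - F t) <= e).
by apply: filterS h3 => h /= hh; rewrite subr0 [h + t]addrC.
Qed.

Lemma vderiveD F G t l m : vderive F t l -> vderive G t m -> vderive (fun t => F t + G t) t (l + m).
Proof.
move=> hF hG; apply: (cvg_near_eq _ (cvgD hF hG)); apply: nearW => h.
by rewrite fctE -scalerDr opprD addrACA.
Qed.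

Lemma vderive_cst (l : X) t : vderive (fun=> l) t 0.
Proof.
rewrite /vderive; under eq_fun do rewrite subrr scaler0.
exact: cvg_cst.
Qed.

Lemma vderive_scale c F t (c' : Cx R) l :
  (h^-1)%:C *: (c (t + h) - c t) @[h --> (0 : R)^'] --> c' -> vderive F t l ->
  vderive (fun t => (c t : R[i]) *: F t) t ((c' : R[i]) *: F t + (c t : R[i]) *: l).
Proof.
move=> hc hF.
have cF : F (t + h) @[h --> (0 : R)^'] --> F t.
  exact: cvg_comp (cvg_shift0 (t := t)) (vderive_continuous hF).
apply: (cvg_near_eq _ (cvgD (cvg_scale hc cF) (cvg_scale (cvg_cst (c t)) hF))).
apply: nearW => h.
change (((h^-1)%:C * (c (t + h) - c t : R[i])) *: F (t + h) +
  (c t : R[i]) *: ((h^-1)%:C *: (F (t + h) - F t)) =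
  (h^-1)%:C *: ((c (t + h) : R[i]) *: F (t + h) - (c t : R[i]) *: F t)).
rewrite -scalerA (scalerA (c t : R[i])) (mulrC (c t : R[i])) -(scalerA _ (c t : R[i])) -scalerDr.
by rewrite scalerBl scalerBr addrA subrK.
Qed.

Lemma vderive_eq F G t l : (\forall x \near t, F x = G x) -> vderive F t l -> vderive G t l.
Proof.
move=> FG; have Ft := nbhs_singleton FG; apply: cvg_near_eq.
have : \forall h \near (0 : R)^', F (t + h) = G (t + h) by exact: (@cvg_shift0 t _ FG).
by apply: filterS => h ->; rewrite Ft.
Qed.

End Vderive.

Section ComplexCalculus.
Context {R : realType}.
Implicit Types (z w : R[i]) (r t : R).

Lemma cvg_complex {T} (F : set_system T) {FF : Filter F} (a b : T -> R) (x y : R) :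
  a @ F --> x -> b @ F --> y -> ((a t +i* b t) : Cx R) @[t --> F] --> (x +i* y : Cx R).
Proof.
move=> /cvgrPdistC_le ha /cvgrPdistC_le hb; apply/cvgr_rnormP => e e0.
have e2 : 0 < e / 2 by rewrite divr_gt0.
apply: filterS2 (ha _ e2) (hb _ e2) => t h1 h2.
by rewrite cabs_rnorm (le_trans (cabs_le _)) // (splitr e) lerD.
Qed.

Lemma vderive_complex (a b : R -> R) t (a' b' : R) :
  is_derive t 1 a a' -> is_derive t 1 b b' ->
  @vderive R (Cx R) (fun t => a t +i* b t) t (a' +i* b').
Proof.
have key (f : R -> R) f' : is_derive t 1 f f' -> h^-1 * (f (t + h) - f t) @[h --> (0 : R)^'] --> f'.
  case=> df <-; apply: (cvg_near_eq _ df); apply: nearW => h /=.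
  by have -> : h *: 1 + t = t + h by rewrite addrC; congr (_ + _); exact: mulr1.
move=> /key ha /key hb; apply: (cvg_near_eq _ (cvg_complex ha hb)).
by apply: nearW => h; rewrite /GRing.scale /=; simpc.
Qed.

Lemma vderive_real (a : R -> R) t (a' : R) :
  is_derive t 1 a a' -> @vderive R (Cx R) (fun x => (a x)%:C) t a'%:C.
Proof. by move=> ha; apply: (@vderive_complex a (cst 0)). Qed.

Lemma cexpD z w : cexp (z + w) = cexp z * cexp w.
Proof.
case: z => a b; case: w => c d; rewrite /cexp /= expRD cosD sinD.
by simpc; congr (_ +i* _); ring.
Qed.

Lemma cexp0 : cexp (0 : R[i]) = 1.
Proof. by rewrite /cexp /= expR0 cos0 sin0; simpc. Qed.

Lemma cabs_cexp z : cabs (cexp z) = expR (complex.Re z).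
Proof.
rewrite cabsM cabs_real ger0_norm ?expR_ge0 //.
by rewrite /cabs normc_def /= cos2Dsin2 sqrtr1 mulr1.
Qed.

Lemma cexp_real r : cexp (r%:C : R[i]) = (expR r)%:C.
Proof. by rewrite /cexp /= cos0 sin0; simpc. Qed.

Lemma cexp_neq0 z : cexp z != 0.
Proof.
apply/eqP => h; have := cabs_cexp z; rewrite h cabs0 => /eqP.
by rewrite lt_eqF // expR_gt0.
Qed.

Lemma cexpN z : cexp (- z) = (cexp z)^-1.
Proof.
by apply: (mulIf (cexp_neq0 z)); rewrite mulVf ?cexp_neq0 // -cexpD addNr cexp0.
Qed.

Lemma cpowD t z w : cpow t (z + w) = cpow t z * cpow t w.
Proof. by rewrite /cpow mulrDl cexpD. Qed.

Lemma cpowN t z : cpow t (- z) = (cpow t z)^-1.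
Proof. by rewrite /cpow mulNr cexpN. Qed.

Lemma cpow0 t : cpow t (0 : R[i]) = 1.
Proof. by rewrite /cpow mul0r cexp0. Qed.

Lemma cpow_neq0 t z : cpow t z != 0.
Proof. exact: cexp_neq0. Qed.

Lemma cpow_real t r : cpow t (r%:C : R[i]) = (expR (r * ln t))%:C.
Proof. by rewrite /cpow -rmorphM cexp_real. Qed.

Lemma cpow1 t : 0 < t -> cpow t (1 : R[i]) = t%:C.
Proof. by move=> t0; rewrite /cpow mul1r cexp_real lnK. Qed.

Lemma cpowM s t z : 0 < s -> 0 < t -> cpow (s * t) z = cpow s z * cpow t z.
Proof. by move=> s0 t0; rewrite /cpow lnM ?posrE // rmorphD /= mulrDr cexpD. Qed.

Lemma cpow1l z : cpow (1 : R) z = 1.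
Proof. by rewrite /cpow ln1 mulr0 cexp0. Qed.

Lemma cpowV s z : 0 < s -> cpow s^-1 z = (cpow s z)^-1.
Proof. by move=> s0; rewrite /cpow lnV ?posrE // rmorphN /= mulrN cexpN. Qed.

Lemma cabs_cpow t z : cabs (cpow t z) = expR (complex.Re z * ln t).
Proof. by rewrite cabs_cexp; case: z => a b /=; rewrite mulr0 subr0. Qed.

Lemma vderive_cexp (u : R -> R) (u' : R) z t : is_derive t 1 u u' ->
  @vderive R (Cx R) (fun x => cexp (z * (u x)%:C)) t (u'%:C * z * cexp (z * (u t)%:C)).
Proof.
move=> hu; case: z => a b.
have E x : cexp ((a +i* b) * (u x)%:C) =
  (expR (a * u x) * cos (b * u x)) +i* (expR (a * u x) * sin (b * u x)).
  by rewrite /cexp /=; simpc.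
under eq_fun do rewrite E.
rewrite E; set c' : R[i] := _ * _.
have -> : c' = (u' * (a * (expR (a * u t) * cos (b * u t)) - b * (expR (a * u t) * sin (b * u t))))
   +i* (u' * (a * (expR (a * u t) * sin (b * u t)) + b * (expR (a * u t) * cos (b * u t)))).
  by rewrite /c'; simpc; congr (_ +i* _); ring.
apply: (@vderive_complex (fun x => expR (a * u x) * cos (b * u x)) (fun x => expR (a * u x) * sin (b * u x)));
  by apply: is_derive_eq; rewrite /GRing.scale /=; ring.
Qed.

Lemma vderive_cpow z t : 0 < t ->
  @vderive R (Cx R) (fun x => cpow x z) t (z * cpow t (z - 1)).
Proof.
move=> t0; have -> : z * cpow t (z - 1) = (t^-1)%:C * z * cexp (z * (ln t)%:C).
  by rewrite cpowD cpowN cpow1 // fmorphV /cpow; ring.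
exact: (vderive_cexp (is_derive1_ln t0)).
Qed.

Lemma cont_pos_vderive {X : completeNormedModType R[i]} (F f : R -> X) :
  (forall r, 0 < r -> vderive F r (f r)) -> cont_pos F.
Proof. by move=> h r r0; apply: vderive_continuous (h r r0). Qed.

Lemma cont_pos_cpow z : @cont_pos R (Cx R) (fun t => cpow t z).
Proof. by apply: cont_pos_vderive => r r0; exact: vderive_cpow. Qed.

Lemma cont_pos_scale {X : completeNormedModType R[i]} (c : R -> Cx R) (f : R -> X) :
  cont_pos c -> cont_pos f -> cont_pos (fun r => (c r : R[i]) *: f r).
Proof. by move=> hc hf r r0; apply: cvg_scale; [exact: hc|exact: hf]. Qed.

Lemma cont_pos_real (f : R -> R) : cont_pos f -> @cont_pos R (Cx R) (fun t => (f t)%:C).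
Proof. by move=> hf r r0; apply: cvg_real; exact: hf. Qed.

End ComplexCalculus.

(** * Mean value inequality and integrals with exponential weights *)

Section ExponentialWeights.
Context {R : realType} {X : completeNormedModType R[i]}.
Implicit Types (F f g : R -> X) (a p s K C : R).

(** The real mean value theorem, applied to F composed with a norming functional of F u - F s. *)
Lemma vderive_bound F f (s u K : R) : s <= u ->
  (forall r, s <= r -> r <= u -> vderive F r (f r) /\ rnorm (f r) <= K) ->
  rnorm (F u - F s) <= K * (u - s).
Proof.
rewrite le_eqVlt => /orP[/eqP<- _|su h]; first by rewrite !subrr rnorm0 mulr0.
have [phi [hp h1 h2]] := norming_functional (F u - F s).
have inI r : r \in `]s, u[ -> s <= r /\ r <= u.
  by rewrite in_itv /= => /andP[/ltW ? /ltW ?].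
have dphi r : s <= r -> r <= u -> is_derive r 1 (phi \o F) (phi (f r)).
  by move=> r1 r2; have [h3 _] := h r r1 r2; exact: vderive_functional h3 hp.
have [||c /inI[c1 c2] e] := @MVT R (phi \o F) (phi \o f) s u su.
- by move=> r /inI[r1 r2]; exact: dphi.
- apply: derivable_within_continuous => r; rewrite in_itv /= => /andP[r1 r2].
  by case: (dphi r r1 r2).
rewrite -h2 rfunctionalB // -[phi (F u) - _]/((phi \o F) u - (phi \o F) s) e.
rewrite ler_pM2r ?subr_gt0 //; apply: le_trans (ler_norm _) _.
by apply: le_trans (h1 _) _; have [_] := h c c1 c2.
Qed.

Lemma vderive0_cst F : (forall r, 0 < r -> vderive F r 0) ->
  forall s u, 0 < s -> 0 < u -> F s = F u.
Proof.
move=> hF; suff H s u : 0 < s -> s <= u -> F s = F u.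
  move=> s u s0 u0; have [/H ->|/ltW /H ->] := leP s u => //.
move=> s0 su; apply/esym/eqP; rewrite -subr_eq0; apply/eqP; apply: rnorm_eq0.
apply/eqP; rewrite eq_le rnorm_ge0 andbT -[leRHS](mul0r (u - s)).
apply: (@vderive_bound _ (fun=> 0)) => // r r1 _; split; last by rewrite rnorm0.
by apply: hF; exact: lt_le_trans r1.
Qed.

Lemma dominated_le {Y : completeNormedModType R[i]} C a K (g : R -> Y) f : 0 <= K -> cont_pos f ->
  (forall r, 0 < r -> rnorm (f r) <= K * rnorm (g r)) -> dominated C a g -> dominated (K * C) a f.
Proof.
move=> K0 cf fg [a0 cg hg]; split=> // r r0.
by rewrite (le_trans (fg _ r0)) // -mulrA ler_wpM2l // hg.
Qed.

Lemma dom_le {Y : completeNormedModType R[i]} K (g : R -> Y) f : 0 <= K -> cont_pos f ->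
  (forall r, 0 < r -> rnorm (f r) <= K * rnorm (g r)) -> dom g -> dom f.
Proof. by move=> K0 cf fg [C [a hg]]; exists (K * C), a; exact: dominated_le hg. Qed.

(** r [wt a r] = e^(-a |ln r|) tends to 0 at both ends. This disposes of the boundary terms in
    integrations by parts. *)
Lemma dom_primitive_cvg0 {Y : completeNormedModType R[i]} (f : R -> Y) F K : 0 <= K -> dom f ->
  (forall r, 0 < r -> rnorm (F r) <= K * (r * rnorm (f r))) ->
  F x @[x --> (0 : R)^'+] --> 0 /\ F x @[x --> +oo] --> 0.
Proof.
move=> K0 [C [a [a0 cf hf]]] h; apply: (@cvg0_expR_absln _ _ (K * C) a) => // r r0.
apply: le_trans (h r r0) _; rewrite -mulrA ler_wpM2l //.
apply: le_trans (ler_wpM2l (ltW r0) (hf _ r0)) _.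
by rewrite /wt mulrCA (mulrA r) divff ?mul1r // gt_eqF.
Qed.

Lemma dom_exp p s K f : -1 < p -> 0 < s -> cont_pos f ->
  (forall r, 0 < r -> rnorm (f r) <= K * expR (p * ln r)) ->
  dom (fun r => (expR (- (s * r)))%:C *: f r).
Proof.
move=> hp s0 cf hf.
have K0 : 0 <= K.
  by have := hf 1 ltr01; rewrite ln1 mulr0 expR0 mulr1; apply: le_trans; exact: rnorm_ge0.
have m0 : 0 < p + 2 by lra.
(* For r >= 1, e^(-s r) is traded for L r^(-p-2), which leaves r^-2 at infinity. *)
pose L := expR ((p + 2) * ln (p + 2)) * expR (- ((p + 2) * ln s)).
have L0 : 0 <= L by rewrite mulr_ge0 ?expR_ge0.
exists (K * (1 + L)), (Num.min (p + 1) (- (-2) - 1)); apply: dominatedI => //.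
- by lra.
- apply: cont_pos_scale => //; apply: cont_pos_real => r r0.
  apply: continuous_comp; last exact: continuous_expR.
  by apply: cvgN; apply: cvgM; [exact: cvg_cst|exact: cvg_id].
- move=> r r0 r1; rewrite rnormZR ger0_norm ?expR_ge0 //.
  apply: (@le_trans _ _ (1 * (K * expR (p * ln r)))).
    apply: ler_pM; rewrite ?expR_ge0 ?rnorm_ge0 ?hf //.
    by rewrite -expR0 ler_expR oppr_le0 mulr_ge0 // ltW.
  by rewrite mul1r ler_wpM2r ?expR_ge0 // mulrDr mulr1 lerDl mulr_ge0.
- move=> r r1; have r0 : 0 < r by rewrite (lt_le_trans _ r1).
  rewrite rnormZR ger0_norm ?expR_ge0 //.
  apply: (@le_trans _ _ ((L * expR (- ((p + 2) * ln r))) * (K * expR (p * ln r)))).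
    apply: ler_pM; rewrite ?expR_ge0 ?rnorm_ge0 ?hf //.
    apply: le_trans (expRN_le_pow m0 (mulr_gt0 s0 r0)) _.
    by rewrite lnM ?posrE // mulrDr opprD expRD mulrA.
  rewrite mulrACA -expRD [L * K]mulrC.
  have -> : - ((p + 2) * ln r) + p * ln r = -2 * ln r by ring.
  by rewrite ler_wpM2r ?expR_ge0 // ler_wpM2l // lerDr.
Qed.

Lemma dom_expV p s K f : p < -1 -> 0 < s -> cont_pos f ->
  (forall r, 0 < r -> rnorm (f r) <= K * expR (p * ln r)) ->
  dom (fun r => (expR (- (s * r^-1)))%:C *: f r).
Proof.
move=> hp s0 cf hf.
have K0 : 0 <= K.
  by have := hf 1 ltr01; rewrite ln1 mulr0 expR0 mulr1; apply: le_trans; exact: rnorm_ge0.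
have m0 : 0 < - p by lra.
(* For r <= 1, e^(-s/r) is traded for L r^(-p), which cancels r^p and leaves a bounded function. *)
pose L := expR (- p * ln (- p)) * expR (- (- p * ln s)).
have L0 : 0 <= L by rewrite mulr_ge0 ?expR_ge0.
exists (K * (1 + L)), (Num.min (0 + 1) (- p - 1)); apply: dominatedI => //.
- apply: cont_pos_scale => //; apply: cont_pos_real => r r0.
  apply: continuous_comp; last exact: continuous_expR.
  apply: cvgN; apply: cvgM; [exact: cvg_cst|].
  by apply: cvgV; [rewrite gt_eqF|exact: cvg_id].
- move=> r r0 r1; rewrite rnormZR ger0_norm ?expR_ge0 //.
  have ri : 0 < r^-1 by rewrite invr_gt0.
  apply: (@le_trans _ _ ((L * expR (- (- p * ln r^-1))) * (K * expR (p * ln r)))).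
    apply: ler_pM; rewrite ?expR_ge0 ?rnorm_ge0 ?hf //.
    apply: le_trans (expRN_le_pow m0 (mulr_gt0 s0 ri)) _.
    by rewrite lnM ?posrE // mulrDr opprD expRD mulrA.
  rewrite mulrACA -expRD [L * K]mulrC lnV ?posrE //.
  have -> : - (- p * - ln r) + p * ln r = 0 * ln r by ring.
  by rewrite ler_wpM2r ?expR_ge0 // ler_wpM2l // lerDr.
- move=> r r1; have r0 : 0 < r by rewrite (lt_le_trans _ r1).
  rewrite rnormZR ger0_norm ?expR_ge0 //.
  apply: (@le_trans _ _ (1 * (K * expR (p * ln r)))).
    apply: ler_pM; rewrite ?expR_ge0 ?rnorm_ge0 ?hf //.
    by rewrite -expR0 ler_expR oppr_le0 mulr_ge0 ?invr_ge0 // ltW.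
  by rewrite mul1r ler_wpM2r ?expR_ge0 // mulrDr mulr1 lerDl mulr_ge0.
Qed.

(** Both halves of [key] are instances of 1 + x <= e^x, at x and at - x. *)
Lemma expR_taylor2 (y : R) : `|expR y - 1 - y| <= y ^+ 2 * expR `|y|.
Proof.
have key (x : R) : 0 <= expR x - 1 - x <= x * (expR x - 1).
  apply/andP; split; first by have := expR_ge1Dx x; lra.
  have h := expR_ge1Dx (- x); have e : expR x * expR (- x) = 1 by rewrite -expRD subrr expR0.
  have := expR_gt0 x; nra.
have /andP[h1 h2] := key y; rewrite ger0_norm //; apply: (le_trans h2).
rewrite expr2 -mulrA.
have [y0|y0] := leP 0 y.
  rewrite ler_wpM2l // ger0_norm //.
  have h := expR_ge1Dx (- y); have e : expR y * expR (- y) = 1 by rewrite -expRD subrr expR0.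
  by have := expR_gt0 y; nra.
rewrite ler_wnM2l ?(ltW y0) // ltr0_norm //.
have h3 := expR_ge1Dx y; have h4 : 1 <= expR (- y) by rewrite -expR0 ler_expR; lra.
nra.
Qed.

(** Differentiation under the integral. For |h| <= s/2 the second-order remainder of e^(-(s+h) w) is
    at most h^2 w^2 e^(-(s/2) w), which is why the weight w^2 must be integrable for every positive
    parameter. *)
Lemma vderive_exp_integral (w : R -> R) f s : 0 < s -> cont_pos w ->
  (forall r, 0 < r -> 0 < w r) -> cont_pos f ->
  (forall u, 0 < u -> dom (fun r => (expR (- (u * w r)))%:C *: f r)) ->
  (forall u, 0 < u -> dom (fun r => (expR (- (u * w r)))%:C *: ((w r)%:C *: f r))) ->
  (forall u, 0 < u -> dom (fun r => (expR (- (u * w r)))%:C *: ((w r ^+ 2)%:C *: f r))) ->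
  vderive (fun u => integral_pos (fun r => (expR (- (u * w r)))%:C *: f r)) s
    (- integral_pos (fun r => (expR (- (s * w r)))%:C *: ((w r)%:C *: f r))).
Proof.
move=> s0 cw w0 cf d0 d1 d2.
pose I u := integral_pos (fun r => (expR (- (u * w r)))%:C *: f r).
pose I1 := integral_pos (fun r => (expR (- (s * w r)))%:C *: ((w r)%:C *: f r)).
have s2 : 0 < s / 2 by rewrite divr_gt0.
have [C [a hd2]] := d2 _ s2.
have cE u : cont_pos (fun r => expR (- (u * w r))).
  move=> r r0; apply: continuous_comp; last exact: continuous_expR.
  by apply: cvgN; apply: cvgM; [exact: cvg_cst|exact: cw].
have key h : `|h| <= s / 2 -> rnorm (I (s + h) - I s + h%:C *: I1) <= h ^+ 2 * C * (4 / a).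
  move=> hs; have sh : 0 < s + h.
    by move: hs; rewrite ler_norml => /andP[? ?]; lra.
  have dh := domZ h%:C (d1 _ s0).
  have dB := domB (d0 _ sh) (d0 _ s0).
  rewrite /I -(integral_posB (d0 _ sh) (d0 _ s0)) /I1 -(integral_posZ h%:C (d1 _ s0)).
  rewrite -(integral_posD dB dh).
  apply: (@rnorm_integral_pos _ _ (h ^+ 2 * C) a).
  apply: (dominated_le _ _ _ hd2); first exact: sqr_ge0.
    by have [C' [a' [_ cD _]]] := domD dB dh; exact: cD.
  move=> r r0; set E := expR (- (s * w r)).
  have -> : (expR (- ((s + h) * w r)))%:C *: f r - E%:C *: f r +
     h%:C *: (E%:C *: ((w r)%:C *: f r)) =
     (E * (expR (- (h * w r)) - 1 - (- (h * w r))))%:C *: f r.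
    rewrite mulrDl opprD expRD -/E !scalerA -!rmorphM -scalerBl -scalerDl -rmorphB -rmorphD.
    by congr (_%:C *: _); ring.
  rewrite rnormZR (rnormZR _ (_ *: _)) rnormZR !mulrA ler_wpM2r ?rnorm_ge0 //.
  rewrite normrM ger0_norm ?expR_ge0 //.
  apply: (@le_trans _ _ (E * ((- (h * w r)) ^+ 2 * expR `|- (h * w r)|))).
    by rewrite ler_wpM2l ?expR_ge0 // expR_taylor2.
  rewrite sqrrN exprMn normrN normrM (ger0_norm (ltW (w0 _ r0))) [X in _ * (X * _)]mulrC.
  rewrite !(ger0_norm (expR_ge0 _)) (ger0_norm (sqr_ge0 (w r))).
  rewrite [leLHS](_ : _ = (h ^+ 2 * (E * expR (`|h| * w r))) * w r ^+ 2); last by ring.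
  rewrite ler_wpM2r ?sqr_ge0 // ler_wpM2l ?sqr_ge0 // -expRD ler_expR.
  by have := w0 _ r0; nra.
rewrite /vderive -/I -/I1.
apply: (@squeeze_rnorm _ _ _ _ _ _ (fun h => `|h| * (C * (4 / a)))).
  have hs : \forall h \near (0 : R)^', `|h| <= s / 2.
    by apply: nbhs_dnbhs; apply: filterS (nbhs0_le s2) => h.
  near=> h; have h0 : h != 0 by near: h; exact: nbhs_dnbhs_neq.
  have -> : (h^-1)%:C *: (I (s + h) - I s) - - I1 = (h^-1)%:C *: (I (s + h) - I s + h%:C *: I1).
    by rewrite [RHS]scalerDr scalerA -rmorphM mulVf // scale1r opprK.
  rewrite rnormZR normfV ler_pdivrMl ?normr_gt0 //.
  apply: (@le_trans _ _ (h ^+ 2 * C * (4 / a))); first by apply: key; near: h.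
  by rewrite !mulrA -normrM -expr2 ger0_norm ?sqr_ge0.
rewrite -[X in _ --> X](mul0r (C * (4 / a))); apply: cvgM; last exact: cvg_cst.
by rewrite -[X in _ --> X](normr0 R); apply: cvg_norm; exact: cvg_within.
Unshelve. all: by end_near.
Qed.

End ExponentialWeights.

(** * The Gamma function *)

Section GammaKernel.
Context {R : realType}.
Implicit Types (z a : R[i]) (r s u : R) (n : nat).

Definition ekern s z r : Cx R := (expR (- (s * r)))%:C *: (cpow r z : Cx R).
(** The exponent is z and not z - 1: [eint 1 z] is Gamma(z + 1). *)
Definition eint s z : R[i] := integral_pos (ekern s z).

Lemma ReD z a : complex.Re (z + a) = complex.Re z + complex.Re a.
Proof. by case: z => ? ?; case: a. Qed.

Lemma Re1 : complex.Re (1 : R[i]) = 1.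
Proof. by []. Qed.

Lemma dom_ekern s z : 0 < s -> -1 < complex.Re z -> dom (ekern s z).
Proof.
move=> s0 z1; apply: (@dom_exp _ _ (complex.Re z) s 1) => //.
  exact: cont_pos_cpow.
by move=> r r0; rewrite mul1r cabs_rnorm cabs_cpow.
Qed.

Lemma cGammaE z : cGamma z = eint 1 (z - 1).
Proof.
have e : (fun t => cpow t (z - 1) * (expR (- t))%:C : Cx R) = ekern 1 (z - 1).
  by apply/funext => t; rewrite /ekern mul1r [LHS]mulrC.
by rewrite /eint -e.
Qed.

Lemma is_derive_expRN s r : is_derive r 1 (fun x => expR (- (s * x))) (- s * expR (- (s * r))).
Proof. by apply: is_derive_eq; rewrite /GRing.scale /=; ring. Qed.

(** The derivative of e^(-s r) r^(z+1) has integral 0; for s = 1 this is the functional equation of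
    Gamma. *)
Lemma eintS s z : 0 < s -> -1 < complex.Re z -> s%:C * eint s (z + 1) = (z + 1) * eint s z.
Proof.
move=> s0 z1; have z2 : -1 < complex.Re (z + 1) by rewrite ReD Re1; lra.
have d0 := domZ (z + 1) (dom_ekern s0 z1); have d1 := domZ s%:C (dom_ekern s0 z2).
have dB := domB d0 d1.
pose F r : Cx R := (expR (- (s * r)))%:C *: (cpow r (z + 1) : Cx R).
have [F0 F1] : F x @[x --> (0 : R)^'+] --> 0 /\ F x @[x --> +oo] --> 0.
  apply: (@dom_primitive_cvg0 _ _ _ (ekern s z) F 1) => //; first exact: dom_ekern.
  move=> r r0; rewrite mul1r /F /ekern !rnormZR !cabs_rnorm cpowD cabsM cpow1 // cabs_real.
  by rewrite [X in _ <= X]mulrCA (ger0_norm (ltW r0)) [cabs _ * r]mulrC.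
have := FTC_integral_pos dB _ F0 F1; rewrite subr0 => h.
apply/esym/eqP; rewrite -subr_eq0; apply/eqP.
rewrite -[RHS]h.
  by rewrite (integral_posB d0 d1) integral_posZ ?integral_posZ //; exact: dom_ekern.
move=> r r0.
have v1 := vderive_scale (vderive_real (is_derive_expRN s r)) (vderive_cpow (z := z + 1) r0).
have -> : (z + 1) *: ekern s z r - s%:C *: ekern s (z + 1) r =
  ((- s * expR (- (s * r)))%:C *: (cpow r (z + 1) : Cx R)) +
  ((expR (- (s * r)))%:C *: ((z + 1) * cpow r (z + 1 - 1) : Cx R)); last exact: v1.
rewrite addrK /ekern /GRing.scale /= rmorphM rmorphN.
by ring.
Qed.

(** Instead of a change of variables: u^(z+1) [eint u z] has derivative 0 in u, by [eintS], and is
    compared at s and 1. *)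
Lemma eint_scale s z : 0 < s -> -1 < complex.Re z -> eint s z = eint 1 z * cpow s (- (z + 1)).
Proof.
move=> s0 z1; have z2 : -1 < complex.Re (z + 1) by rewrite ReD Re1; lra.
have z3 : -1 < complex.Re (z + 1 + 1) by rewrite ReD Re1; lra.
pose H u : Cx R := cpow u (z + 1) *: (eint u z : Cx R).
have dH u : 0 < u -> vderive H u 0.
  move=> u0.
  have v1 : vderive (fun v : R => eint v z : Cx R) u (- eint u (z + 1) : Cx R).
    have e r : (r%:C *: (cpow r z : Cx R)) = (r%:C * cpow r z : R[i]) by [].
    have d1 v : 0 < v -> dom (fun r => (expR (- (v * r)))%:C *: (r%:C *: (cpow r z : Cx R))).
      move=> v0; apply: dom_eq (dom_ekern v0 z2) => r r0.
      by rewrite /ekern e cpowD cpow1 // [cpow r z * _]mulrC.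
    have d2 v : 0 < v -> dom (fun r => (expR (- (v * r)))%:C *: ((r ^+ 2)%:C *: (cpow r z : Cx R))).
      move=> v0; apply: dom_eq (dom_ekern v0 z3) => r r0.
      rewrite /ekern; congr (_ *: _); rewrite !cpowD cpow1 // rmorphXn /=.
      by rewrite -[RHS]/((r%:C ^+ 2 : R[i]) * cpow r z) expr2; ring.
    have := @vderive_exp_integral R (Cx R) id (fun r => cpow r z) u u0.
    move=> /(_ _ _ _ _ d1 d2) h.
    have -> : eint u (z + 1) = integral_pos (fun r => (expR (- (u * r)))%:C *: (r%:C *: (cpow r z : Cx R))).
      apply: (@integral_pos_eq R (Cx R) (ekern u (z + 1))); last exact: dom_ekern.
      by move=> r r0; rewrite /ekern e cpowD cpow1 // [cpow r z * _]mulrC.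
    have cid : @cont_pos R R id by move=> r _; exact: cvg_id.
    have d0 v : 0 < v -> dom (fun r => (expR (- (v * r)))%:C *: (cpow r z : Cx R)).
      by move=> v0; exact: (dom_ekern v0 z1).
    have cz : @cont_pos R (Cx R) (fun r => cpow r z) by exact: cont_pos_cpow.
    have h2 := h cid (fun _ p => p) cz d0.
    exact h2.
  have v2 := vderive_scale (vderive_cpow (z := z + 1) u0) v1.
  have e : ((z + 1) * cpow u (z + 1 - 1)) * eint u z + cpow u (z + 1) * (- eint u (z + 1)) = 0.
    rewrite addrK [X in X * - _](_ : _ = cpow u z * u%:C); last by rewrite cpowD cpow1.
    by rewrite mulrN -[X in _ - X]mulrA eintS //; ring.
  by rewrite -[X in vderive _ _ X]e; exact: v2.
have : cpow s (z + 1) * eint s z = cpow 1 (z + 1) * eint 1 z := vderive0_cst dH s0 ltr01.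
rewrite cpow1l mul1r => <-; rewrite cpowN mulrC mulrA mulVf ?mul1r //; exact: cpow_neq0.
Qed.

Lemma eint10 : eint 1 0 = 1.
Proof.
have z1 : -1 < complex.Re (0 : R[i]) by rewrite /=; lra.
have d := dom_ekern (@ltr01 R) z1.
pose F r : Cx R := (- expR (- (1 * r)))%:C.
have F0 : F x @[x --> (0 : R)^'+] --> (((- 1 : R)%:C) : Cx R).
  apply: (cvg_real (f := fun x => - expR (- (1 * x)))); apply: cvg_at_right_filter.
  have -> : (- 1 : R) = - expR (- (1 * 0)) by rewrite mulr0 oppr0 expR0.
  apply: cvgN; apply: continuous_comp; last exact: continuous_expR.
  by apply: cvgN; apply: cvgM; [exact: cvg_cst|exact: cvg_id].
have F1 : F x @[x --> +oo] --> (((0 : R)%:C) : Cx R).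
  apply: (cvg_real (f := fun x => - expR (- (1 * x)))); rewrite -oppr0; apply: cvgN.
  by under eq_fun do rewrite mul1r; exact: cvgr_expR.
have := FTC_integral_pos d _ F0 F1; rewrite /eint => ->.
  by rewrite -rmorphB /= sub0r opprK.
move=> r r0; have h : is_derive r 1 (fun x => - expR (- (1 * x))) (expR (- (1 * r))).
  by apply: is_derive_eq; rewrite /GRing.scale /=; ring.
have -> : ekern 1 0 r = (expR (- (1 * r)))%:C.
  by rewrite /ekern cpow0; exact: mulr1.
exact: (vderive_real h).
Qed.

Lemma cGammaS z : 0 < complex.Re z -> cGamma (z + 1) = z * cGamma z.
Proof.
move=> z0; rewrite !cGammaE addrK.
have := @eintS 1 (z - 1) ltr01; rewrite ReD /= subrK mul1r; apply.
by move: z0; case: z => x y /=; lra.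
Qed.

Lemma cGamma_nat n : cGamma (n.+1%:R) = (n`!)%:R :> R[i].
Proof.
elim: n => [|n IH]; first by rewrite cGammaE subrr eint10.
rewrite -natr1 cGammaS; last by rewrite -[n.+1%:R]/(n.+1%:R : R[i]) -(rmorph_nat (real_complex R)) /= ltr0n.
by rewrite IH -natrM factS.
Qed.

Lemma integral_eint s z : 0 < s -> 0 < complex.Re z ->
  integral_pos (fun t => (expR (- (s * t)))%:C *: (cpow t (z - 1) : Cx R)) = cGamma z * cpow s (- z).
Proof.
move=> s0 z0; rewrite -/(ekern s (z - 1)) -/(eint s (z - 1)) eint_scale //.
  by rewrite cGammaE subrK.
by move: z0; case: z => x y /=; lra.
Qed.

End GammaKernel.

Section RealBounds.
Context {R : realType}.

Lemma rfunctional_Re : @rfunctional R (Cx R) (@complex.Re R).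
Proof.
split=> [r x y|]; last by exists 1 => x; rewrite mul1r; exact: cabs_Re.
by rewrite raddfD /=; congr (_ + _); case: x => a b; rewrite /= mul0r subr0.
Qed.

Lemma rnorm_integral_le {X : completeNormedModType R[i]} (f : R -> X) (g : R -> R) :
  dom f -> @dom R (Cx R) (fun r => (g r)%:C) -> (forall r, 0 < r -> rnorm (f r) <= g r) ->
  rnorm (integral_pos f) <= complex.Re (integral_pos (fun r => (g r)%:C : Cx R)).
Proof.
move=> df dg fg; have [C [a hf]] := df; have [C' [a' hg]] := dg.
have [phi [hp h1 h2]] := norming_functional (integral_pos f).
rewrite -h2 (integral_pos_functional hf hp) (integral_pos_functional hg rfunctional_Re).
apply: le_Rintegral; [exact: measurable_itv|exact: integrable_functional| |].
  exact: (integrable_functional dg rfunctional_Re).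
move=> r /posP r0 /=; apply: le_trans (ler_norm _) _.
by apply: le_trans (h1 _) (fg _ r0).
Qed.

Lemma cpow_nat (n : nat) (r : R) : 0 < r -> cpow r (n%:R : R[i]) = (r ^+ n)%:C.
Proof.
move=> r0; rewrite -(rmorph_nat (real_complex R)) cpow_real.
by rewrite expRM_natl lnK.
Qed.

Lemma eint_nat (n : nat) (s : R) : 0 < s ->
  eint s n%:R = (n`!%:R * expR (- n.+1%:R * ln s))%:C :> R[i].
Proof.
move=> s0; rewrite eint_scale //; last first.
  by rewrite -(rmorph_nat (real_complex R)) /= (lt_le_trans (ltrN10 _)).
have := @cGamma_nat R n; rewrite cGammaE -natr1 addrK => ->.
rewrite natr1 -(rmorph_nat (real_complex R)) -(rmorph_nat (real_complex R) n.+1) -rmorphN cpow_real.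
by rewrite -rmorphM.
Qed.

End RealBounds.

(** * Concentration of the Gamma density at its mean *)

Section GammaRatio.
Context {R : realType} (al : R[i]).
Hypothesis al01 : 0 < complex.Re al < 1.

(** Mean value inequality between 1 and u: |r^(al-1)| is at most 1 for r >= 1 and at most 1/u for u
    <= r <= 1. The sum of the two bounds covers both cases. *)
Lemma cpow_sub1_le (u : R) : 0 < u -> cabs (cpow u al - 1) <= cabs al * (`|u - 1| * (1 + u^-1)).
Proof.
move=> u0; have /andP[a0 a1] := al01.
have ui : 0 < u^-1 by rewrite invr_gt0.
pose F r : Cx R := cpow r al.
have dF r : 0 < r -> vderive F r (al * cpow r (al - 1) : R[i]) by move=> r0; exact: vderive_cpow.
have Re1 : complex.Re (al - 1) = complex.Re al - 1 by case: (al).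
have cF r : cabs (al * cpow r (al - 1)) = cabs al * expR ((complex.Re al - 1) * ln r).
  by rewrite cabsM cabs_cpow Re1.
rewrite -cabs_rnorm.
have [u1|u1] := leP 1 u.
  have h := @vderive_bound R (Cx R) F (fun r => al * cpow r (al - 1)) 1 u (cabs al) u1.
  have {h} : rnorm (F u - F 1) <= cabs al * (u - 1).
    apply: h => r r1 r2; have r0 : 0 < r by rewrite (lt_le_trans _ r1).
    split; first exact: dF.
    rewrite cabs_rnorm cF // -[leRHS]mulr1 ler_wpM2l ?cabs_ge0 // -[X in _ <= X]expR0 ler_expR.
    by have := ln_ge0 r1; nra.
  rewrite /F cpow1l => h; apply: (le_trans h); rewrite ler_wpM2l ?cabs_ge0 //.
  by rewrite ger0_norm ?subr_ge0 // ler_peMr ?subr_ge0 // lerDl ltW.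
have h := @vderive_bound R (Cx R) F (fun r => al * cpow r (al - 1)) u 1 (cabs al * u^-1) (ltW u1).
have {h} : rnorm (F 1 - F u) <= cabs al * u^-1 * (1 - u).
  apply: h => r r1 r2; have r0 : 0 < r by rewrite (lt_le_trans _ r1).
  split; first exact: dF.
  rewrite cabs_rnorm cF // ler_wpM2l ?cabs_ge0 // -[u^-1]lnK ?posrE // ler_expR lnV ?posrE //.
  have := ln_le0 r2; have : ln u <= ln r by rewrite ler_ln.
  by nra.
rewrite /F cpow1l rnorm_distC => h; apply: (le_trans h).
rewrite -mulrA ler_wpM2l ?cabs_ge0 // mulrC ler0_norm ?opprB; last by rewrite subr_le0 ltW.
by rewrite ler_wpM2l ?subr_ge0 ?(ltW u1) // lerDr.
Qed.

(** Up to normalisation, e^(-N r) r^(n+1) with N = n + 2 is the Gamma density of mean 1 and variance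
    1/N, so r^al is close to 1 on average. Young's inequality |r - 1| <= e/2 + (r - 1)^2/(2e)
    replaces the modulus by a polynomial, whose moments follow from [eintS]. *)
Lemma eint_ratio_bound (n : nat) (e : R) : 0 < e ->
  cabs (eint n.+2%:R (n.+1%:R + al) - eint n.+2%:R n.+1%:R) <=
  complex.Re (eint n.+2%:R n.+1%:R) * (cabs al * (3 / 2 * e + (e * n.+1%:R)^-1)).
Proof.
move=> e0; set N := n.+2%:R : R; have /andP[a0 a1] := al01.
have N0 : 0 < N by rewrite ltr0n.
have NE : N = n.+1%:R + 1 by rewrite /N natr1.
have n3E : n.+3%:R = N + 1 :> R by rewrite /N natr1.
have NCE : N%:C = n.+2%:R :> R[i] by rewrite -(rmorph_nat (real_complex R)).
have PE := eint_nat n.+1 N0.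
clearbody N.
have ReN (k : nat) : complex.Re (k%:R : R[i]) = k%:R by rewrite -(rmorph_nat (real_complex R)).
have Rek (k : nat) : -1 < complex.Re (k%:R : R[i]).
  by rewrite ReN (lt_le_trans (ltrN10 _)).
have dk (k : nat) := dom_ekern N0 (Rek k).
have da : dom (ekern N (n.+1%:R + al)).
  by apply: dom_ekern => //; rewrite ReD ReN; have := ler0n R n.+1; lra.
pose A := cabs al; have A0 : 0 <= A := cabs_ge0 al.
(* The coefficients of r^n, ..., r^(n+3) in A r^(n+1) (1 + 1/r) (e/2 + (r - 1)^2/(2e)). *)
pose c1 := A * (e / 2 + (2 * e)^-1); pose c2 := A * (e / 2 - (2 * e)^-1).
pose c3 := - (A * (2 * e)^-1); pose c4 := A * (2 * e)^-1.
pose g r := expR (- (N * r)) * (c1 * r ^+ n + c2 * r ^+ n.+1 + c3 * r ^+ n.+2 + c4 * r ^+ n.+3).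
have dc c k := domZ (c : R)%:C (dk k).
have d12 := domD (dc c1 n) (dc c2 n.+1).
have d123 := domD d12 (dc c3 n.+2).
have d1234 := domD d123 (dc c4 n.+3).
have gE r : 0 < r -> c1%:C *: ekern N n%:R r + c2%:C *: ekern N n.+1%:R r +
    c3%:C *: ekern N n.+2%:R r + c4%:C *: ekern N n.+3%:R r = (g r)%:C :> R[i].
  move=> r0; rewrite /ekern !cpow_nat // /GRing.scale /= /g.
  by rewrite !(rmorphM, rmorphD) /=; ring.
have dg : @dom R (Cx R) (fun r => (g r)%:C) by apply: dom_eq d1234 => r r0; exact: gE.
have dB := domB da (dk n.+1).
have dI : eint N (n.+1%:R + al) - eint N n.+1%:R =
    integral_pos (fun r => ekern N (n.+1%:R + al) r - ekern N n.+1%:R r).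
  by rewrite (integral_posB da (dk n.+1)).
have le1 : cabs (eint N (n.+1%:R + al) - eint N n.+1%:R) <= complex.Re (integral_pos (fun r => (g r)%:C : Cx R)).
  rewrite dI -cabs_rnorm; apply: (rnorm_integral_le dB dg) => r r0.
  have -> : ekern N (n.+1%:R + al) r - ekern N n.+1%:R r =
     (expR (- (N * r)) * r ^+ n.+1)%:C *: ((cpow r al - 1 : R[i]) : Cx R).
    by rewrite /ekern cpowD cpow_nat // /GRing.scale /= rmorphM /=; ring.
  have E0 := expR_ge0 (- (N * r)).
  rewrite rnormZR ger0_norm ?mulr_ge0 ?exprn_ge0 ?(ltW r0) // cabs_rnorm.
  apply: (@le_trans _ _ (expR (- (N * r)) * r ^+ n.+1 * (A * (`|r - 1| * (1 + r^-1))))).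
    by rewrite ler_wpM2l ?mulr_ge0 ?exprn_ge0 ?(ltW r0) // cpow_sub1_le.
  have ri : 0 < r^-1 by rewrite invr_gt0.
  have b1 : `|r - 1| <= e / 2 + (r - 1) ^+ 2 * (2 * e)^-1.
    have : 0 <= (e - `|r - 1|) ^+ 2 by exact: sqr_ge0.
    have -> : (r - 1) ^+ 2 = `|r - 1| ^+ 2 by rewrite real_normK ?num_real.
    move=> h; rewrite -(ler_pM2r (x := 2 * e)); last by lra.
    have -> : (e / 2 + `|r - 1| ^+ 2 * (2 * e)^-1) * (2 * e) = e ^+ 2 + `|r - 1| ^+ 2.
      by field; rewrite gt_eqF.
    by nra.
  apply: (@le_trans _ _ (expR (- (N * r)) * r ^+ n.+1 * (A * ((e / 2 + (r - 1) ^+ 2 * (2 * e)^-1) * (1 + r^-1))))).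
    rewrite ler_wpM2l ?mulr_ge0 ?exprn_ge0 ?(ltW r0) // ler_wpM2l //.
    by rewrite ler_wpM2r // addr_ge0 // ltW.
  rewrite le_eqVlt; apply/orP; left; apply/eqP.
  rewrite /g /c1 /c2 /c3 /c4 !exprS; field.
  by rewrite !gt_eqF.
apply: (le_trans le1).
have -> : integral_pos (fun r => (g r)%:C : Cx R) = c1%:C * eint N n%:R + c2%:C * eint N n.+1%:R +
    c3%:C * eint N n.+2%:R + c4%:C * eint N n.+3%:R :> R[i].
  rewrite -(@integral_pos_eq R (Cx R) _ (fun r => (g r)%:C) gE d1234) (integral_posD d123 (dc c4 n.+3)) (integral_posD d12 (dc c3 n.+2)).
  rewrite (integral_posD (dc c1 n) (dc c2 n.+1)).
  by rewrite (integral_posZ _ (dk n)) (integral_posZ _ (dk n.+1)) (integral_posZ _ (dk n.+2)) (integral_posZ _ (dk n.+3)).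
have rec (k : nat) : N%:C * eint N k.+1%:R = k.+1%:R * eint N k%:R.
  by have := eintS N0 (Rek k); rewrite natr1.
have {PE}P0 : 0 <= complex.Re (eint N n.+1%:R) by rewrite PE //= mulr_ge0 ?expR_ge0.
have R0 := rec n; have R1 := rec n.+1; have R2 := rec n.+2.
have NC : N%:C != 0 :> R[i] by rewrite -(rmorph0 (real_complex R)) (inj_eq (@complexI R)) gt_eqF.
have nC : n.+1%:R != 0 :> R[i] by rewrite pnatr_eq0.
set P := eint N n.+1%:R in R0 R1 R2 P0 *.
clearbody P.
have e1 : eint N n%:R = (N / n.+1%:R)%:C * P.
  apply: (mulfI nC); rewrite -R0 mulrA -(rmorph_nat (real_complex R)) -rmorphM.
  by congr (_%:C * _); rewrite mulrCA divff ?mulr1 // pnatr_eq0.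
have e2 : eint N n.+2%:R = P.
  by apply: (mulfI NC); rewrite R1 NCE.
have e3 : eint N n.+3%:R = (n.+3%:R / N)%:C * P.
  apply: (mulfI NC); rewrite R2 e2 mulrA -rmorphM -(rmorph_nat (real_complex R)).
  by congr (_%:C * _); rewrite mulrCA divff ?mulr1 // gt_eqF.
rewrite e1 e2 e3.
have -> : c1%:C * ((N / n.+1%:R)%:C * P) + c2%:C * P + c3%:C * P + c4%:C * ((n.+3%:R / N)%:C * P) =
  (c1 * (N / n.+1%:R) + c2 + c3 + c4 * (n.+3%:R / N))%:C * P.
  by rewrite !(rmorphD, rmorphM) /=; ring.
have -> (x : R) (z : R[i]) : complex.Re (x%:C * z) = x * complex.Re z by case: z => ? ? /=; ring.
rewrite mulrC ler_wpM2l // /c1 /c2 /c3 /c4 -/A.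
have -> : A * (e / 2 + (2 * e)^-1) * (N / n.+1%:R) + A * (e / 2 - (2 * e)^-1) + - (A * (2 * e)^-1) +
   A * (2 * e)^-1 * (n.+3%:R / N) =
   A * (e / 2 * (1 + N / n.+1%:R) + (2 * e)^-1 * (N / n.+1%:R - 2 + n.+3%:R / N)) by ring.
rewrite ler_wpM2l //.
have n0 : 0 < n.+1%:R :> R by rewrite ltr0n.
have n1 : 1 <= n.+1%:R :> R by rewrite ler1n.
have -> : n.+3%:R / N = 1 + N^-1 by rewrite n3E; field; rewrite gt_eqF.
have -> : N / n.+1%:R = 1 + n.+1%:R^-1 by rewrite NE; field; rewrite gt_eqF.
(* [i1] bounds 1 + N/(n + 1) by 3, whence 3/2 e; [i2] bounds the factor of 1/(2e) by 2/(n + 1). *)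
have i1 : n.+1%:R^-1 <= 1 :> R by rewrite invf_le1.
have i2 : N^-1 <= n.+1%:R^-1 by rewrite lef_pV2 ?posrE // NE; lra.
rewrite !invfM; have ei : 0 < e^-1 by rewrite invr_gt0.
have j1 : e * n.+1%:R^-1 <= e by rewrite ler_piMr // ltW.
have j2 : e^-1 * N^-1 <= e^-1 * n.+1%:R^-1 by rewrite ler_wpM2l // ltW.
move: j1 j2; move: (n.+1%:R^-1) (N^-1) (e^-1) => x y z; lra.
Qed.

End GammaRatio.

(** * Wallis-type integrals: recursion, initial values, comparison with z = 0 *)

Section WallisIntegrals.
Context {R : realType}.
Implicit Types (z : R[i]) (n : nat) (r s x : R).

(** [ccs z x] and [csn z x] are cos(z x) and sin(z x), with the real variable of differentiation
    kept apart from z. *)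
Definition ccs z x : R[i] := (cexp ('i * z * x%:C) + cexp (- ('i * z) * x%:C)) / 2.
Definition csn z x : R[i] := (cexp ('i * z * x%:C) - cexp (- ('i * z) * x%:C)) / (2 * 'i).

Lemma csnE z x : csn z x = csin (z * x%:C).
Proof. by rewrite /csn /csin mulNr !mulrA. Qed.

Lemma ccs0 x : ccs 0 x = 1.
Proof. by rewrite /ccs mulr0 oppr0 mul0r cexp0 -mulr2n -mulr_natl divff ?mulr1 // pnatr_eq0. Qed.

Lemma csn0 z : csn z 0 = 0.
Proof. by rewrite /csn !mulr0 subrr mul0r. Qed.

Lemma ccsz0 z : ccs z 0 = 1.
Proof. by rewrite /ccs !mulr0 cexp0 -mulr2n -mulr_natl divff ?mulr1 // pnatr_eq0. Qed.

Lemma i2 : ('i * 'i : R[i]) = -1.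
Proof. by rewrite -expr2 sqr_i. Qed.

Lemma vderive_ccs z (u : R -> R) (u' t : R) : is_derive t 1 u u' ->
  @vderive R (Cx R) (fun x => ccs z (u x)) t (- (u'%:C * z * csn z (u t)) : R[i]).
Proof.
move=> hu; have v1 := vderive_cexp (z := 'i * z) hu; have v2 := vderive_cexp (z := - ('i * z)) hu.
have v3 := vderive_scale (vderive_cst (X := Cx R) (2^-1 : R[i]) t) (vderiveD v1 v2).
have e : forall x, ccs z (u x) = (2^-1 : R[i]) * (cexp ('i * z * (u x)%:C) + cexp (- ('i * z) * (u x)%:C)).
  by move=> x; rewrite /ccs mulrC.
under eq_fun do rewrite e.
have -> : - (u'%:C * z * csn z (u t)) = 0 * (cexp ('i * z * (u t)%:C) + cexp (- ('i * z) * (u t)%:C)) +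
  2^-1 * (u'%:C * ('i * z) * cexp ('i * z * (u t)%:C) + u'%:C * (- ('i * z)) * cexp (- ('i * z) * (u t)%:C)).
  rewrite /csn invfM; have -> : ('i : R[i])^-1 = - 'i.
    by apply: (mulfI (x := 'i)); rewrite ?mulfV ?mulrN ?i2 ?opprK // eq_complex /= oner_eq0 andbF.
  by ring.
exact: v3.
Qed.

Lemma vderive_csn z (u : R -> R) (u' t : R) : is_derive t 1 u u' ->
  @vderive R (Cx R) (fun x => csn z (u x)) t (u'%:C * z * ccs z (u t) : R[i]).
Proof.
move=> hu; have v1 := vderive_cexp (z := 'i * z) hu; have v2 := vderive_cexp (z := - ('i * z)) hu.
have v3 := vderive_scale (vderive_cst (X := Cx R) ((2 * 'i)^-1 : R[i]) t)
  (vderiveD v1 (vderive_scale (vderive_cst (X := Cx R) (-1 : R[i]) t) v2)).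
have e : forall x, csn z (u x) = ((2 * 'i)^-1 : R[i]) * (cexp ('i * z * (u x)%:C) + -1 * cexp (- ('i * z) * (u x)%:C)).
  by move=> x; rewrite /csn mulN1r mulrC.
under eq_fun do rewrite e.
have -> : u'%:C * z * ccs z (u t) =
  0 * (cexp ('i * z * (u t)%:C) + -1 * cexp (- ('i * z) * (u t)%:C)) +
  (2 * 'i)^-1 * (u'%:C * ('i * z) * cexp ('i * z * (u t)%:C) +
    (0 * cexp (- ('i * z) * (u t)%:C) + -1 * (u'%:C * (- ('i * z)) * cexp (- ('i * z) * (u t)%:C)))).
  rewrite /ccs; field.
  by rewrite eq_complex /= oner_eq0 andbF.
exact: v3.
Qed.

(** A common bound for the exponentials e^(i z x) and e^(-i z x) with |x| <= 2, a range that
    contains the values of [atan]. *)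
Let K z : R := expR (2 * cabs z).

Lemma cabs_cexp_le z x : `|x| <= 2 -> cabs (cexp (z * x%:C)) <= K z.
Proof.
move=> x2; rewrite cabs_cexp ler_expR.
have -> : complex.Re (z * x%:C) = complex.Re z * x by case: z => a b /=; ring.
apply: le_trans (ler_norm _) _; rewrite normrM mulrC.
by apply: ler_pM => //; exact: cabs_Re.
Qed.

Lemma cabs_ccs z x : `|x| <= 2 -> cabs (ccs z x) <= K z.
Proof.
move=> x2; rewrite /ccs mulrC cabsM.
have -> : cabs (2^-1 : R[i]) = 2^-1.
  have -> : (2^-1 : R[i]) = (2^-1 : R)%:C by rewrite fmorphV rmorph_nat.
  by rewrite cabs_real ger0_norm.
have e1 := cabs_cexp_le ('i * z) x2; have e2 := cabs_cexp_le (- ('i * z)) x2.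
have eK : cabs ('i * z) = cabs z by rewrite cabsM cabs_i mul1r.
rewrite /K ?cabsN eK -/(K z) in e1 e2.
by have := cabsD (cexp ('i * z * x%:C)) (cexp (- ('i * z) * x%:C)); lra.
Qed.

Lemma cabs_csn z x : 0 <= x -> x <= 2 -> cabs (csn z x) <= cabs z * K z * x.
Proof.
move=> x0 x2; rewrite -cabs_rnorm.
have h := @vderive_bound R (Cx R) (fun x => csn z x) (fun x => 1%:C * z * ccs z x) 0 x (cabs z * K z) x0.
have {h} : rnorm (csn z x - csn z 0 : Cx R) <= cabs z * K z * (x - 0).
  apply: h => r r1 r2; split.
    have hv : @vderive R (Cx R) (fun x => csn z x) r (1%:C * z * ccs z r) := @vderive_csn z id 1 r (is_derive_id r 1).
    exact: hv.
  rewrite cabs_rnorm mul1r cabsM ler_wpM2l ?cabs_ge0 // cabs_ccs // ger0_norm //.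
  exact: le_trans r2 x2.
by rewrite csn0 !subr0.
Qed.

Lemma cabs_ccs_sub1 z x : 0 <= x -> x <= 2 -> cabs (ccs z x - 1) <= cabs z ^+ 2 * K z * x ^+ 2.
Proof.
move=> x0 x2; rewrite -cabs_rnorm.
have h := @vderive_bound R (Cx R) (fun x => ccs z x) (fun r => - (1%:C * z * csn z r)) 0 x (cabs z * (cabs z * K z * x)) x0.
have {h} : rnorm (ccs z x - ccs z 0 : Cx R) <= cabs z * (cabs z * K z * x) * (x - 0).
  apply: h => r r1 r2; split.
    have hv : @vderive R (Cx R) (fun x => ccs z x) r (- (1%:C * z * csn z r)) := @vderive_ccs z id 1 r (is_derive_id r 1).
    exact: hv.
  rewrite cabs_rnorm cabsN mul1r cabsM ler_wpM2l ?cabs_ge0 //.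
  apply: le_trans (cabs_csn z r1 (le_trans r2 x2)) _.
  by rewrite ler_wpM2l // mulr_ge0 ?cabs_ge0 ?expR_ge0.
by rewrite ccsz0 subr0 => h; apply: (le_trans h); rewrite !expr2; lra.
Qed.

(** The derivative of [atan], equal to cos(atan s)^2. In x = atan s, the integral [wallis z n] is
    that of cos(z x) cos(x)^(2n) over (0, pi/2). *)
Definition vv s : R := (1 + s ^+ 2)^-1.

Lemma vv_gt0 s : 0 < vv s.
Proof. by rewrite invr_gt0 ltr_wpDr ?sqr_ge0. Qed.

Lemma vvK s : vv s * (1 + s ^+ 2) = 1.
Proof. by rewrite mulVf // gt_eqF // ltr_wpDr ?sqr_ge0. Qed.

Lemma vv_le1 s : vv s <= 1.
Proof. by have := vvK s; have := vv_gt0 s; have := sqr_ge0 s; nra. Qed.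

Lemma is_derive_vv n s : is_derive s 1 (fun x => vv x ^+ n.+1) (- (2 * n.+1%:R * s * vv s ^+ n.+2)).
Proof.
have e0 : 1 + s ^+ 2 != 0 by rewrite gt_eqF // ltr_wpDr ?sqr_ge0.
have h : is_derive s 1 vv (- (2 * s * vv s ^+ 2)).
  rewrite /vv; apply: is_derive_eq; rewrite /GRing.scale /=.
  by field; exact: e0.
have hX : is_derive s 1 (fun x => vv x ^+ n.+1) ((n.+1%:R * vv s ^+ n) *: (- (2 * s * vv s ^+ 2))).
  by have := is_deriveX n.+1 h; rewrite exprfctE.
apply: (is_derive_eq hX); rewrite /GRing.scale /= [vv s ^+ n.+2]exprS [vv s ^+ n.+1]exprS.
by ring.
Qed.

(** 1 - [vv s] = s^2 [vv s]. For s <= 1 the last bound follows from atan s <= s and [vv s] >= 1/2.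
    For s > 1 it follows from atan s <= 2 and s^2 [vv s] >= 1/2, which fixes the constant 8. *)
Lemma atan_bounds s : 0 <= s -> [/\ 0 <= atan s, atan s <= 2 & atan s ^+ 2 <= 8 * (1 - vv s)].
Proof.
move=> s0.
have h0 : rnorm ((atan s)%:C - (atan 0)%:C : Cx R) <= 1 * (s - 0).
  apply: (@vderive_bound R (Cx R) (fun x => (atan x)%:C) (fun x => (vv x)%:C) 0 s 1) => // r r1 r2.
  split; first exact: (vderive_real (is_derive1_atan r)).
  by rewrite cabs_rnorm cabs_real ger0_norm ?(ltW (vv_gt0 _)) // vv_le1.
rewrite atan0 subr0 cabs_rnorm mul1r subr0 cabs_real in h0.
have a2 : atan s <= 2 by rewrite ltW // (lt_trans (atan_ltpi2 s)) // pihalf_lt2.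
have a0 : 0 <= atan s.
  by rewrite -atan0; exact: le_atan.
rewrite ger0_norm // in h0; split=> //.
have := vvK s; have := vv_gt0 s; have := vv_le1 s => v1 v0 vk.
have e : 1 - vv s = vv s * s ^+ 2 by lra.
rewrite e; have [s1|s1] := leP s 1.
  have h1 : atan s ^+ 2 <= s ^+ 2 by rewrite ler_sqr ?nnegrE.
  have h2 : s ^+ 2 <= 1 by rewrite exprn_ile1.
  have h3 : 1 <= 2 * vv s by nra.
  by have := sqr_ge0 s; nra.
have h1 : atan s ^+ 2 <= 4 by have -> : 4 = 2 ^+ 2 :> R; [ring|rewrite ler_sqr ?nnegrE].
have h2 : 1 <= s ^+ 2 by rewrite exprn_ege1 // ltW.
by nra.
Qed.

Definition wallisk z n s : Cx R := (vv s ^+ n.+1)%:C *: (ccs z (atan s) : Cx R).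
Definition wallis z n : R[i] := integral_pos (wallisk z n).

Lemma dom_wallisk z n : dom (wallisk z n).
Proof.
exists (K z), (Num.min (0 + 1) (- (-2) - 1)); apply: dominatedI; [lra|lra| | |].
- have c1 : @cont_pos R (Cx R) (fun s => (vv s ^+ n.+1)%:C).
    by move=> r r0; exact: (vderive_continuous (vderive_real (is_derive_vv n r))).
  have c2 : @cont_pos R (Cx R) (fun s => ccs z (atan s)).
    move=> r r0; have hv := vderive_ccs (z := z) (is_derive1_atan r).
    exact: vderive_continuous hv.
  exact: cont_pos_scale c1 c2.
- move=> r r0 r1; have [b1 b2 _] := atan_bounds (ltW r0).
  rewrite mul0r expR0 mulr1 rnormZR cabs_rnorm ger0_norm ?exprn_ge0 ?(ltW (vv_gt0 _)) //.
  rewrite -[leRHS]mul1r ler_pM ?exprn_ge0 ?cabs_ge0 ?(ltW (vv_gt0 _)) //.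
    by rewrite exprn_ile1 ?vv_le1 ?(ltW (vv_gt0 _)).
  by rewrite cabs_ccs // ger0_norm.
- move=> r r1; have r0 : 0 < r by rewrite (lt_le_trans _ r1).
  have [b1 b2 _] := atan_bounds (ltW r0).
  rewrite rnormZR cabs_rnorm ger0_norm ?exprn_ge0 ?(ltW (vv_gt0 _)) // mulrC.
  rewrite ler_pM ?exprn_ge0 ?cabs_ge0 ?(ltW (vv_gt0 _)) //.
    by rewrite cabs_ccs // ger0_norm.
  have -> : expR (-2 * ln r) = (r ^+ 2)^-1.
    by rewrite mulNr expRN; congr (_^-1); rewrite -[2]/(2%:R) expRM_natl lnK.
  rewrite exprS; apply: (@le_trans _ _ (vv r * 1)).
    by rewrite ler_wpM2l ?(ltW (vv_gt0 _)) // exprn_ile1 ?vv_le1 ?(ltW (vv_gt0 _)).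
  by rewrite mulr1 lef_pV2 ?posrE ?exprn_gt0 ?ltr_wpDr ?sqr_ge0 // lerDr.
Qed.

(** In x = atan s these are two integrations by parts of cos(z x) cos(x)^(2n+2). The primitive [F]
    is -1/2 times the sum of their boundary terms and vanishes at both ends. *)
Lemma wallis_rec z n : (2 * n.+1%:R ^+ 2 - z ^+ 2 / 2) * wallis z n.+1 = n.+1%:R * (2 * n.+1%:R - 1) * wallis z n.
Proof.
pose m : R := n.+1%:R.
have mE : n.+1%:R = m%:C :> R[i] by rewrite /m rmorph_nat.
rewrite mE; set a := 2 * m%:C ^+ 2 - z ^+ 2 / 2; set b := m%:C * (2 * m%:C - 1).
have d1 := domZ a (dom_wallisk z n.+1); have d0 := domZ b (dom_wallisk z n).
have dB := domB d1 d0.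
pose G s : Cx R := (- (z / 2) : R[i]) *: (csn z (atan s) : Cx R) + (m * s)%:C *: (ccs z (atan s) : Cx R).
pose F s : Cx R := (vv s ^+ n.+1)%:C *: G s.
have dF s : vderive F s (a *: wallisk z n.+1 s - b *: wallisk z n s).
  have hS := vderive_csn (z := z) (is_derive1_atan s).
  have hC := vderive_ccs (z := z) (is_derive1_atan s).
  have hms : is_derive s 1 (fun x : R => m * x) m.
    by apply: is_derive_eq; rewrite /GRing.scale /= mulr1.
  have h := vderive_scale (vderive_real (is_derive_vv n s))
    (vderiveD (vderive_scale (vderive_cst (X := Cx R) (- (z / 2) : R[i]) s) hS)
              (vderive_scale (vderive_real hms) hC)).
  set S := csn z (atan s) in h *; set C := ccs z (atan s) in h *.
  have e : a * ((vv s ^+ n.+2)%:C * C) - b * ((vv s ^+ n.+1)%:C * C) =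
    (- (2 * m * s * vv s ^+ n.+2))%:C * (- (z / 2) * S + (m * s)%:C * C) +
    (vv s ^+ n.+1)%:C * ((0 * S + (- (z / 2)) * ((vv s)%:C * z * C)) +
       (m%:C * C + (m * s)%:C * (- ((vv s)%:C * z * S)))).
    have -> : vv s ^+ n.+1 = vv s ^+ n.+2 * (1 + s ^+ 2).
      by rewrite [vv s ^+ n.+2]exprSr -mulrA vvK mulr1.
    have e2 : (vv s)%:C * (1 + s%:C ^+ 2) = 1 :> R[i].
      by rewrite -rmorphXn -(rmorph1 (real_complex R)) -rmorphD -rmorphM vvK.
    move: (vv s ^+ n.+2) => p; move: (vv s) e2 => v e2.
    have e4 : (2 : R)%:C = 2 :> R[i] by rewrite rmorph_nat.
    rewrite /a /b rmorphN !rmorphM rmorphD rmorph1 rmorphXn /= e4.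
    move: e2; move: (p%:C) (v%:C) (s%:C) (m%:C) => p' v' s' m' e2.
    apply/eqP; rewrite -subr_eq0; apply/eqP.
    transitivity (p' * (v' * (1 + s' ^+ 2) - 1) * (z ^+ 2 / 2 * C + m' * s' * z * S)).
      by field.
    by rewrite e2 subrr mulr0 mul0r.
  have -> : a *: wallisk z n.+1 s - b *: wallisk z n s = a * ((vv s ^+ n.+2)%:C * C) - b * ((vv s ^+ n.+1)%:C * C) by [].
  by rewrite e; exact: h.
have F0 : F x @[x --> (0 : R)^'+] --> 0.
  have -> : 0 = F 0.
    by rewrite /F /G atan0 csn0 mulr0 scale0r addr0 !scaler0.
  by apply: cvg_at_right_filter; exact: vderive_continuous (dF 0).
have F1 : F x @[x --> +oo] --> 0.
  pose L := cabs z * (cabs z * K z) + m * K z.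
  have m0 : 0 <= m by rewrite ler0n.
  have K0 : 0 <= K z by exact: expR_ge0.
  have z0 := cabs_ge0 z.
  have cV : (x : R)^-1 @[x --> +oo] --> (0 : R).
    by apply/gtr0_cvgV0; [apply: neary_pos|exact: cvg_id].
  apply: (@squeeze_rnorm _ _ _ _ _ _ (fun x => 2 * L * x^-1)); last first.
    by rewrite -[X in _ --> X](mulr0 (2 * L)); apply: cvgM => //; exact: cvg_cst.
  near=> x; have x1 : 1 <= x by near: x; exact: nbhs_pinfty_ge.
  have x0 : 0 < x by rewrite (lt_le_trans _ x1).
  have [b1 b2 _] := atan_bounds (ltW x0).
  rewrite subr0 /F rnormZR ger0_norm ?exprn_ge0 ?(ltW (vv_gt0 _)) //.
  have h1 : rnorm (G x) <= 2 * L * x.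
    apply: (le_trans (rnormD _ _)); rewrite rnormZ rnormZR !cabs_rnorm cabsN cabsM.
    have -> : cabs (2^-1 : R[i]) = 2^-1.
      have -> : (2^-1 : R[i]) = (2^-1 : R)%:C by rewrite fmorphV rmorph_nat.
      by rewrite cabs_real ger0_norm.
    rewrite ger0_norm ?mulr_ge0 ?(ltW x0) //.
    have c1 : cabs (ccs z (atan x)) <= K z by rewrite cabs_ccs // ger0_norm.
    have c2 : cabs (csn z (atan x)) <= cabs z * K z * 2.
      apply: le_trans (cabs_csn z b1 b2) _; by rewrite ler_wpM2l // mulr_ge0.
    have c3 := ler_wpM2l z0 c2; have c4 := ler_wpM2l (mulr_ge0 m0 (ltW x0)) c1.
    have zK : 0 <= cabs z * (cabs z * K z) by rewrite !mulr_ge0.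
    have zK1 : cabs z * (cabs z * K z) <= cabs z * (cabs z * K z) * x by rewrite ler_peMr.
    have mK : 0 <= m * K z * x by rewrite !mulr_ge0 // ltW.
    rewrite /L; lra.
  have h2 : vv x ^+ n.+1 <= (x ^+ 2)^-1.
    rewrite exprS; apply: (@le_trans _ _ (vv x * 1)).
      by rewrite ler_wpM2l ?(ltW (vv_gt0 _)) // exprn_ile1 ?vv_le1 ?(ltW (vv_gt0 _)).
    by rewrite mulr1 lef_pV2 ?posrE ?exprn_gt0 ?ltr_wpDr ?sqr_ge0 // lerDr.
  apply: (@le_trans _ _ ((x ^+ 2)^-1 * (2 * L * x))).
    by rewrite ler_pM ?exprn_ge0 ?(ltW (vv_gt0 _)) ?rnorm_ge0.
  by rewrite le_eqVlt; apply/orP; left; apply/eqP; field; rewrite gt_eqF.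
have := FTC_integral_pos dB (fun r _ => dF r) F0 F1; rewrite subrr => h.
apply/eqP; rewrite -subr_eq0; apply/eqP; rewrite -[RHS]h.
by rewrite (integral_posB d1 d0) (integral_posZ _ (dom_wallisk z n.+1)) (integral_posZ _ (dom_wallisk z n)).
Unshelve. all: by end_near.
Qed.

(** In x = atan s, the integral of z cos(z x) over (0, pi/2). At z = 2 alpha this is the source of
    sin(alpha pi). *)
Lemma wallis0 z : z * wallis z 0 = csn z (pi / 2).
Proof.
have d := domZ z (dom_wallisk z 0).
pose F s : Cx R := csn z (atan s).
have dF s : vderive F s (z *: wallisk z 0 s).
  have h := vderive_csn (z := z) (is_derive1_atan s).
  have -> : z *: wallisk z 0 s = (vv s)%:C * z * ccs z (atan s).
    by rewrite /wallisk expr1; rewrite /GRing.scale /=; ring.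
  exact: h.
have F0 : F x @[x --> (0 : R)^'+] --> 0.
  have -> : 0 = F 0 by rewrite /F atan0 csn0.
  by apply: cvg_at_right_filter; exact: vderive_continuous (dF 0).
have F1 : F x @[x --> +oo] --> (csn z (pi / 2) : Cx R).
  have hc : csn z x @[x --> pi / 2 : R] --> (csn z (pi / 2) : Cx R).
    exact: (@vderive_continuous R (Cx R) (fun x => csn z x) _ _ (@vderive_csn z id 1 (pi / 2) (is_derive_id _ _))).
  by apply: (@cvg_comp _ _ _ (@atan R) (fun x => csn z x : Cx R)); [exact: cvgy_atan|exact: hc].
have := FTC_integral_pos d (fun r _ => dF r) F0 F1; rewrite subr0 => <-.
by rewrite (integral_posZ _ (dom_wallisk z 0)).
Qed.

Lemma wallis00 : wallis 0 0 = (pi / 2)%:C.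
Proof.
have d := dom_wallisk 0 0.
pose F s : Cx R := (atan s)%:C.
have dF s : vderive F s (wallisk 0 0 s).
  have h := vderive_real (is_derive1_atan s).
  have -> : wallisk 0 0 s = (vv s)%:C.
    by rewrite /wallisk expr1 ccs0; exact: mulr1.
  exact: h.
have F0 : F x @[x --> (0 : R)^'+] --> 0.
  have -> : 0 = F 0 by rewrite /F atan0.
  by apply: cvg_at_right_filter; exact: vderive_continuous (dF 0).
have F1 : F x @[x --> +oo] --> (((pi / 2 : R)%:C) : Cx R) by apply: (cvg_real (f := @atan R)); exact: cvgy_atan.
by have := FTC_integral_pos d (fun r _ => dF r) F0 F1; rewrite subr0.
Qed.

(** |cos(z x) - 1| is at most a multiple of x^2, and atan(s)^2 <= 8 (1 - [vv s]); multiplication by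
    1 - [vv s] turns the integrand for n into the difference of those for n and n + 1. *)
Lemma wallis_near z n : cabs (wallis z n - wallis 0 n) <=
  8 * cabs z ^+ 2 * K z * complex.Re (wallis 0 n - wallis 0 n.+1).
Proof.
have d1 := dom_wallisk z n; have d0 := dom_wallisk 0 n; have d00 := dom_wallisk 0 n.+1.
set L := 8 * cabs z ^+ 2 * K z.
have L0 : 0 <= L by rewrite /L mulr_ge0 ?expR_ge0 // mulr_ge0 ?sqr_ge0.
pose g s := L * (vv s ^+ n.+1 - vv s ^+ n.+2).
have dB0 := domB d0 d00.
have gE r : 0 < r -> L%:C *: (wallisk 0 n r - wallisk 0 n.+1 r) = (g r)%:C :> R[i].
  by move=> r0; rewrite /wallisk ccs0 /GRing.scale /= /g !(rmorphM, rmorphB) /= !mulr1.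
have dg : @dom R (Cx R) (fun r => (g r)%:C) := @dom_eq R (Cx R) _ (fun r => (g r)%:C) gE (domZ L%:C dB0).
have dI : wallis z n - wallis 0 n = integral_pos (fun r => wallisk z n r - wallisk 0 n r).
  by rewrite (integral_posB d1 d0).
rewrite [X in cabs X]dI -cabs_rnorm.
apply: (@le_trans _ _ (complex.Re (integral_pos (fun r => (g r)%:C : Cx R)))).
  apply: (rnorm_integral_le (domB d1 d0) dg) => r r0.
  have [b1 b2 b3] := atan_bounds (ltW r0).
  have -> : wallisk z n r - wallisk 0 n r = (vv r ^+ n.+1)%:C *: (ccs z (atan r) - 1 : Cx R).
    by rewrite /wallisk ccs0 -scalerBr.
  have v0 := vv_gt0 r.
  rewrite rnormZR cabs_rnorm ger0_norm ?exprn_ge0 ?(ltW v0) //.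
  have -> : g r = vv r ^+ n.+1 * (L * (1 - vv r)) by rewrite /g [vv r ^+ n.+2]exprSr; ring.
  rewrite ler_wpM2l ?exprn_ge0 ?(ltW v0) //.
  apply: le_trans (cabs_ccs_sub1 z b1 b2) _.
  have kz : 0 <= cabs z ^+ 2 * K z by rewrite mulr_ge0 ?expR_ge0 ?sqr_ge0.
  by have := ler_wpM2l kz b3; rewrite /L; lra.
rewrite -(@integral_pos_eq R (Cx R) _ (fun r => (g r)%:C) gE (domZ L%:C dB0)).
rewrite (integral_posZ _ dB0) (integral_posB d0 d00) -/(wallis 0 n) -/(wallis 0 n.+1).
have -> (x : R) (w : R[i]) : complex.Re (x%:C *: (w : Cx R)) = x * complex.Re w by case: w => ? ? /=; ring.
by [].
Qed.

End WallisIntegrals.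

(** * Euler's reflection formula *)

Section Reflection.
Context {R : realType}.
Implicit Types (z a : R[i]) (n : nat).

#[local] Opaque eint wallis cGamma.

Lemma natC n : n%:R = (n%:R : R)%:C :> R[i].
Proof. by rewrite rmorph_nat. Qed.

Lemma cvg_mulC {T} (F : set_system T) {FF : Filter F} (f g : T -> Cx R) (x y : Cx R) :
  f @ F --> x -> g @ F --> y -> ((f t : R[i]) * (g t : R[i]) : Cx R) @[t --> F] --> ((x : R[i]) * (y : R[i]) : Cx R).
Proof. by move=> hf hg; exact: cvg_scale hf hg. Qed.

Lemma cvg_succ {V : topologicalType} (u : nat -> V) (l : V) :
  u n @[n --> \oo] --> l -> u n.+1 @[n --> \oo] --> l.
Proof.
move=> h P /h [N _ hN]; exists N => // n Nn; apply: hN => /=; exact: leqW.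
Qed.

Lemma divr_sub1 (x p : R[i]) : p != 0 -> x / p - 1 = (x - p) * p^-1.
Proof. by move=> p0; rewrite mulrBl divff. Qed.

(** For Re a > 0 this is Gamma(n + 2 + a) / (Gamma(n + 2) (n + 2)^a). *)
Definition eratio n a : R[i] := eint n.+2%:R (n.+1%:R + a) / eint n.+2%:R n.+1%:R.

Lemma eint_nat_gt0 n : 0 < complex.Re (eint (n.+2%:R : R) n.+1%:R) /\
  eint (n.+2%:R : R) n.+1%:R = (complex.Re (eint (n.+2%:R : R) n.+1%:R))%:C.
Proof.
have e := @eint_nat R n.+1 n.+2%:R (ltr0Sn _ _).
by rewrite e /=; split=> //; rewrite mulr_gt0 ?expR_gt0 // ltr0n fact_gt0.
Qed.

Lemma eratio_cvg a : 0 < complex.Re a < 1 -> (eratio n a : Cx R) @[n --> \oo] --> ((1 : R[i]) : Cx R).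
Proof.
move=> a01; have A0 := cabs_ge0 a.
have bd n e : 0 < e -> cabs (eratio n a - 1) <= cabs a * (3 / 2 * e + (e * n.+1%:R)^-1).
  move=> e0; have [p0 pE] := eint_nat_gt0 n; have h := eint_ratio_bound a01 n e0.
  set P := eint _ _ in p0 pE h *.
  have Pn0 : P != 0 by apply/eqP => P0; move: p0; rewrite P0 ltxx.
  have -> : eratio n a - 1 = (eint n.+2%:R (n.+1%:R + a) - P) * P^-1.
    exact: divr_sub1.
  have -> : P^-1 = (complex.Re P)^-1%:C by rewrite {1}pE fmorphV.
  rewrite cabsM cabs_real ger0_norm ?invr_ge0 ?(ltW p0) // ler_pdivrMr //.
  by rewrite mulrC.
apply/cvgr_rnormP => d d0.
pose A := cabs a + 1; have Apos : 0 < A by rewrite ltr_wpDl.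
(* A 3/2 e is then d/2; the other half of d is left for A/(e (n + 1)). *)
pose e := d / (3 * A); have e0 : 0 < e by rewrite divr_gt0 // mulr_gt0.
near=> n; rewrite cabs_rnorm; apply: le_trans (bd n e e0) _.
have n1 : (2 * A / (d * e)) <= n.+1%:R.
  have : (2 * A / (d * e)) <= n%:R by near: n; exact: nbhs_infty_ger.
  by move=> h; apply: le_trans h _; rewrite ler_nat.
have nn0 : 0 < n.+1%:R :> R by rewrite ltr0n.
have h1 : (e * n.+1%:R)^-1 <= d / (2 * A).
  have de0 : 0 < d * e by rewrite mulr_gt0.
  move: n1; rewrite (ler_pdivrMr _ _ de0) => n1.
  have A2 : 0 < 2 * A by rewrite mulr_gt0.
  have en : 0 < e * n.+1%:R by rewrite mulr_gt0.
  rewrite -[leLHS]mul1r (ler_pdivrMr _ _ en) mulrAC (ler_pdivlMr _ _ A2) mul1r.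
  by have -> : d * (e * n.+1%:R) = n.+1%:R * (d * e) by ring.
apply: (@le_trans _ _ (A * (3 / 2 * e + d / (2 * A)))).
  have en : 0 < e * n.+1%:R by rewrite mulr_gt0.
  apply: ler_pM; [exact: A0| |by rewrite lerDl|by rewrite lerD2l].
  by rewrite addr_ge0 ?invr_ge0 ?(ltW en) // mulr_ge0 ?(ltW e0) // divr_ge0.
rewrite le_eqVlt; apply/orP; left; apply/eqP; rewrite /e; field.
by rewrite gt_eqF.
Unshelve. all: by end_near.
Qed.

Lemma eint_cGamma n a : 0 < complex.Re a ->
  eint n.+2%:R (n.+1%:R + a) = cGamma (n.+2%:R + a) * (cpow n.+2%:R (- n.+2%:R) * cpow n.+2%:R (- a)).
Proof.
move=> a0; rewrite eint_scale //; last by rewrite ReD natC /=; have := ler0n R n.+1; lra.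
have -> : n.+1%:R + a + 1 = n.+2%:R + a by rewrite addrAC natr1.
have -> : eint 1 (n.+1%:R + a) = cGamma (n.+2%:R + a).
  by rewrite cGammaE -[n.+2%:R]natr1; congr (eint 1 _); ring.
by rewrite opprD cpowD.
Qed.

(** The pair a, 1 - a is used because both have real part in (0, 1), unlike - a. The powers (n +
    2)^a and (n + 2)^(1-a) multiply to n + 2. *)
Lemma eratioM n a : 0 < complex.Re a < 1 -> eratio n a * eratio n (1 - a) =
  cGamma (n.+2%:R + a) * cGamma (n.+2%:R + (1 - a)) / ((n.+1)`!%:R ^+ 2 * n.+2%:R).
Proof.
move=> /andP[a0 a1]; have b0 : 0 < complex.Re (1 - a) by move: a1; case: (a) => x y /=; lra.
rewrite /eratio !eint_cGamma //.
have N0 : 0 < n.+2%:R :> R by rewrite ltr0n.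
have -> : eint (n.+2%:R : R) n.+1%:R = (n.+1)`!%:R * cpow n.+2%:R (- n.+2%:R).
  rewrite eint_scale //; last by rewrite natC /=; have := ler0n R n.+1; lra.
  have -> : eint 1 n.+1%:R = (n.+1)`!%:R :> R[i].
    by have := @cGamma_nat R n.+1; rewrite cGammaE -[n.+2%:R]natr1 addrK.
  by rewrite natr1.
set q := cpow _ (- n.+2%:R); have q0 : q != 0 := cpow_neq0 _ _.
have f0 : (n.+1)`!%:R != 0 :> R[i] by rewrite pnatr_eq0 -lt0n fact_gt0.
have e : cpow n.+2%:R (- a) * cpow n.+2%:R (- (1 - a)) = (n.+2%:R : R[i])^-1.
  by rewrite -cpowD -opprD addrC subrK cpowN cpow1 // -natC.
set x := cpow _ (- a) in e *; set y := cpow _ (- (1 - a)) in e *.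
have {e}-> : n.+2%:R = (x * y)^-1 :> R[i] by rewrite e invrK.
have x0 : x != 0 := cpow_neq0 _ _; have y0 : y != 0 := cpow_neq0 _ _.
move: (cGamma _) (cGamma _) => G G'.
by field; rewrite f0 q0 x0 y0.
Qed.

(** The explicit ratio shows that [wallis 0 n] is nonzero and exceeds [wallis 0 n.+1] by the
    fraction 1/(2 (n + 1)) of itself, which makes the relative error in [wallis_near] tend to 0. *)
Lemma wallis0_real n : exists2 j : R, 0 < j & wallis 0 n = j%:C /\ wallis 0 n.+1 = (j * ((2 * n.+1%:R - 1) / (2 * n.+1%:R)))%:C.
Proof.
have rec (j : R) m : 0 < j -> wallis 0 m = j%:C -> wallis 0 m.+1 = (j * ((2 * m.+1%:R - 1) / (2 * m.+1%:R)))%:C.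
  move=> j0 e; have m0 : m.+1%:R != 0 :> R by rewrite pnatr_eq0.
  have h := wallis_rec (0 : R[i]) m; rewrite e expr0n /= mul0r subr0 (natC m.+1) in h.
  have m2 : 2 * (m.+1%:R : R)%:C ^+ 2 != 0 :> R[i].
    by rewrite mulf_neq0 ?pnatr_eq0 // expf_neq0 // -natC pnatr_eq0.
  apply: (mulfI m2); rewrite h.
  have -> : (2 : R[i]) = (2 : R)%:C by rewrite rmorph_nat.
  rewrite -(rmorph1 (real_complex R)) -rmorphXn -!rmorphM -rmorphB -!rmorphM; congr (_%:C).
  by field.
suff [j j0 e] : exists2 j : R, 0 < j & wallis 0 n = j%:C.
  by exists j => //; split=> //; exact: rec.
elim: n => [|n [j j0 e]]; first by exists (pi / 2); [rewrite divr_gt0 // pi_gt0|exact: wallis00].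
exists (j * ((2 * n.+1%:R - 1) / (2 * n.+1%:R))); last exact: rec.
have : 1 <= n.+1%:R :> R by rewrite ler1n.
by move=> n1; rewrite mulr_gt0 // divr_gt0 //; lra.
Qed.

Lemma wallis_ratio_cvg z : (wallis z n / wallis 0 n : Cx R) @[n --> \oo] --> ((1 : R[i]) : Cx R).
Proof.
pose L := 8 * cabs z ^+ 2 * expR (2 * cabs z).
have L0 : 0 <= L by rewrite /L mulr_ge0 ?expR_ge0 // mulr_ge0 ?sqr_ge0.
apply: (@squeeze_rnorm _ _ _ _ _ _ (fun n => L * (n.+1%:R)^-1)); last first.
  rewrite -[X in _ --> X](mulr0 L); apply: cvgM; first exact: cvg_cst.
  apply/gtr0_cvgV0; first by apply: nearW => n; rewrite ltr0n.
  apply/cvgryPge => A; near=> n.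
  have h1 : A <= n%:R by near: n; exact: nbhs_infty_ger.
  by apply: le_trans h1 _; rewrite ler_nat.
apply: nearW => n; have [j j0 [e1 e2]] := wallis0_real n.
have h := wallis_near z n; rewrite e1 e2 -/L in h.
have jn : j%:C != 0 :> R[i] by rewrite -(rmorph0 (real_complex R)) (inj_eq (@complexI R)) gt_eqF.
have eq : wallis z n / wallis 0 n - 1 = (wallis z n - j%:C) * (j^-1)%:C.
  by rewrite e1 fmorphV divr_sub1.
rewrite [X in rnorm X]eq cabs_rnorm cabsM cabs_real ger0_norm ?invr_ge0 ?(ltW j0) // ler_pdivrMr //.
have -> : L / n.+1%:R * j = L * (n.+1%:R^-1 * j) by rewrite mulrA.
apply: (le_trans h); rewrite -rmorphB /= ler_wpM2l //.
have n0 : 0 < n.+1%:R :> R by rewrite ltr0n.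
have -> : j - j * ((2 * n.+1%:R - 1) / (2 * n.+1%:R)) = (n.+1%:R^-1 * j) / 2 by field; rewrite addrC natr1 pnatr_eq0.
by rewrite ler_pdivrMr // ler_peMr ?mulr_ge0 ?invr_ge0 ?(ltW n0) ?(ltW j0) // ler1n.
Unshelve. all: by end_near.
Qed.

Lemma gamma_reflection a : 0 < complex.Re a < 1 ->
  cGamma a * cGamma (1 - a) * csin (a * pi%:C) = pi%:C :> R[i].
Proof.
move=> a01; have /andP[a0 a1] := a01.
pose W n := wallis (2 * a) n; pose J n : R[i] := wallis 0 n.
pose h n := W n / J n * (cGamma (n.+1%:R + a) * cGamma (n.+1%:R - a) / n`!%:R ^+ 2).
have J0 n : J n != 0.
  have [j j0 [e _]] := wallis0_real n.
  by rewrite /J e -(rmorph0 (real_complex R)) (inj_eq (@complexI R)) gt_eqF.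
have ReDn (b : R[i]) n : complex.Re (n%:R + b) = n%:R + complex.Re b by rewrite ReD natC.
have f0 n : n`!%:R != 0 :> R[i] by rewrite pnatr_eq0 -lt0n fact_gt0.
have ReN : complex.Re (- a) = - complex.Re a by case: (a).
have GS n : cGamma (n.+2%:R + a) = (n.+1%:R + a) * cGamma (n.+1%:R + a).
  rewrite -natr1 addrAC cGammaS // ReDn; have := ltr0Sn R n; lra.
have GS' n : cGamma (n.+2%:R - a) = (n.+1%:R - a) * cGamma (n.+1%:R - a).
  rewrite -natr1 addrAC cGammaS // ReDn ReN; have : 1 <= n.+1%:R :> R by rewrite ler1n.
  lra.
have hS n : h n.+1 = h n.
  have w1 := wallis_rec (2 * a) n; have w0 := wallis_rec (0 : R[i]) n.
  rewrite -/(W n.+1) -/(W n) in w1; rewrite -/(J n.+1) -/(J n) expr0n /= mul0r subr0 in w0.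
  have m0 : n.+1%:R != 0 :> R[i] by rewrite pnatr_eq0.
  have j1 := J0 n.+1; have j0 := J0 n.
  rewrite /h GS GS' factS natrM.
  move: (cGamma _) (cGamma _) w1 w0 m0 (f0 n) j1 j0 => G G'.
  move: (W n.+1) (W n) (J n.+1) (J n) (n.+1%:R : R[i]) (n`!%:R : R[i]) => w' w j' j m f w1 w0 m0 ff j1 j0.
  (* The two recursions have the same right-hand factor m (2 m - 1), which cancels on
     cross-multiplication. *)
  have key : w' * (m ^+ 2 - a ^+ 2) * j = w * (j' * m ^+ 2).
    have n2 : (2 : R[i]) != 0 by rewrite pnatr_eq0.
    apply: (mulfI n2).
    have -> : 2 * (w' * (m ^+ 2 - a ^+ 2) * j) = ((2 * m ^+ 2 - (2 * a) ^+ 2 / 2) * w') * j by field.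
    have -> : 2 * (w * (j' * m ^+ 2)) = (2 * m ^+ 2 * j') * w by ring.
    by rewrite w1 w0; ring.
  have -> : w' / j' * ((m + a) * G' * ((m - a) * G) / (m * f) ^+ 2) =
    (w' * (m ^+ 2 - a ^+ 2) * j) * (G * G') / (j * j' * m ^+ 2 * f ^+ 2).
    by field; rewrite ff m0 j0 j1.
  by rewrite key; field; rewrite ff m0 j0 j1.
have hc n : h n = h 0%N by elim: n => // n <-; exact: hS.
have hE n : h n = W n / J n * (cGamma (n.+1%:R + a) * cGamma (n.+1%:R - a) / n`!%:R ^+ 2) by [].
have c1 : (W n.+1 / J n.+1 : Cx R) @[n --> \oo] --> ((1 : R[i]) : Cx R).
  exact: (cvg_succ (wallis_ratio_cvg (2 * a))).
have WE : W 0%N = wallis (2 * a) 0 by [].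
have JE : J 0%N = (pi / 2)%:C by exact: wallis00.
clearbody h W J.
have b01 : 0 < complex.Re (1 - a) < 1.
  by move: a0 a1; case: (a) => x y /= ? ?; apply/andP; split; lra.
have [E EE c2] : exists2 E : nat -> R[i], (forall n, E n = cGamma (n.+2%:R + a) * cGamma (n.+2%:R + (1 - a)) / ((n.+1)`!%:R ^+ 2 * n.+2%:R))
    & (E n : Cx R) @[n --> \oo] --> ((1 * 1 : R[i]) : Cx R).
  exists (fun n => eratio n a * eratio n (1 - a)); first by move=> n; exact: eratioM.
  exact: cvg_mulC (eratio_cvg a01) (eratio_cvg b01).
have ReDa n : n.+1%:R <= cabs (n.+2%:R - a).
  apply: le_trans _ (cabs_Re _); rewrite ReDn ReN; apply: le_trans (ler_norm _).
  by rewrite -[n.+2%:R]natr1; lra.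
have na n : n.+2%:R - a != 0.
  apply/eqP => e; have := ReDa n; rewrite e cabs0 => /(lt_le_trans (ltr0Sn _ n)).
  by rewrite ltxx.
(* [E n] contains Gamma(n + 3 - a) / (n + 2); this factor turns it into the Gamma(n + 2 - a) of
   [h n.+1]. *)
have c3 : (n.+2%:R / (n.+2%:R - a) : Cx R) @[n --> \oo] --> ((1 : R[i]) : Cx R).
  apply: (@squeeze_rnorm _ _ _ _ _ _ (fun n => cabs a * (n.+1%:R)^-1)); last first.
    rewrite -[X in _ --> X](mulr0 (cabs a)); apply: cvgM; first exact: cvg_cst.
    apply/gtr0_cvgV0; first by apply: nearW => n; rewrite ltr0n.
    apply/cvgryPge => A; near=> n.
    have h1 : A <= n%:R by near: n; exact: nbhs_infty_ger.
    by apply: le_trans h1 _; rewrite ler_nat.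
  apply: nearW => n.
  have e : n.+2%:R / (n.+2%:R - a) - 1 = a * (n.+2%:R - a)^-1.
    by rewrite (divr_sub1 _ (na n)) opprB addrC subrK.
  rewrite [X in rnorm X]e cabs_rnorm cabsM ler_wpM2l ?cabs_ge0 //.
  have cp : 0 < cabs (n.+2%:R - a) by rewrite (lt_le_trans _ (ReDa n)).
  have -> : cabs ((n.+2%:R - a)^-1) = (cabs (n.+2%:R - a))^-1.
    apply: (mulfI (lt0r_neq0 cp)); rewrite -cabsM !divff ?cabs1 //.
    exact: lt0r_neq0.
  by rewrite lef_pV2 ?posrE.
have cc : ((W n.+1 / J n.+1) * (E n * (n.+2%:R / (n.+2%:R - a))) : Cx R)
    @[n --> \oo] --> ((1 * (1 * 1 * 1) : R[i]) : Cx R).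
  exact: cvg_mulC c1 (cvg_mulC c2 c3).
rewrite !mulr1 in cc.
have h0E : h 0%N = 1.
  apply: (cvg_unique (@norm_hausdorff _ (Cx R)) _ cc).
  apply: (cvg_near_eq _ (cvg_cst (h 0%N : Cx R))); apply: nearW => n.
  rewrite -(hc n.+1) hE EE.
  have -> : n.+2%:R + (1 - a) = n.+2%:R - a + 1 by ring.
  rewrite cGammaS; last by rewrite ReDn ReN -[n.+2%:R]natr1; have := ler0n R n.+1; lra.
  have m0 : n.+2%:R != 0 :> R[i] by rewrite pnatr_eq0.
  have nn := na n; have ff := f0 n.+1.
  move: (cGamma _) (cGamma _) => G G'.
  move: (n.+1`!%:R : R[i]) ff => f ff; move: (n.+2%:R : R[i]) m0 nn => M m0 nn.
  by field; rewrite J0 ff nn m0.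
have W0 : 2 * a * W 0%N = csin (a * pi%:C).
  rewrite WE wallis0 csnE; congr csin; rewrite rmorphM fmorphV /= rmorph_nat.
  by field.
have g1 : cGamma (1%:R + a) = a * cGamma a.
  rewrite mulr1n addrC; exact: (cGammaS a0).
have h1 : W 0%N / (pi / 2)%:C * (a * cGamma a * cGamma (1 - a)) = 1.
  have h1 := hE 0%N; rewrite h0E g1 JE fact0 mulr1n expr1n divr1 in h1.
  exact: esym h1.
rewrite -W0.
have p0 : (pi / 2)%:C != 0 :> R[i].
  by rewrite -(rmorph0 (real_complex R)) (inj_eq (@complexI R)) gt_eqF // divr_gt0 // pi_gt0.
have -> : pi%:C = 2 * (pi / 2)%:C :> R[i].
  by rewrite rmorphM fmorphV /= rmorph_nat; field.
move: p0 h1; move: (cGamma (1 - a)) (cGamma a) (W 0%N) ((pi / 2)%:C : R[i]) => G' G w p p0 h1.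
have := congr1 (fun x => 2 * p * x) h1; rewrite mulr1 => <-.
by field; exact: p0.
Unshelve. all: by end_near.
Qed.

End Reflection.

(** * Resolvents and semigroups *)

Section Resolvent.
Context {R : realType} {X : completeNormedModType R[i]}.
Variable A : operator X.
Hypothesis Alin : linear_operator A.
Hypothesis Ann : nonnegative A.
Implicit Types (x y u : X) (l : R) (a : R[i]).

Lemma opapp_comb a x y : opdom A x -> opdom A y ->
  opdom A (a *: x + y) /\ A (a *: x + y) = a *: A x + A y.
Proof. by case: Alin => _ /(_ a x y). Qed.

Lemma opapp0 : opdom A 0 /\ A 0 = 0.
Proof.
have d0 := Alin.1; split=> //; have [_ e] := opapp_comb 1 d0 d0.
by move: e; rewrite !scale1r addr0 => e; apply: (addrI (A 0)); rewrite -e addr0.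
Qed.

Lemma opappZ a x : opdom A x -> opdom A (a *: x) /\ A (a *: x) = a *: A x.
Proof.
by move=> dx; have [d0 e0] := opapp0; have := opapp_comb a dx d0; rewrite e0 !addr0.
Qed.

(** The resolvent set is defined through a - A; at a = - l this operator is -(l + A). *)
Lemma resolvent_surj l y : 0 < l -> exists x, opdom A x /\ l%:C *: x + A x = y.
Proof.
move=> l0; have lN : - l < 0 by rewrite oppr_lt0.
have /= [_ /seteqP[_ h] _] := Ann.1 _ lN.
have [x dx /= e] := h (- y) I; exists x; split=> //.
by apply: oppr_inj; rewrite -e rmorphN scaleNr scaleN1r opprD.
Qed.

Lemma resolvent_inj l x y : 0 < l -> opdom A x -> opdom A y ->
  l%:C *: x + A x = l%:C *: y + A y -> x = y.
Proof.
move=> l0 dx dy e; have lN : - l < 0 by rewrite oppr_lt0.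
have /= [inj _ _] := Ann.1 _ lN; apply: inj => //=.
by rewrite rmorphN !scaleNr !scale1r -!opprD e.
Qed.

Lemma resolventP l y : 0 < l ->
  opdom A (resolvent A l y) /\ l%:C *: resolvent A l y + A (resolvent A l y) = y.
Proof.
move=> l0; rewrite /resolvent /=.
case: xgetP => [x _ //|]; have [x hx] := resolvent_surj y l0.
by move=> /(_ x); case.
Qed.

Lemma resolventK l u : 0 < l -> opdom A u -> resolvent A l (l%:C *: u + A u) = u.
Proof.
move=> l0 du; have [d e] := resolventP (l%:C *: u + A u) l0.
exact: resolvent_inj l0 d du e.
Qed.

Lemma resolvent_comb l a x y : 0 < l ->
  resolvent A l (a *: x + y) = a *: resolvent A l x + resolvent A l y.
Proof.
move=> l0; have [dx ex] := resolventP x l0; have [dy ey] := resolventP y l0.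
have [dc ec] := opapp_comb a dx dy.
rewrite -[RHS](resolventK l0 dc) ec; congr (resolvent A l _).
rewrite -{1}ex -{1}ey !scalerDr scalerA mulrC -scalerA.
by rewrite addrACA.
Qed.

Lemma resolventB l x y : 0 < l -> resolvent A l (x - y) = resolvent A l x - resolvent A l y.
Proof. by move=> l0; rewrite addrC -scaleN1r resolvent_comb // scaleN1r addrC. Qed.

Lemma resolvent_op l x : 0 < l -> A (resolvent A l x) = x - l%:C *: resolvent A l x.
Proof. by move=> l0; rewrite -{2}(resolventP x l0).2 addrAC subrr add0r. Qed.

Lemma resolvent_op_comm l x : 0 < l -> opdom A x ->
  resolvent A l (A x) = x - l%:C *: resolvent A l x.
Proof.
move=> l0 dx; have := resolventK l0 dx; rewrite resolvent_comb // => e.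
by rewrite -{2}e addrAC subrr add0r.
Qed.

Lemma resolvent_bound : exists2 M : R, 0 <= M &
  forall l x, 0 < l -> l * rnorm (resolvent A l x) <= M * rnorm x.
Proof.
have [M hM] := Ann.2; exists `|M| => // l x l0.
have := hM l x l0; rewrite !norm_rnorm -rmorphM lecR rnormZR gtr0_norm // => h.
by apply: le_trans h _; rewrite ler_wpM2r ?rnorm_ge0 // ler_norm.
Qed.

Lemma resolvent_injective l x : 0 < l -> resolvent A l x = 0 -> x = 0.
Proof.
move=> l0 e; have [_] := resolventP x l0.
by rewrite e scaler0 add0r opapp0.2.
Qed.

Lemma resolvent_lcont l : 0 < l -> exists K : R, forall x, rnorm (resolvent A l x) <= K * rnorm x.
Proof.
move=> l0; have [M M0 hM] := resolvent_bound; exists (M / l) => x.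
by rewrite mulrAC ler_pdivlMr // mulrC hM.
Qed.

Local Notation D := (closure (opdom A)).

Lemma closure_dom x : opdom A x -> D x.
Proof. exact: subset_closure. Qed.

Lemma closure_comb (a : R[i]) x y : D x -> D y -> D (a *: x + y).
Proof.
move=> /closure_rnormP hx /closure_rnormP hy; apply/closure_rnormP => e e0.
have c0 := cabs_ge0 a; pose d := e / (cabs a + 1).
have a1 : 0 < cabs a + 1 by rewrite ltr_wpDl.
have d0 : 0 < d by rewrite divr_gt0.
have [x' dx' ex'] := hx _ d0; have [y' dy' ey'] := hy _ d0.
exists (a *: x' + y'); first exact: (opapp_comb a dx' dy').1.
have -> : a *: x' + y' - (a *: x + y) = a *: (x' - x) + (y' - y).
  by rewrite scalerBr opprD addrACA.
apply: le_trans (rnormD _ _) _; rewrite rnormZ.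
have -> : e = cabs a * d + d by rewrite -[X in _ + X]mul1r -mulrDl mulrC divfK // gt_eqF.
by rewrite lerD // ler_wpM2l.
Qed.

Lemma closure_dom0 : D 0.
Proof. exact: closure_dom opapp0.1. Qed.

Lemma closureZ a x : D x -> D (a *: x).
Proof. by move=> dx; have := @closure_comb a _ _ dx closure_dom0; rewrite addr0. Qed.

Lemma closureB x y : D x -> D y -> D (x - y).
Proof. by move=> dx dy; rewrite addrC -scaleN1r; exact: closure_comb. Qed.

(** For u in the domain, l R(l) u - u = - R(l) A u is O(1/l). The uniform bound on l R(l) carries
    the convergence over to the closure. *)
Lemma resolvent_approx x : D x -> l%:C *: resolvent A l x @[l --> +oo] --> x.
Proof.
move=> /closure_rnormP dx; have [M M0 hM] := resolvent_bound.
apply/cvgr_rnormP => e e0.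
pose d := e / (2 * (M + 1)); have d0 : 0 < d by rewrite divr_gt0 // mulr_gt0 // ltr_wpDl.
have [u du ud] := dx _ d0.
near=> l.
have l0 : 0 < l by near: l; exact: nbhs_pinfty_gt.
have -> : l%:C *: resolvent A l x - x =
   (l%:C *: resolvent A l (x - u) + (u - x)) + - (resolvent A l (A u)).
  rewrite resolventB // resolvent_op_comm // scalerBr.
  by rewrite opprB [RHS]addrAC !addrA !subrK.
apply: le_trans (rnormD _ _) _; rewrite rnormN.
have h1 : rnorm (l%:C *: resolvent A l (x - u) + (u - x)) <= e / 2.
  apply: le_trans (rnormD _ _) _; rewrite rnormZR gtr0_norm //.
  apply: (@le_trans _ _ (M * d + d)).
    by rewrite lerD // (le_trans (hM _ _ l0)) // ler_wpM2l // rnorm_distC.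
  have -> // : M * d + d = e / 2.
  by rewrite /d; field; rewrite gt_eqF // ltr_wpDl.
have h2 : rnorm (resolvent A l (A u)) <= e / 2.
  have := hM l (A u) l0; rewrite mulrC -ler_pdivlMr // => h; apply: le_trans h _.
  rewrite ler_pdivrMr // [leRHS]mulrC -ler_pdivrMr ?divr_gt0 //.
by rewrite [leRHS](splitr e) lerD.
Unshelve. all: by end_near.
Qed.

End Resolvent.

(** * The semigroup, its generator and its Laplace transform *)

Section Semigroup.
Context {R : realType} {X : completeNormedModType R[i]}.
Variables (A : operator X) (T : R -> X -> X).
Hypothesis Alin : linear_operator A.
Hypothesis Ann : nonnegative A.
Local Notation D := (closure (opdom A)).
Hypothesis TC0 : bounded_C0_semigroup D T.
Hypothesis Tgen : op_eq (generator D T) (scale_op (-1) (part_op A D)).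
Implicit Types (x y u z : X) (l r s t : R) (a : R[i]).

Lemma semigroup_mem r x : 0 <= r -> D x -> D (T r x).
Proof. by case: TC0 => h _ _ _ _ r0 dx; exact: (h r 1 x x r0 dx dx).1. Qed.

Lemma semigroup_comb r a x y : 0 <= r -> D x -> D y -> T r (a *: x + y) = a *: T r x + T r y.
Proof. by case: TC0 => h _ _ _ _ r0 dx dy; exact: (h r a x y r0 dx dy).2. Qed.

Lemma semigroupZ r a x : 0 <= r -> D x -> T r (a *: x) = a *: T r x.
Proof.
move=> r0 dx; have d0 := closure_dom0 Alin.
have e0 : T r 0 = 0.
  have := semigroup_comb 1 r0 d0 d0; rewrite !scale1r addr0 => e.
  by apply: (addrI (T r 0)); rewrite -e addr0.
by have := semigroup_comb a r0 dx d0; rewrite e0 !addr0.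
Qed.

Lemma semigroupB r x y : 0 <= r -> D x -> D y -> T r (x - y) = T r x - T r y.
Proof. by move=> r0 dx dy; rewrite addrC -scaleN1r semigroup_comb // scaleN1r addrC. Qed.

Lemma semigroupD r s x : 0 <= r -> 0 <= s -> D x -> T (r + s) x = T r (T s x).
Proof. by case: TC0 => _ _ h _ _; exact: h. Qed.

Lemma semigroup_cvg0 x : D x -> T r x @[r --> 0^'+] --> x.
Proof. by case: TC0 => _ _ _ h _; exact: h. Qed.

Lemma semigroup_bound : exists2 M : R, 0 <= M &
  forall r x, 0 <= r -> D x -> rnorm (T r x) <= M * rnorm x.
Proof.
case: TC0 => _ _ _ _ [M hM]; exists `|M| => // r x r0 dx.
have := hM r x r0 dx; rewrite !norm_rnorm -rmorphM lecR => h.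
by apply: le_trans h _; rewrite ler_wpM2r ?rnorm_ge0 // ler_norm.
Qed.

(** The earlier of the two times is factored out, so increments of either sign reduce to the
    behaviour of T at 0 from the right. *)
Lemma semigroup_shift r h x : 0 <= Num.min r (r + h) -> D x ->
  T (r + h) x - T r x =
  (Num.sg h)%:C *: T (Num.min r (r + h)) (T `|h| x - x).
Proof.
move=> m0 dx; case: (ltgtP h 0) => h0.
- have e : Num.min r (r + h) = r + h by rewrite min_r // gerDl ltW.
  rewrite e in m0 *; rewrite ltr0_sg // ltr0_norm // rmorphN scaleN1r.
  have Nh : 0 <= - h by rewrite oppr_ge0 ltW.
  by rewrite (semigroupB m0 (semigroup_mem Nh dx) dx) -(semigroupD m0 Nh dx) addrK opprB.
- have e : Num.min r (r + h) = r by rewrite min_l // lerDl ltW.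
  rewrite e in m0 *; rewrite gtr0_sg // gtr0_norm // scale1r.
  have Nh : 0 <= h by rewrite ltW.
  by rewrite (semigroupB m0 (semigroup_mem Nh dx) dx) -(semigroupD m0 Nh dx).
- by rewrite h0 addr0 sgr0 scale0r subrr.
Qed.

(** Two-sided continuity from right continuity at 0 and the uniform bound, by [semigroup_shift]. *)
Lemma cont_pos_semigroup x : D x -> cont_pos (T ^~ x).
Proof.
move=> dx r r0; have [M M0 hM] := semigroup_bound.
have M1 : 0 < M + 1 by rewrite ltr_wpDl.
apply/cvgr_rnormP => e e0.
have /cvgr_rnormP/(_ (e / (M + 1))) := semigroup_cvg0 dx.
rewrite divr_gt0 // => /(_ isT) [d /= d0 hd].
near=> s.
have s0 : 0 < s by near: s; exact: near_pos.
have sd : `|r - s| < d by near: s; exists d.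
have -> : s = r + (s - r) by rewrite addrC subrK.
have m0 : 0 <= Num.min r (r + (s - r)).
  by rewrite le_min (ltW r0) addrC subrK (ltW s0).
case: (eqVneq s r) => [->|sr]; first by rewrite subrr addr0 subrr rnorm0 ltW.
rewrite semigroup_shift // rnormZR.
have ns : 0 < `|s - r| by rewrite normr_gt0 subr_eq0.
have sg1 : `|Num.sg (s - r)| = 1 by rewrite normr_sg subr_eq0 sr.
rewrite sg1 mul1r; apply: le_trans (hM _ _ m0 _) _.
  by apply: closureB => //; exact: semigroup_mem.
have := hd `|s - r|; rewrite /ball_ /= sub0r normrN normr_id => /(_ _ ns) h.
have {}h := h ltac:(by rewrite distrC).
apply: (@le_trans _ _ (M * (e / (M + 1)))); first by rewrite ler_wpM2l.
by rewrite mulrA ler_pdivrMr // mulrC ler_wpM2l ?(ltW e0) // lerDl.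
Unshelve. all: by end_near.
Qed.

Lemma generator_cvg u : opdom A u -> D (A u) ->
  (h^-1)%:C *: (T h u - u) @[h --> 0^'+] --> - A u.
Proof.
move=> du dAu; have [e1 e2] := Tgen.
have du' : opdom (generator D T) u by rewrite e1 /=; split=> //; exact: closure_dom.
by have := e2 _ du'; rewrite /= scaleN1r => <-; exact: du'.2.
Qed.

(** The difference quotient of the orbit of T(r) u is T(r) applied to that of u; hence T(r) u lies
    in the domain of the generator, which is that of the part of - A in D. *)
Lemma semigroup_op r u : 0 <= r -> opdom A u -> D (A u) ->
  opdom A (T r u) /\ A (T r u) = T r (A u).
Proof.
move=> r0 du dAu; have dDu := closure_dom du.
have [M M0 hM] := semigroup_bound.
have c : (h^-1)%:C *: (T h (T r u) - T r u) @[h --> 0^'+] --> - T r (A u).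
  apply: (@squeeze_rnorm _ _ _ _ _ _ (fun h => M * rnorm ((h^-1)%:C *: (T h u - u) - - A u))).
    near=> h; have h0 : 0 <= h.
      by apply: ltW; near: h; exact: nbhs_right_gt.
    have dq : D (T h u - u) by apply: closureB => //; exact: semigroup_mem.
    rewrite -semigroupD // [h + r]addrC semigroupD // -semigroupB ?semigroup_mem //.
    rewrite -semigroupZ // opprK.
    have -> : T r (A u) = 1 *: T r (A u) by rewrite scale1r.
    rewrite addrC -semigroup_comb //; last exact: closureZ.
    rewrite scale1r addrC opprK; apply: hM => //; apply: closure_comb => //.
    exact: semigroup_mem.
  rewrite -[X in _ --> X](mulr0 M); apply: cvgM; first exact: cvg_cst.
  by apply/cvgr_rnorm0; exact: generator_cvg.
have [e1 e2] := Tgen.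
have dg : opdom (generator D T) (T r u).
  by split; [exact: semigroup_mem|apply/cvg_ex; exists (- T r (A u))].
have dA : opdom (scale_op (-1) (part_op A D)) (T r u) by rewrite -e1.
split; first by case: dA.
have := e2 _ dg; rewrite /= scaleN1r => e.
by apply: oppr_inj; rewrite -e; apply: cvg_lim c; exact: norm_hausdorff.
Unshelve. all: by end_near.
Qed.

(** The quotient with increment h equals T(m h) applied to the right quotient [q] at 0 with
    increment |h|, where m h is the earlier of the two times. *)
Lemma vderive_semigroup r u : 0 < r -> opdom A u -> D (A u) ->
  vderive (T ^~ u) r (- T r (A u)).
Proof.
move=> r0 du dAu; have dDu := closure_dom du.
have [M M0 hM] := semigroup_bound.
pose q h := (h^-1)%:C *: (T h u - u); pose m h := Num.min r (r + h).
have cq : q `|h| @[h --> (0 : R)^'] --> - A u.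
  apply/cvgr_rnormP => e e0.
  have /cvgr_rnormP/(_ e e0) [d /= d0 hd] := generator_cvg du dAu.
  exists d => // h /= hd' h0; apply: hd; last by rewrite /= normr_gt0.
  by move: hd'; rewrite /ball_ /= !sub0r !normrN normr_id.
have cm : T (m h) (A u) @[h --> (0 : R)^'] --> T r (A u).
  have mr : m h @[h --> (0 : R)^'] --> r.
    apply/cvgrPdist_le => e e0; exists e => // h /=; rewrite sub0r normrN => he _.
    apply: le_trans (ltW he); rewrite /m minElt; case: ifP => _.
      by rewrite subrr normr0.
    by rewrite opprD addrA subrr sub0r normrN.
  exact: (cvg_comp _ _ mr (cont_pos_semigroup dAu r0)).
apply: (@squeeze_rnorm _ _ _ _ _ _ (fun h => M * rnorm (q `|h| - - A u) + rnorm (T (m h) (A u) - T r (A u)))).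
  near=> h; have h0 : h != 0 by near: h; exact: nbhs_dnbhs_neq.
  have hr : `|h| < r.
    near: h; exists r => //= h; rewrite /ball_ /= sub0r normrN //.
  have m0 : 0 <= m h.
    rewrite /m le_min (ltW r0) /=; move: hr; rewrite ltr_norml => /andP[]; lra.
  have n0 : 0 <= `|h| by [].
  have dq : D (T `|h| u - u) by apply: closureB => //; exact: semigroup_mem.
  have -> : (h^-1)%:C *: (T (r + h) u - T r u) = T (m h) (q `|h|).
    rewrite semigroup_shift // scalerA -rmorphM /q semigroupZ //; congr (_%:C *: _).
    case: (ltgtP h 0) h0 => // hh _; first by rewrite ltr0_sg // ltr0_norm // mulrN1 invrN.
    by rewrite gtr0_sg // gtr0_norm // mulr1.
  have -> : T (m h) (q `|h|) - - T r (A u) = T (m h) (q `|h| - - A u) - (T (m h) (A u) - T r (A u)).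
    rewrite !opprK opprB -[X in X + A u]scale1r semigroup_comb //; last exact: closureZ.
    by rewrite scale1r -addrA [X in _ = _ + X]addrC subrK.
  apply: le_trans (rnormB _ _) _; rewrite lerD2r; apply: hM => //.
  by rewrite opprK -[X in X + _]scale1r; apply: closure_comb => //; exact: closureZ.
have e00 : M * 0 + 0 = 0 :> R by rewrite mulr0 addr0.
rewrite -[X in _ --> X]e00; apply: cvgD.
  by apply: cvgM; [exact: cvg_cst|apply/cvgr_rnorm0].
exact/cvgr_rnorm0.
Unshelve. all: by end_near.
Qed.

(** For x in D, A R(l) x = x - l R(l) x is again in D, so [semigroup_op] applies to R(l) x. *)
Lemma resolvent_semigroup l r x : 0 < l -> 0 <= r -> D x ->
  resolvent A l (T r x) = T r (resolvent A l x).
Proof.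
move=> l0 r0 dx; have [du e] := resolventP Ann x l0; set u := resolvent A l x in du e *.
have dDu := closure_dom du.
have dAu : D (A u).
  have -> : A u = x - l%:C *: u by rewrite -e addrAC subrr add0r.
  by apply: closureB => //; exact: closureZ.
have [dT eT] := semigroup_op r0 du dAu.
by rewrite -[RHS](resolventK Ann l0 dT) eT -semigroup_comb // e.
Qed.

Lemma dom_laplace t x : 0 < t -> D x -> dom (fun s => (expR (- (t * s)))%:C *: T s x).
Proof.
move=> t0 dx; have [M M0 hM] := semigroup_bound.
apply: (@dom_exp _ _ 0 _ (M * rnorm x)) => //; first exact: cont_pos_semigroup.
by move=> r r0; rewrite mul0r expR0 mulr1 hM // ltW.
Qed.

Lemma resolvent_laplace t z : 0 < t -> D z ->
  integral_pos (fun s => (expR (- (t * s)))%:C *: T s z) = resolvent A t z.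
Proof.
move=> t0 dz; have [du e] := resolventP Ann z t0; set u := resolvent A t z in du e *.
have dDu := closure_dom du.
have dAu : D (A u).
  have -> : A u = z - t%:C *: u by rewrite -e addrAC subrr add0r.
  by apply: closureB => //; exact: closureZ.
have [M M0 hM] := semigroup_bound.
(* Its derivative is e^(-t s) T(s) (t u + A u) = e^(-t s) T(s) z. *)
pose F s := (- expR (- (t * s)))%:C *: T s u.
rewrite (@FTC_integral_pos _ _ _ F (- u) 0) ?sub0r ?opprK //.
- exact: dom_laplace.
- move=> r r0.
  have v1 := @vderive_real R (fun s => - expR (- (t * s))) r _ (is_deriveN (is_derive_expRN t r)).
  have := vderive_scale v1 (vderive_semigroup r0 du dAu).
  rewrite /F; set V := (X in vderive _ _ X); set W := (X in _ -> vderive _ _ X).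
  have -> // : V = W.
  rewrite /V /W -e semigroup_comb ?(ltW r0) // scalerDr scalerA; congr (_ + _).
    by rewrite -rmorphM; congr (_%:C *: _); ring.
  by rewrite rmorphN scaleNr scalerN opprK.
- rewrite -scaleN1r /F; apply: (cvg_scale (c0 := (-1 : R[i]))); last exact: semigroup_cvg0.
  have -> : (-1 : R[i]) = (- expR (- (t * 0)))%:C by rewrite mulr0 oppr0 expR0 rmorphN.
  apply: cvg_real; apply: cvgN; apply: cvg_at_right_filter.
  apply: continuous_cvg; first exact: continuous_expR.
  by apply: cvgN; apply: cvgM; [exact: cvg_cst|exact: cvg_id].
- apply: (@squeeze_rnorm _ _ _ _ _ _ (fun s => expR (- (t * s)) * (M * rnorm u))).
    near=> s; rewrite subr0 rnormZR normrN ger0_norm ?expR_ge0 // ler_wpM2l ?expR_ge0 //.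
    by apply: hM => //; apply: ltW; near: s; exact: nbhs_pinfty_gt.
  rewrite -[X in _ --> X](mul0r (M * rnorm u)); apply: cvgM; last exact: cvg_cst.
  apply: (@cvg_comp _ _ _ (fun s => t * s) (fun s => expR (- s)) _ (pinfty_nbhs R)); last exact: cvgr_expR.
  by apply: gt0_cvgMry => //; exact: cvg_id.
Unshelve. all: by end_near.
Qed.

(* [A x] need not lie in [D], so the estimate is proved for [l R(l) x], where
   [A (l R(l) x) = l R(l) A x] is in [D] and bounded uniformly in [l]. *)
Lemma semigroup_lipschitz x : opdom A x -> exists2 K : R, 0 <= K &
  forall r, 0 < r -> rnorm (T r x - x) <= K * r.
Proof.
move=> dx; have dDx := closure_dom dx.
have [M M0 hM] := semigroup_bound; have [N N0 hN] := resolvent_bound Ann.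
exists (M * (N * rnorm (A x))) => [|r r0]; first by rewrite !mulr_ge0 ?rnorm_ge0.
set K := M * _.
pose u l := l%:C *: resolvent A l x.
have bu l : 0 < l -> rnorm (T r (u l) - u l) <= K * r.
  move=> l0; have [dR eR] := resolventP Ann x l0.
  have [du eu] := opappZ Alin l%:C dR.
  have eA : A (u l) = l%:C *: resolvent A l (A x).
    by rewrite /u eu (resolvent_op_comm Alin Ann l0 dx) (resolvent_op Ann x l0).
  have dAu : D (A (u l)).
    rewrite eA; apply: (closureZ Alin); apply: closure_dom; exact: (resolventP Ann _ l0).1.
  (* The orbit is differentiated at positive times only, so the estimate is made on [s, r] and s
     tends to 0. *)
  have c : rnorm (T r (u l) - T s (u l)) @[s --> 0^'+] --> rnorm (T r (u l) - u l).
    apply: rnorm_cvg; apply: cvgB; first exact: cvg_cst.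
    exact: semigroup_cvg0 (closure_dom du).
  apply: (cvgr_to_le c); near=> s.
  have s0 : 0 < s by near: s; exact: nbhs_right_gt.
  have sr : s <= r by near: s; exact: nbhs_right_le.
  apply: (@le_trans _ _ (K * (r - s))); last first.
    by rewrite ler_wpM2l ?gerBl ?(ltW s0) // !mulr_ge0 ?rnorm_ge0.
  apply: (@vderive_bound _ _ (T ^~ (u l)) (fun s => - T s (A (u l)))) => // v sv vr.
  have v0 : 0 < v := lt_le_trans s0 sv.
  split; first exact: vderive_semigroup.
  rewrite rnormN; apply: le_trans (hM _ _ (ltW v0) dAu) _.
  by rewrite ler_wpM2l // eA rnormZR gtr0_norm // hN.
have cu := resolvent_approx Alin Ann dDx.
have c : rnorm (T r (u l) - u l) @[l --> +oo] --> rnorm (T r x - x).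
  apply: rnorm_cvg; apply: cvgB => //.
  apply: (@squeeze_rnorm _ _ _ _ _ _ (fun l => M * rnorm (u l - x))); last first.
    rewrite -[X in _ --> X](mulr0 M); apply: cvgM; first exact: cvg_cst.
    exact/cvgr_rnorm0.
  near=> l; have l0 : 0 < l by near: l; exact: nbhs_pinfty_gt.
  have dul : D (u l) by apply: (closureZ Alin); apply: closure_dom; exact: (resolventP Ann x l0).1.
  by rewrite -semigroupB ?(ltW r0) //; apply: hM; [exact: ltW|exact: closureB].
by apply: (cvgr_to_le c); near=> l; apply: bu; near: l; exact: nbhs_pinfty_gt.
Unshelve. all: by end_near.
Qed.

Lemma dom_exp_cst t x : 0 < t -> dom (fun s => (expR (- (t * s)))%:C *: x).
Proof.
move=> t0; apply: (@dom_exp _ _ 0 _ (rnorm x)) => //; first by move=> r _; exact: cvg_cst.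
by move=> r r0; rewrite mul0r expR0 mulr1.
Qed.

Lemma integral_exp_cst t x : 0 < t -> t%:C *: integral_pos (fun s => (expR (- (t * s)))%:C *: x) = x.
Proof.
move=> t0; have tn : t != 0 by rewrite gt_eqF.
rewrite -integral_posZ; last exact: dom_exp_cst.
rewrite (@FTC_integral_pos _ _ _ (fun s => (- expR (- (t * s)))%:C *: x) (- x) 0) ?sub0r ?opprK //.
- exact/domZ/dom_exp_cst.
- move=> r r0.
  have v1 := @vderive_real R (fun s => - expR (- (t * s))) r _ (is_deriveN (is_derive_expRN t r)).
  have := vderive_scale v1 (vderive_cst x r).
  rewrite scaler0 addr0; set V := (X in vderive _ _ X); set W := (X in _ -> vderive _ _ X).
  have -> // : V = W by rewrite /V /W scalerA -rmorphM mulNr opprK.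
- rewrite -scaleN1r; apply: (cvg_scale (c0 := (-1 : R[i]))); last exact: cvg_cst.
  have -> : (-1 : R[i]) = (- expR (- (t * 0)))%:C by rewrite mulr0 oppr0 expR0 rmorphN.
  apply: cvg_real; apply: cvgN; apply: cvg_at_right_filter.
  apply: continuous_cvg; first exact: continuous_expR.
  by apply: cvgN; apply: cvgM; [exact: cvg_cst|exact: cvg_id].
- rewrite -[X in _ --> X](scale0r x); apply: (cvg_scale (c0 := (0 : R[i]))); last exact: cvg_cst.
  have -> : (0 : R[i]) = (- (0 : R))%:C by rewrite oppr0.
  apply: cvg_real; apply: cvgN.
  apply: (@cvg_comp _ _ _ (fun s => t * s) (fun s => expR (- s)) _ (pinfty_nbhs R)); last exact: cvgr_expR.
  by apply: gt0_cvgMry => //; exact: cvg_id.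
Qed.

(** From R(t) A x = x - t R(t) x, the Laplace formula for R(t) x and x = t int_0^oo e^(-t s) x ds.
    Only x, and not A x, has to lie in D. *)
Lemma resolvent_op_integral t x : 0 < t -> opdom A x ->
  resolvent A t (A x) = integral_pos (fun s => (t * expR (- (t * s)))%:C *: (x - T s x)).
Proof.
move=> t0 dx; have dDx := closure_dom dx.
have d1 := dom_exp_cst x t0; have d2 := dom_laplace t0 dDx.
rewrite (resolvent_op_comm Alin Ann t0 dx) -(resolvent_laplace t0 dDx) -{1}(integral_exp_cst x t0).
rewrite -scalerBr -integral_posB // -integral_posZ; last exact: domB.
apply: integral_pos_eq; last exact/domZ/domB.
by move=> r _; rewrite -scalerBr scalerA -rmorphM.
Qed.

End Semigroup.

(** * The kernels of the extension problem *)

Section HeatKernels.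
Context {R : realType} {X : completeNormedModType R[i]}.
Implicit Types (f g : R -> X) (z : R[i]) (r s y K C : R) (x : X).

Lemma vderive_comp (F : R -> X) (u : R -> R) (t u' : R) l :
  is_derive t 1 u u' -> vderive F (u t) l -> vderive (F \o u) t (u'%:C *: l).
Proof.
move=> du dF.
(* Extending the quotient by l at 0 covers the increments h with u (t + h) = u t. *)
pose Q k := if k == 0 then l else (k^-1)%:C *: (F (u t + k) - F (u t)).
have cQ : Q k @[k --> (0 : R)] --> l.
  apply/cvgr_rnormP => e e0.
  have /cvgr_rnormP/(_ e e0) [d /= d0 hd] := dF.
  exists d => // k /= kd; rewrite /Q; case: eqVneq => [_|k0]; last exact: hd.
  by rewrite subrr rnorm0 ltW.
have cu : u x @[x --> t] --> u t.
  by apply: differentiable_continuous; apply/derivable1_diffP; exact: ex_derive.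
have ck : u (t + h) - u t @[h --> (0 : R)^'] --> (0 : R).
  rewrite -[X in _ --> X](subrr (u t)); apply: cvgB; last exact: cvg_cst.
  have c0 : t + h @[h --> (0 : R)^'] --> t by apply: cvg_shift0.
  exact: (cvg_comp _ _ c0 cu).
have cQk := cvg_comp _ _ ck cQ.
have hS : ((h^-1)%:C *: ((u (t + h))%:C - (u t)%:C : Cx R) : R[i]) *: Q (u (t + h) - u t)
    @[h --> (0 : R)^'] --> (u'%:C : R[i]) *: l.
  exact: cvg_scale (vderive_real du) cQk.
rewrite /vderive; move: hS; apply: cvg_near_eq; apply: nearW => h; rewrite /= /Q subr_eq0.
case: eqVneq => [->|n]; first by rewrite !subrr !scaler0 scale0r.
rewrite [u t + _]addrC subrK scalerA; congr (_ *: _).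
by rewrite -rmorphB -[_ *: _]/(_ * _) -!rmorphM mulfK ?subr_eq0.
Qed.

(** With s = t^2/4, z = -alpha - 1 and f(r) = T(r) x, this is the integral in U(t) x;
    differentiation in s lowers z by 1. *)
Definition kint f z s := integral_pos (fun r => (expR (- (s * r^-1)))%:C *: (cpow r z *: f r)).

Lemma dom_kint f z s K : complex.Re z < -1 -> 0 < s -> cont_pos f ->
  (forall r, 0 < r -> rnorm (f r) <= K) ->
  dom (fun r => (expR (- (s * r^-1)))%:C *: (cpow r z *: f r)).
Proof.
move=> z1 s0 cf bf; apply: (@dom_expV _ _ (complex.Re z) _ K) => //.
  by apply: cont_pos_scale => //; exact: cont_pos_cpow.
move=> r r0; rewrite rnormZ cabs_cpow mulrC; apply: ler_wpM2r; first exact: expR_ge0.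
exact: bf.
Qed.

Lemma cpow_pred z r : 0 < r -> (r^-1)%:C * cpow r z = cpow r (z - 1).
Proof. by move=> r0; rewrite cpowD cpowN cpow1 // mulrC fmorphV. Qed.

Lemma vderive_kint f z s K : complex.Re z < -1 -> 0 < s -> cont_pos f ->
  (forall r, 0 < r -> rnorm (f r) <= K) ->
  vderive (kint f z) s (- kint f (z - 1) s).
Proof.
move=> z1 s0 cf bf.
have z2 : complex.Re (z - 1) < -1 by rewrite ReD; case: (z) z1 => a b /=; lra.
have z3 : complex.Re (z - 1 - 1) < -1 by move: z2; rewrite !ReD /=; lra.
have e1 r : 0 < r -> (r^-1)%:C *: (cpow r z *: f r) = cpow r (z - 1) *: f r.
  by move=> r0; rewrite scalerA cpow_pred.
have e2 r : 0 < r -> ((r^-1) ^+ 2)%:C *: (cpow r z *: f r) = cpow r (z - 1 - 1) *: f r.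
  by move=> r0; rewrite expr2 rmorphM -scalerA e1 // scalerA cpow_pred.
have -> : kint f (z - 1) s = integral_pos (fun r => (expR (- (s * r^-1)))%:C *: ((r^-1)%:C *: (cpow r z *: f r))).
  apply: integral_pos_eq; first by move=> r r0; rewrite e1.
  exact: dom_kint z2 s0 cf bf.
apply: (@vderive_exp_integral _ _ (fun r => r^-1)) => //.
- by move=> r r0; apply: cvgV; [rewrite gt_eqF|exact: cvg_id].
- by move=> r r0; rewrite invr_gt0.
- by apply: cont_pos_scale => //; exact: cont_pos_cpow.
- by move=> v v0; exact: dom_kint z1 v0 cf bf.
- move=> v v0; apply: dom_eq (dom_kint z2 v0 cf bf) => r r0; by rewrite e1.
- move=> v v0; apply: dom_eq (dom_kint z3 v0 cf bf) => r r0; by rewrite e2.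
Qed.

(** The derivative of e^(-s/r) r^z in r has integral 0. For z = -alpha this says that [Lam]
    annihilates constant functions. *)
Lemma kint_cst z s x : complex.Re z < 0 -> 0 < s ->
  s%:C *: kint (fun=> x) (z - 1 - 1) s = - (z *: kint (fun=> x) (z - 1) s).
Proof.
move=> z0 s0; have cx : cont_pos (fun _ : R => x) by move=> r _; exact: cvg_cst.
have bx r : 0 < r -> rnorm ((fun=> x) r) <= rnorm x by [].
have z1 : complex.Re (z - 1) < -1 by rewrite ReD; case: (z) z0 => a b /=; lra.
have z2 : complex.Re (z - 1 - 1) < -1 by move: z1; rewrite !ReD /=; lra.
have d1 := dom_kint z1 s0 cx bx; have d2 := dom_kint z2 s0 cx bx.
pose F r := (expR (- (s * r^-1)))%:C *: (cpow r z *: x).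
have [F0 F1] : F r @[r --> (0 : R)^'+] --> 0 /\ F r @[r --> +oo] --> 0.
  apply: (dom_primitive_cvg0 (K := 1) _ d1) => // r r0.
  rewrite mul1r !rnormZ !cabs_cpow ReD -[complex.Re (- 1)]/(-1 : R) mulrDl expRD mulN1r.
  have -> : expR (- ln r) = r^-1 by rewrite expRN lnK ?posrE.
  rewrite le_eqVlt; apply/orP; left; apply/eqP.
  move: (cabs _) (expR (complex.Re z * _)) (rnorm x) => a b c; field.
  by rewrite gt_eqF.
apply/eqP; rewrite -subr_eq0 opprK -integral_posZ // -integral_posZ // -integral_posD; try exact: domZ.
rewrite (@FTC_integral_pos _ _ _ F 0 0) ?subrr //.
  exact: (domD (domZ _ d2) (domZ _ d1)).
move=> r r0.
have dr : is_derive r 1 (fun r => expR (- (s * r^-1))) (s * r ^- 2 * expR (- (s * r^-1))).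
  have rn : r != 0 by rewrite gt_eqF.
  have h := is_derive1_comp (is_derive_expRN s r^-1) (is_deriveV rn (is_derive_id r 1)).
  by apply: (is_derive_eq h); rewrite /GRing.scale /=; ring.
have := vderive_scale (vderive_real dr) (vderive_scale (vderive_cpow (z := z) r0) (vderive_cst x r)).
rewrite /F; set V := (X in vderive _ _ X); set W := (X in _ -> vderive _ _ X).
have -> // : V = W.
rewrite /V /W scaler0 addr0 !scalerA; congr (_ *: _ + _ *: _).
  have -> : s * r ^- 2 * expR (- (s * r^-1)) = s * expR (- (s * r^-1)) * r^-1 * r^-1.
    by field; rewrite gt_eqF.
  by rewrite !rmorphM -(cpow_pred (z - 1) r0) -(cpow_pred z r0) !mulrA.
by rewrite mulrCA !mulrA.
Qed.

Lemma min1_le_pow (th y : R) : 0 < th -> th <= 1 -> 0 < y -> Num.min 1 y <= expR (th * ln y).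
Proof.
move=> t0 t1 y0; case: (leP 1 y) => y1.
  by rewrite -expR0 ler_expR mulr_ge0 ?ln_ge0 // ltW.
have l0 : ln y <= 0 by rewrite ln_le0 // ltW.
by rewrite -[X in X <= _]lnK ?posrE // ler_expR; nra.
Qed.

(** The bound (s/r)^th splits into s^th, which tends to 0, and r^(-th), which the integrand is
    assumed to absorb. *)
Lemma integral_small (c : R -> R -> Cx R) th B f : 0 < th -> 0 <= B ->
  dom (fun r => (expR (- (th * ln r)))%:C *: f r) ->
  (forall s, 0 < s -> cont_pos (fun r => (c s r : R[i]) *: f r)) ->
  (forall s r, 0 < s -> 0 < r -> cabs (c s r) <= B * expR (th * ln (s * r^-1))) ->
  integral_pos (fun r => (c s r : R[i]) *: f r) @[s --> (0 : R)^'+] --> 0.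
Proof.
move=> t0 B0 [C [a hd]] cc hc; have [a0 _ _] := hd.
apply: (@squeeze_rnorm _ _ _ _ _ _ (fun s => B * C * (4 / a) * expR (th * ln s))).
  near=> s; have s0 : 0 < s by near: s; exact: nbhs_right_gt.
  rewrite subr0 [leRHS]mulrC; set Q := expR (th * ln s).
  have BQ : 0 <= B * Q by rewrite mulr_ge0 ?expR_ge0.
  have hh : dominated (B * Q * C) a (fun r => (c s r : R[i]) *: f r).
    apply: (dominated_le BQ _ _ hd); first exact: cc.
    move=> r r0; rewrite rnormZ rnormZR mulrA ger0_norm ?expR_ge0 //.
    rewrite ler_wpM2r ?rnorm_ge0 //; apply: le_trans (hc s r s0 r0) _.
    by rewrite lnM ?lnV ?posrE ?invr_gt0 // mulrBr expRD mulrA.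
  apply: le_trans (rnorm_integral_pos hh) _.
  by have -> : B * Q * C * (4 / a) = Q * (B * C * (4 / a)) by ring.
have e0 : B * C * (4 / a) * 0 = 0 by rewrite mulr0.
rewrite -[X in _ --> X]e0; apply: cvgM; first exact: cvg_cst.
have [h _] := expR_absln_cvg0 t0; move: h; apply: cvg_near_eq; near=> s.
have s1 : s <= 1 by near: s; apply: nbhs_right_le.
by rewrite ler0_norm ?ln_le0 // mulrNN.
Unshelve. all: by end_near.
Qed.

(** Each bound on f serves one end: the linear one raises the exponent to p + 1 > -1 near 0, the
    constant one keeps p < -1 near oo. *)
Lemma dom_pow f (p : R) C : -2 < p -> p < -1 -> cont_pos f -> 0 <= C ->
  (forall r, 0 < r -> rnorm (f r) <= C) ->
  (forall r, 0 < r -> rnorm (f r) <= C * r) -> dom (fun r => (expR (p * ln r))%:C *: f r).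
Proof.
move=> p2 p1 cf C0 b1 b2; exists C, (Num.min (p + 1 + 1) (- p - 1)).
apply: dominatedI => //; first by lra.
- apply: cont_pos_scale => //; apply: cont_pos_real => r r0.
  apply: continuous_cvg; first exact: continuous_expR.
  by apply: cvgM; [exact: cvg_cst|exact: cont_ln].
- move=> r r0 _; rewrite rnormZR ger0_norm ?expR_ge0 // mulrDl expRD mul1r lnK ?posrE //.
  by rewrite mulrCA ler_wpM2l ?expR_ge0 // b2.
- move=> r r1; rewrite rnormZR ger0_norm ?expR_ge0 // mulrC ler_wpM2r ?expR_ge0 // b1 //.
  exact: lt_le_trans r1.
Qed.

Lemma kint_cvg0 f z C : -2 < complex.Re z -> complex.Re z < -1 -> cont_pos f -> 0 <= C ->
  (forall r, 0 < r -> rnorm (f r) <= C) -> (forall r, 0 < r -> rnorm (f r) <= C * r) ->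
  kint f z s @[s --> 0^'+] --> integral_pos (fun r => cpow r z *: f r) /\
  s%:C *: kint f (z - 1) s @[s --> 0^'+] --> 0.
Proof.
move=> z2 z1 cf C0 b1 b2.
(* Half of the margin of Re z above -2 is spent on the factor s^th. The kernels 1 - e^(-y) and y
   e^(-y), y = s/r, are at most min(1, y) <= y^th. *)
have th0 : exists2 th : R, 0 < th <= 1 & -2 < complex.Re z - th.
  exists ((complex.Re z + 2) / 2); last by lra.
  by apply/andP; split; lra.
have [th /andP[t0 t1] hth] := th0.
have cg := cont_pos_scale (@cont_pos_cpow R z) cf.
have dg : dom (fun r => cpow r z *: f r).
  apply: (dom_le (K := 1) (g := fun r => (expR (complex.Re z * ln r))%:C *: f r)) => //.
    by move=> r r0; rewrite mul1r rnormZ rnormZR cabs_cpow ger0_norm ?expR_ge0.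
  exact: (dom_pow z2 z1 cf C0 b1 b2).
have dt : dom (fun r => (expR (- (th * ln r)))%:C *: (cpow r z *: f r)).
  apply: (dom_le (K := 1) (g := fun r => (expR ((complex.Re z - th) * ln r))%:C *: f r)) => //.
  - apply: cont_pos_scale => //; apply: cont_pos_real => r r0.
    apply: continuous_cvg; first exact: continuous_expR.
    by apply: cvgN; apply: cvgM; [exact: cvg_cst|exact: cont_ln].
  - move=> r r0; rewrite mul1r !rnormZ !cabs_real cabs_cpow !ger0_norm ?expR_ge0 // mulrA.
    by rewrite -expRD mulrBl [X in expR X]addrC.
  - by apply: (dom_pow hth _ cf C0 b1 b2); lra.
have cexp s : 0 < s -> cont_pos (fun r => (expR (- (s * r^-1)))%:C : Cx R).
  move=> s0; apply: cont_pos_real => r r0.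
  apply: continuous_cvg; first exact: continuous_expR.
  apply: cvgN; apply: cvgM; first exact: cvg_cst.
  by apply: cvgV; [rewrite gt_eqF|exact: cvg_id].
have ypos s r : 0 < s -> 0 < r -> 0 < s * r^-1 by move=> s0 r0; rewrite mulr_gt0 ?invr_gt0.
split.
- have := @integral_small (fun s r => (expR (- (s * r^-1)) - 1)%:C) th 1 _ t0 ler01 dt _ _.
  move=> h.
  have {}h : integral_pos (fun r => (expR (- (s * r^-1)) - 1)%:C *: (cpow r z *: f r)) @[s --> (0 : R)^'+] --> 0.
    apply: h.
    + move=> s s0.
      apply: (@cont_pos_eq _ _ (fun r => (expR (- (s * r^-1)))%:C *: (cpow r z *: f r) - cpow r z *: f r)).
        by move=> r r0; rewrite rmorphB scalerBl scale1r.
      move=> r r0; apply: cvgB; last exact: cg.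
      exact: (cont_pos_scale (cexp s s0) cg).
    + move=> s r s0 r0; rewrite cabs_real mul1r distrC.
      have y0 := ypos s r s0 r0; apply: le_trans (min1_le_pow t0 t1 y0).
      rewrite ger0_norm ?subr_ge0 ?expR_le1 ?oppr_le0 ?(ltW y0) //.
      rewrite le_min gerBl expR_ge0 /= lerBlDl -lerBlDr.
      by have := expR_ge1Dx (- (s * r^-1)); rewrite addrC.
  pose I := integral_pos (fun r => cpow r z *: f r).
  have hI : integral_pos (fun r => (expR (- (s * r^-1)) - 1)%:C *: (cpow r z *: f r)) + I @[s --> (0 : R)^'+] --> 0 + I.
    by apply: cvgD h _; exact: cvg_cst.
  rewrite -[X in _ --> X]add0r; move: hI; apply: cvg_near_eq; near=> s.
  have s0 : 0 < s by near: s; exact: nbhs_right_gt.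
  have d1 : dom (fun r => (expR (- (s * r^-1)))%:C *: (cpow r z *: f r)) := dom_kint z1 s0 cf b1.
  have -> : integral_pos (fun r => (expR (- (s * r^-1)) - 1)%:C *: (cpow r z *: f r)) =
     kint f z s - integral_pos (fun r => cpow r z *: f r).
    rewrite /kint -(integral_posB d1 dg); apply/esym/integral_pos_eq; last exact: domB.
    by move=> r r0; rewrite rmorphB scalerBl scale1r.
  by rewrite subrK.
- have := @integral_small (fun s r => ((s * r^-1) * expR (- (s * r^-1)))%:C) th 1 _ t0 ler01 dt _ _.
  move=> h.
  have {}h : integral_pos (fun r => ((s * r^-1) * expR (- (s * r^-1)))%:C *: (cpow r z *: f r)) @[s --> (0 : R)^'+] --> 0.
    apply: h.
    + move=> s s0.
      have c1 : @cont_pos R (Cx R) (fun r => (s * r^-1)%:C).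
        apply: cont_pos_real => r r0; apply: cvgM; first exact: cvg_cst.
        by apply: cvgV; [rewrite gt_eqF|exact: cvg_id].
      apply: (@cont_pos_eq _ _ (fun r => (s * r^-1)%:C *: ((expR (- (s * r^-1)))%:C *: (cpow r z *: f r)))).
        by move=> r r0; rewrite !scalerA -rmorphM.
      exact: cont_pos_scale c1 (cont_pos_scale (cexp s s0) cg).
    + move=> s r s0 r0; rewrite cabs_real mul1r.
      have y0 := ypos s r s0 r0; apply: le_trans (min1_le_pow t0 t1 y0).
      move: (s * r^-1) y0 => y y0; rewrite ger0_norm ?mulr_ge0 ?expR_ge0 ?(ltW y0) //.
      rewrite le_min ler_piMr ?(ltW y0) ?expR_le1 ?oppr_le0 ?(ltW y0) // andbT expRN ler_pdivrMr ?expR_gt0 // mul1r.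
      by apply: le_trans (expR_ge1Dx y); rewrite lerDr.
  move: h; apply: cvg_near_eq; near=> s.
  have s0 : 0 < s by near: s; exact: nbhs_right_gt.
  have z2' : complex.Re (z - 1) < -1 by rewrite ReD; case: (z) z1 => a b /=; lra.
  have d1 := dom_kint z2' s0 cf b1.
  rewrite /kint -(integral_posZ s%:C d1); apply/esym/integral_pos_eq; last exact: domZ.
  move=> r r0; rewrite -(cpow_pred z r0) !scalerA; congr (_ *: _).
  by rewrite !rmorphM; ring.
Unshelve. all: by end_near.
Qed.

Lemma kintB f g w s C : complex.Re w < -1 -> 0 < s -> cont_pos f -> cont_pos g ->
  (forall r, 0 < r -> rnorm (f r) <= C) -> (forall r, 0 < r -> rnorm (g r) <= C) ->
  kint (fun r => f r - g r) w s = kint f w s - kint g w s.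
Proof.
move=> w1 s0 cf cg bf bg; have df := dom_kint w1 s0 cf bf; have dg := dom_kint w1 s0 cg bg.
rewrite /kint -(integral_posB df dg); apply/esym/integral_pos_eq; last exact: domB.
by move=> r _; rewrite !scalerBr.
Qed.

End HeatKernels.

(** * The weighted derivative of the extension U(t) x *)

Section DirichletNeumannDerivative.
Context {R : realType} {X : completeNormedModType R[i]}.
Variable alpha : R[i].
Hypothesis alpha01 : 0 < complex.Re alpha < 1.
Implicit Types (f g : R -> X) (s C : R) (x : X).

Local Notation z := (- alpha - 1).

Let z2 : -2 < complex.Re z.
Proof. by move: alpha01; case: (alpha) => a b /= /andP[]; lra. Qed.

Let z1 : complex.Re z < -1.
Proof. by move: alpha01; case: (alpha) => a b /= /andP[]; lra. Qed.

Let z11 : complex.Re (z - 1) < -1.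
Proof. by move: z1; case: (alpha) => a b /=; lra. Qed.

Definition Kc : R[i] := (cGamma alpha)^-1 * cpow 2 (- (2 * alpha)).

(* [int_0^oo e^(-s/r) (2 alpha - 2 s/r) r^(-alpha-1) f(r) dr] *)
Definition Lam f s : X := (2 * alpha) *: kint f z s - (2 * s)%:C *: kint f (z - 1) s.

Definition Uf f (s : R) : X := ((cGamma alpha)^-1 * cpow (s / 2) (2 * alpha)) *: kint f z (s ^+ 2 / 4).

Lemma cpow_half s : 0 < s -> cpow (s / 2) (2 * alpha) = cpow 2 (- (2 * alpha)) * cpow s (2 * alpha).
Proof. by move=> s0; rewrite cpowM ?invr_gt0 // cpowV // cpowN mulrC. Qed.

(** [V] stands for t |-> U(t) x, which is given by the integral for t > 0 only. The factor t^(1-2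
    alpha) cancels the powers of t produced by the product and chain rules, up to t itself, which
    combines with t/2 to t^2/2 = 2 s. *)
Lemma real_derive_Uf (V : R -> X) f C (t : R) : 0 < t -> cont_pos f ->
  (forall r, 0 < r -> rnorm (f r) <= C) -> (forall v, 0 < v -> V v = Uf f v) ->
  - (cpow t (1 - 2 * alpha) *: real_derive V t) = - (Kc *: Lam f (t ^+ 2 / 4)).
Proof.
move=> t0 cf bf hV; have s0 : 0 < t ^+ 2 / 4 by rewrite divr_gt0 // exprn_gt0.
have du : is_derive t 1 (fun v : R => v ^+ 2 / 4) (t / 2).
  by apply: is_derive_eq; rewrite /GRing.scale /=; field.
have dG := vderive_comp du (vderive_kint z1 s0 cf bf).
have dc := vderive_cpow (z := 2 * alpha) t0.
have dK := @vderive_cst R (Cx R) Kc t.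
have dV := vderive_scale dK (vderive_scale dc dG).
have -> : real_derive V t = Kc *: ((2 * alpha * cpow t (2 * alpha - 1)) *: kint f z (t ^+ 2 / 4) +
   cpow t (2 * alpha) *: ((t / 2)%:C *: - kint f (z - 1) (t ^+ 2 / 4))).
  apply: real_derive_vderive; move: dV; rewrite scale0r add0r.
  apply: vderive_eq; near=> v; have v0 : 0 < v by near: v; exact: near_pos.
  by rewrite (hV v v0) /Uf (cpow_half v0) scalerA /Kc -mulrA.
congr (- _); rewrite scalerA [_ * Kc]mulrC -[(Kc * _) *: _]scalerA; congr (_ *: _).
have e1 : cpow t (1 - 2 * alpha) * cpow t (2 * alpha - 1) = 1.
  by rewrite -cpowD addrA subrK subrr cpow0.
have e2 : cpow t (1 - 2 * alpha) * cpow t (2 * alpha) = t%:C.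
  by rewrite -cpowD subrK cpow1.
rewrite scalerDr !scalerA mulrCA e1 mulr1 mulrA e2 /Lam; congr (_ + _).
rewrite scalerN -rmorphM; congr (- (_%:C *: _)).
by field.
Unshelve. all: by end_near.
Qed.

Lemma LamB_cst f x s C : 0 < s -> cont_pos f -> (forall r, 0 < r -> rnorm (f r) <= C) ->
  Lam (fun r => x - f r) s = - Lam f s.
Proof.
move=> s0 cf bf; have cx : cont_pos (fun _ : R => x) by move=> r _; exact: cvg_cst.
pose K := Num.max C (rnorm x).
have b1 r : 0 < r -> rnorm ((fun _ : R => x) r) <= K by move=> _; rewrite le_max lexx orbT.
have b2 r : 0 < r -> rnorm (f r) <= K by move=> r0; rewrite le_max bf.
have k1 := kintB z1 s0 cx cf b1 b2; have k2 := kintB z11 s0 cx cf b1 b2.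
have a0 : complex.Re (- alpha) < 0 by move: alpha01; case: (alpha) => a b /= /andP[]; lra.
have k3 := kint_cst x a0 s0.
rewrite /Lam k1 k2; move: (kint (fun=> x) z s) (kint (fun=> x) (z - 1) s) (kint f z s) (kint f (z - 1) s) k3.
move=> a c b d k3.
have k4 : (2 * s)%:C *: c = (2 * alpha) *: a.
  have -> : (2 * s)%:C = 2 * s%:C :> R[i] by rewrite rmorphM rmorph_nat.
  by rewrite -[LHS]scalerA k3 scaleNr opprK scalerA.
by rewrite !scalerBr k4 !opprB addrC addrA subrK.
Qed.

Lemma Lam_cvg f C : cont_pos f -> 0 <= C -> (forall r, 0 < r -> rnorm (f r) <= C) ->
  (forall r, 0 < r -> rnorm (f r) <= C * r) ->
  Lam f s @[s --> (0 : R)^'+] --> (2 * alpha) *: integral_pos (fun r => cpow r z *: f r).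
Proof.
move=> cf C0 b1 b2; have [h1 h2] := kint_cvg0 z2 z1 cf C0 b1 b2.
rewrite -[X in _ --> X]subr0 /Lam; apply: cvgB.
  by apply: (cvg_scale (c0 := 2 * alpha)) h1; exact: cvg_cst.
rewrite -(scaler0 _ (2 : R)%:C); apply: (cvg_near_eq (f := fun s : R => (2 : R)%:C *: (s%:C *: kint f (z - 1) s))).
  by apply: nearW => s; rewrite scalerA -rmorphM.
exact: cvg_realP.
Qed.

Lemma Lam_linear (L : X -> X) (K : R) f C s : 0 < s -> cont_pos f ->
  (forall r, 0 < r -> rnorm (f r) <= C) ->
  (forall (a : R[i]) x y, L (a *: x + y) = a *: L x + L y) ->
  (forall x, rnorm (L x) <= K * rnorm x) -> Lam (L \o f) s = L (Lam f s).
Proof.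
move=> s0 cf bf lin bL.
have L0 : L 0 = 0.
  have := lin 1 0 0; rewrite !scale1r addr0 => e.
  by apply: (addrI (L 0)); rewrite -e addr0.
have LZ a x : L (a *: x) = a *: L x by rewrite -[a *: x]addr0 lin L0 !addr0.
have h w : complex.Re w < -1 -> kint (L \o f) w s = L (kint f w s).
  move=> w1; have df := dom_kint w1 s0 cf bf.
  rewrite /kint -(integral_pos_linear lin bL df); apply/esym/integral_pos_eq.
    by move=> r _ /=; rewrite !LZ.
  have [D [b db]] := dom_linear lin bL df; by exists D, b.
rewrite /Lam !h // addrC -scaleNr -(LZ (2 * alpha)) -lin; congr L.
by rewrite scaleNr addrC.
Qed.

Lemma Lam_mem (S : set X) f C s : 0 < s -> cont_pos f ->
  (forall r, 0 < r -> rnorm (f r) <= C) -> S 0 ->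
  (forall (a : R[i]) x y, S x -> S y -> S (a *: x + y)) -> (forall r, 0 < r -> S (f r)) ->
  exists u v, [/\ closure S u, closure S v & Lam f s = (2 * alpha) *: u - (2 * s)%:C *: v].
Proof.
move=> s0 cf bf S0 SD Sf.
have SZ a x : S x -> S (a *: x) by move=> Sx; rewrite -[_ *: _]addr0; exact: SD.
have h w : complex.Re w < -1 -> closure S (kint f w s).
  move=> w1; have [D [a da]] := dom_kint w1 s0 cf bf.
  by apply: (integral_pos_mem da) => // r r0; apply: (SZ); apply: (SZ); exact: Sf.
by exists (kint f z s), (kint f (z - 1) s); split=> //; exact: h.
Qed.

End DirichletNeumannDerivative.

(** * The Balakrishnan integral *)

Section FubiniHalfLine.
Context {R : realType}.
Local Notation mu := (@lebesgue_measure R).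
Local Notation pos := (`]0, +oo[%classic : set (measurableTypeR R)).
Implicit Types (k : R -> R -> R) (B f g : R -> R).

Lemma rintE f : mu.-integrable pos (EFin \o f) -> (\int[mu]_(x in pos) (f x)%:E)%E = (rint f)%:E.
Proof. by move=> hf; rewrite /rint /Rintegral fineK //; exact: integrable_fin_num hf. Qed.

(** [B] dominates the inner integrals of |k|, so by Tonelli the kernel extended by 0 is integrable
    on the plane. *)
Lemma rint_Fubini k B :
  measurable_fun (pos `*` pos) (fun z : measurableTypeR R * measurableTypeR R => k z.1 z.2) ->
  (forall t, 0 < t -> mu.-integrable pos (EFin \o k t)) ->
  (forall s, 0 < s -> mu.-integrable pos (EFin \o k^~ s)) ->
  (forall s, 0 < s -> (\int[mu]_(t in pos) (`|k t s|)%:E <= (B s)%:E)%E) ->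
  mu.-integrable pos (EFin \o B) ->
  rint (fun t => rint (k t)) = rint (fun s => rint (k^~ s)).
Proof.
move=> mk ik1 ik2 hB iB.
have mpos : measurable pos by [].
have mpp : measurable (pos `*` pos) by exact: measurableX.
pose K : measurableTypeR R * measurableTypeR R -> \bar R := (fun z => (k z.1 z.2)%:E) \_ (pos `*` pos).
have mK : measurable_fun setT K.
  apply/(measurable_restrictT _ mpp); apply/measurable_EFinP; exact: mk.
have KE t s : K (t, s) = ((fun s => ((fun t => (k t s)%:E) \_ pos) t) \_ pos) s.
  rewrite /K !patchE in_setX /=; case: (s \in pos); case: (t \in pos) => //=.
have KE' t s : K (t, s) = ((fun t => ((fun s => (k t s)%:E) \_ pos) s) \_ pos) t.
  rewrite /K !patchE in_setX /=; case: (s \in pos); case: (t \in pos) => //=.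
have iK : (mu \x mu)%E.-integrable setT K.
  apply/(integrable21ltyP _ _ mK).
  apply: (@le_lt_trans _ _ (\int[mu]_(s in pos) (B s)%:E)%E); last first.
    by rewrite (rintE iB) ltry.
  rewrite [leRHS]integral_mkcond; apply: ge0_le_integral => //.
  - by move=> s _; apply: integral_ge0.
  - apply: (measurable_fun_fubini_tonelli_G (m1 := mu) (abse \o K)) => //=.
    exact: measurableT_comp.
  - by apply/(measurable_restrictT _ mpos); exact: measurable_int iB.
  move=> s _; rewrite patchE; case: ifPn => [|sn].
    rewrite inE => /posP s0; apply: le_trans (hB s s0).
    rewrite [leRHS]integral_mkcond le_eqVlt; apply/orP; left; apply/eqP.
    apply: eq_integral => t _; rewrite KE !patchE.
    have -> : s \in pos by rewrite inE; apply/posP.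
    by case: ifP => // _; rewrite abse0.
  rewrite (eq_integral (fun=> 0%E)) ?integral0 // => t _.
  by rewrite KE patchE (negbTE sn) abse0.
have F := Fubini iK.
have E1 : (\int[mu]_t \int[mu]_s K (t, s))%E = (\int[mu]_(t in pos) (rint (k t))%:E)%E.
  rewrite [RHS]integral_mkcond; apply: eq_integral => t _; rewrite patchE.
  case: ifPn => [|tn].
    rewrite inE => /posP t0; rewrite -(rintE (ik1 t t0)) [RHS]integral_mkcond.
    apply: eq_integral => s _; rewrite KE' [LHS]patchE.
    by have -> : t \in pos by rewrite inE; apply/posP.
  rewrite (eq_integral (fun=> 0%E)) ?integral0 // => s _.
  by rewrite KE' patchE (negbTE tn).
have E2 : (\int[mu]_s \int[mu]_t K (t, s))%E = (\int[mu]_(s in pos) (rint (k^~ s))%:E)%E.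
  rewrite [RHS]integral_mkcond; apply: eq_integral => s _; rewrite patchE.
  case: ifPn => [|sn].
    rewrite inE => /posP s0; rewrite -(rintE (ik2 s s0)) [RHS]integral_mkcond.
    apply: eq_integral => t _; rewrite KE [LHS]patchE.
    by have -> : s \in pos by rewrite inE; apply/posP.
  rewrite (eq_integral (fun=> 0%E)) ?integral0 // => t _.
  by rewrite KE patchE (negbTE sn).
by rewrite [LHS]/rint /Rintegral -E1 F E2.
Qed.

Lemma measurable_prod_pos (a b : R -> R) : cont_pos a -> cont_pos b ->
  measurable_fun (pos `*` pos) (fun z : measurableTypeR R * measurableTypeR R => a z.1 * b z.2).
Proof.
move=> ca cb; apply: measurable_funM.
  apply: (measurable_comp (F := pos) (f := a) (g := fst)) => //.
  - by move=> _ [[u v] [/= u0 v0] <-].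
  - exact: measurable_cont_pos.
  - exact: measurable_funTS measurable_fst.
apply: (measurable_comp (F := pos) (f := b) (g := snd)) => //.
- by move=> _ [[u v] [/= u0 v0] <-].
- exact: measurable_cont_pos.
- exact: measurable_funTS measurable_snd.
Qed.

Lemma measurable_exp_prod (a b a' b' : R -> R) : cont_pos a -> cont_pos b -> cont_pos a' -> cont_pos b' ->
  measurable_fun (pos `*` pos) (fun z : measurableTypeR R * measurableTypeR R =>
    expR (- (z.1 * z.2)) * (a z.1 * b z.2 + a' z.1 * b' z.2)).
Proof.
move=> ca cb ca' cb'; apply: measurable_funM.
  apply: (measurableT_comp (measurable_expR (R := R))).
  apply: measurableT_comp; first exact: oppr_measurable.
  by apply: (@measurable_prod_pos id id) => r r0; exact: cvg_id.
by apply: measurable_funD; exact: measurable_prod_pos.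
Qed.

End FubiniHalfLine.

Section Balakrishnan.
Context {R : realType} {X : completeNormedModType R[i]}.
Variables (A : operator X) (alpha : R[i]).
Hypothesis Alin : linear_operator A.
Hypothesis Ann : nonnegative A.
Hypothesis alpha01 : 0 < complex.Re alpha < 1.
Implicit Types (x y : X) (l s t : R).

Lemma resolvent_identity l t y : 0 < l -> 0 < t ->
  resolvent A t y - resolvent A l y = (l - t)%:C *: resolvent A t (resolvent A l y).
Proof.
move=> l0 t0; have [dt et] := resolventP Ann y t0; have [dl el] := resolventP Ann y l0.
have [dd ed] := opapp_comb Alin (-1) dl dt.
rewrite !scaleN1r in dd ed.
have lin a u v := resolvent_comb Alin Ann a u v t0.
have l00 : resolvent A t 0 = 0.
  by have := resolventB Alin Ann 0 0 t0; rewrite !subrr.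
have -> : (l - t)%:C *: resolvent A t (resolvent A l y) = resolvent A t ((l - t)%:C *: resolvent A l y).
  by have := lin (l - t)%:C (resolvent A l y) 0; rewrite l00 !addr0.
rewrite addrC -[LHS](resolventK Ann t0 dd) ed; congr (resolvent A t _).
rewrite (resolvent_op Ann y t0) (resolvent_op Ann y l0) rmorphB scalerBl scalerDr scalerN.
move: (resolvent A t y) (resolvent A l y) => u v.
by rewrite opprB [_ - y + _]addrA subrK [LHS]addrC addrACA addNr addr0.
Qed.

Lemma cont_pos_resolvent y : cont_pos (fun t => resolvent A t y).
Proof.
move=> r r0; have [M M0 hM] := resolvent_bound Ann; set g := fun t => _.
have bd l z : 0 < l -> rnorm (resolvent A l z) <= M / l * rnorm z.
  by move=> l0; rewrite mulrAC ler_pdivlMr // mulrC hM.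
apply: (@squeeze_rnorm _ _ _ _ _ _ (fun t => `|r - t| * (M / (r / 2) * (M / r * rnorm y)))).
  near=> t.
  have tr : r / 2 < t.
    near: t; exists (r / 2) => [|v]; first by rewrite /= divr_gt0.
    by rewrite /ball_ /= ltr_norml => /andP[]; lra.
  have r2 : 0 < r / 2 by rewrite divr_gt0.
  have t0 : 0 < t := lt_trans r2 tr.
  rewrite /g (resolvent_identity y r0 t0) rnormZR ler_wpM2l //.
  apply: le_trans (bd _ _ t0) _; apply: ler_pM; rewrite ?rnorm_ge0 ?bd //.
    by rewrite divr_ge0 // ltW.
  by rewrite ler_wpM2l // lef_pV2 ?posrE // ltW.
rewrite -[X in _ --> X](mul0r (M / (r / 2) * (M / r * rnorm y))); apply: cvgM; last exact: cvg_cst.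
by apply/cvgrPdist_le => e e0; exists e => // v /= h; rewrite sub0r normrN normr_id ltW.
Unshelve. all: by end_near.
Qed.

(* Near [0] one uses [R(t) A x = x - t R(t) x]. *)
Lemma dom_balakrishnan : exists2 M : R, 0 <= M & forall x, opdom A x ->
  dominated (M * (rnorm x + rnorm (A x))) (Num.min (complex.Re alpha - 1 + 1) (- (complex.Re alpha - 2) - 1))
    (fun t => cpow t (alpha - 1) *: resolvent A t (A x)).
Proof.
have [M M0 hM] := resolvent_bound Ann; exists (1 + M) => [|x dx]; first by rewrite addr_ge0.
have re : complex.Re (alpha - 1) = complex.Re alpha - 1 by rewrite ReD.
have /andP[a0 a1] := alpha01.
apply: dominatedI; [lra|lra| | |].
- apply: cont_pos_scale; [exact: cont_pos_cpow|exact: cont_pos_resolvent].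
- move=> r r0 r1; rewrite rnormZ cabs_cpow re mulrC ler_wpM2r ?expR_ge0 //.
  rewrite (resolvent_op_comm Alin Ann r0 dx); apply: le_trans (rnormB _ _) _.
  have h := hM r x r0.
  rewrite rnormZR gtr0_norm //; have := rnorm_ge0 x; have := rnorm_ge0 (A x); nra.
- move=> r r1; have r0 : 0 < r := lt_le_trans ltr01 r1.
  rewrite rnormZ cabs_cpow re.
  have -> : complex.Re alpha - 1 = complex.Re alpha - 2 + 1 by ring.
  rewrite mulrDl mul1r expRD lnK ?posrE // -mulrA mulrC ler_wpM2r ?expR_ge0 //.
  by have := hM r (A x) r0; have := rnorm_ge0 x; have := rnorm_ge0 (A x); nra.
Qed.

Lemma resolvent_comm l t y : 0 < l -> 0 < t ->
  resolvent A l (resolvent A t y) = resolvent A t (resolvent A l y).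
Proof.
move=> l0 t0; case: (eqVneq l t) => [-> //|lt].
have lt0 : (l - t)%:C != 0 :> R[i].
  by rewrite -(rmorph0 (real_complex R)) (inj_eq (@complexI R)) subr_eq0.
apply: (scalerI lt0); rewrite -(resolvent_identity y l0 t0) -[LHS]opprK -scaleNr -rmorphN opprB.
by rewrite -(resolvent_identity y t0 l0) opprB.
Qed.

Lemma JE x : J alpha A x = (csin (alpha * pi%:C) / pi%:C) *:
  integral_pos (fun t => cpow t (alpha - 1) *: resolvent A t (A x)).
Proof. by []. Qed.

Lemma JB x y : opdom A x -> opdom A y -> opdom A (x - y) /\ J alpha A (x - y) = J alpha A x - J alpha A y.
Proof.
move=> dx dy; have [d e] := opapp_comb Alin (-1) dy dx.
have E : x - y = -1 *: y + x by rewrite scaleN1r addrC.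
rewrite E; split=> //; rewrite !JE e scaleN1r [- A y + _]addrC.
have [M _ hM] := dom_balakrishnan.
have d1 : dom (fun t => cpow t (alpha - 1) *: resolvent A t (A x)) by eexists; eexists; exact: hM.
have d2 : dom (fun t => cpow t (alpha - 1) *: resolvent A t (A y)) by eexists; eexists; exact: hM.
rewrite -scalerBr; congr (_ *: _); apply: etrans (integral_posB d1 d2).
apply/esym/integral_pos_eq; last exact: domB.
by move=> t t0; rewrite -scalerBr resolventB.
Qed.

(* Since [R(1)] is injective, this makes [J] closable. *)
Lemma resolvent_J_bound : exists2 K : R, 0 <= K &
  forall x, opdom A x -> rnorm (resolvent A 1 (J alpha A x)) <= K * rnorm x.
Proof.
have [M M0 hM] := dom_balakrishnan; have [N N0 hN] := resolvent_bound Ann.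
pose a := Num.min (complex.Re alpha - 1 + 1) (- (complex.Re alpha - 2) - 1).
pose k : R[i] := csin (alpha * pi%:C) / pi%:C.
exists (cabs k * (M * (N + (1 + N)) * (4 / a))).
  have [a0 _ _] := hM 0 (opapp0 Alin).1.
  by rewrite mulr_ge0 ?cabs_ge0 // mulr_ge0 ?divr_ge0 ?(ltW a0) // mulr_ge0 // !addr_ge0.
move=> x dx; pose u := resolvent A 1 x.
have [du _] := resolventP Ann x ltr01.
have [K1 hK1] := resolvent_lcont Ann ltr01.
have lin (b : R[i]) v w := resolvent_comb Alin Ann b v w ltr01.
have d1 : dom (fun t => cpow t (alpha - 1) *: resolvent A t (A x)) by eexists; eexists; exact: hM.
have l0 : resolvent A 1 0 = 0 by have := resolventB Alin Ann 0 0 ltr01; rewrite !subrr.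
have linZ (b : R[i]) v : resolvent A 1 (b *: v) = b *: resolvent A 1 v.
  by have := lin b v 0; rewrite l0 !addr0.
(* R(1) passes under the integral. J then acts on u = R(1) x, where both u and A u = x - u are
   controlled by x. *)
have -> : resolvent A 1 (J alpha A x) = J alpha A u.
  rewrite !JE linZ; congr (_ *: _); apply: (etrans (esym (integral_pos_linear lin hK1 d1))).
  have d2 : dom (fun t => cpow t (alpha - 1) *: resolvent A t (A u)) by eexists; eexists; exact: hM.
  apply/esym/integral_pos_eq => // t t0; rewrite -[LHS]/(_ *: _) -[RHS]/(resolvent A 1 (_ *: _)).
  rewrite linZ resolvent_comm //; congr (_ *: resolvent A t _).
  by rewrite (resolvent_op_comm Alin Ann ltr01 dx) (resolvent_op Ann x ltr01).
rewrite JE rnormZ -[leRHS]mulrA ler_wpM2l ?cabs_ge0 //.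
apply: le_trans (rnorm_integral_pos (hM u du)) _.
have [a0 _ _] := hM 0 (opapp0 Alin).1.
rewrite -/a in a0 *.
have a4 : 0 <= 4 / a by rewrite divr_ge0 // ltW.
rewrite [leRHS]mulrAC ler_wpM2r // -[leRHS]mulrA ler_wpM2l //.
have h1 : rnorm u <= N * rnorm x by have := hN 1 x ltr01; rewrite mul1r.
have h2 : rnorm (A u) <= rnorm x + rnorm u.
  by rewrite (resolvent_op Ann x ltr01) scale1r rnormB.
by rewrite !mulrDl mul1r; lra.
Qed.

Variable T : R -> X -> X.
Local Notation D := (closure (opdom A)).
Hypothesis TC0 : bounded_C0_semigroup D T.
Hypothesis Tgen : op_eq (generator D T) (scale_op (-1) (part_op A D)).

Lemma defect_bounds x : opdom A x -> cont_pos (fun s => x - T s x) /\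
  exists2 C : R, 0 <= C & (forall s, 0 < s -> rnorm (x - T s x) <= C) /\
    (forall s, 0 < s -> rnorm (x - T s x) <= C * s).
Proof.
move=> dx; have dDx := closure_dom dx.
split; first by move=> r r0; apply: cvgB; [exact: cvg_cst|exact: (cont_pos_semigroup Alin TC0 dDx)].
have [M M0 hM] := semigroup_bound TC0; have [K K0 hK] := semigroup_lipschitz Alin Ann TC0 Tgen dx.
have n0 := rnorm_ge0 x.
exists (K + (rnorm x + M * rnorm x)); first by rewrite !addr_ge0 ?mulr_ge0.
split=> s s0.
  apply: le_trans (rnormB _ _) _; have := hM s x (ltW s0) dDx; lra.
rewrite rnorm_distC; apply: le_trans (hK s s0) _; rewrite ler_wpM2r ?(ltW s0) // lerDl.
by rewrite addr_ge0 // mulr_ge0.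
Qed.

Lemma dom_defect x : opdom A x -> dom (fun s => cpow s (- alpha - 1) *: (x - T s x)).
Proof.
move=> dx; have [cH [C C0 [b1 b2]]] := defect_bounds dx.
have /andP[a0 a1] := alpha01.
have re : complex.Re (- alpha - 1) = - complex.Re alpha - 1 by case: (alpha).
apply: (dom_le (K := 1) (g := fun r => (expR ((- complex.Re alpha - 1) * ln r))%:C *: (x - T r x))) => //.
- by apply: cont_pos_scale => //; exact: cont_pos_cpow.
- by move=> r r0; rewrite mul1r rnormZ rnormZR cabs_cpow ger0_norm ?expR_ge0 // re.
- by apply: (dom_pow _ _ cH C0 b1 b2); lra.
Qed.

Lemma integral_balakrishnan x : opdom A x ->
  integral_pos (fun t => cpow t (alpha - 1) *: resolvent A t (A x)) =
  cGamma (alpha + 1) *: integral_pos (fun s => cpow s (- alpha - 1) *: (x - T s x)).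
Proof.
move=> dx; have [cH [C C0 [b1 b2]]] := defect_bounds dx.
have /andP[a0 a1] := alpha01.
have [M M0 dJ0] := dom_balakrishnan; have dJ := dJ0 x dx; have dH := dom_defect dx.
rewrite -(integral_posZ _ dH); apply: rfunctional_ext => phi hphi.
have dZ := domZ (cGamma (alpha + 1)) dH.
have [D' [a' dZ']] := dZ.
apply: (etrans (integral_pos_functional dJ hphi)).
apply: etrans (esym (integral_pos_functional dZ' hphi)).
pose H s := x - T s x; rewrite -/(H _).
(* The exponent is alpha and not alpha - 1, because the Laplace representation of R(t) A x carries a
   factor t. *)
pose k t s := phi ((expR (- (t * s)))%:C *: (cpow t alpha *: H s)).
have domk1 t : 0 < t -> dom (fun s => (expR (- (t * s)))%:C *: (cpow t alpha *: H s)).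
  move=> t0; apply: (@dom_exp _ _ 0 _ (cabs (cpow t alpha) * C)) => //.
    by apply: cont_pos_scale => // r r0; exact: cvg_cst.
  by move=> r r0; rewrite mul0r expR0 mulr1 rnormZ ler_wpM2l ?cabs_ge0 // b1.
have k1 t : 0 < t -> phi (cpow t (alpha - 1) *: resolvent A t (A x)) = rint (k t).
  move=> t0; rewrite (resolvent_op_integral Alin Ann TC0 Tgen t0 dx).
  have d2 : dom (fun s => (t * expR (- (t * s)))%:C *: H s).
    apply: dom_eq (domZ (t%:C * (cpow t alpha)^-1) (domk1 t t0)) => s s0.
    rewrite !scalerA rmorphM; congr (_ *: _).
    by have := cpow_neq0 t alpha; move: (cpow t alpha) => c c0; field.
  have [D2 [a2 d2']] := d2.
  have hphi' := rfunctional_scale (cpow t (alpha - 1)) hphi.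
  apply: (etrans (integral_pos_functional d2' hphi')).
  apply: rint_eq => s s0; rewrite /k /=; congr phi; rewrite !scalerA; congr (_ *: _).
  rewrite rmorphM mulrA [X in _ = _ * X](_ : _ = cpow t (alpha - 1) * t%:C); first by ring.
  by rewrite -(cpow1 t0) -cpowD subrK.
pose L s (c : Cx R) : X := (c : R[i]) *: H s.
have linL s (c : R[i]) (u v : Cx R) : L s (c *: u + v) = c *: L s u + L s v.
  by rewrite /L scalerDl scalerA.
have bL s (c : Cx R) : rnorm (L s c) <= rnorm (H s) * rnorm c.
  by rewrite /L rnormZ mulrC [X in _ <= _ * X]cabs_rnorm.
have hphiL s := rfunctional_comp hphi (linL s) (bL s).
have domk2 s : 0 < s -> @dom R (Cx R) (fun t => (expR (- (s * t)))%:C *: (cpow t (alpha + 1 - 1) : Cx R)).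
  by move=> s0; apply: dom_ekern => //; rewrite addrK; lra.
have kE t s : k t s = ((phi \o L s) \o (fun t => (expR (- (s * t)))%:C *: (cpow t (alpha + 1 - 1) : Cx R))) t.
  rewrite /k /= /L addrK [s * t]mulrC; congr phi; exact: scalerA.
(* The integral over t is Euler's: int_0^oo e^(-s t) t^alpha dt = Gamma(alpha + 1) s^(-alpha-1). *)
have k2 s : 0 < s -> rint (k^~ s) = phi (cGamma (alpha + 1) *: (cpow s (- alpha - 1) *: H s)).
  move=> s0; have [D2 [a2 d2']] := domk2 s s0.
  have h := integral_pos_functional d2' (hphiL s).
  rewrite (_ : rint (k^~ s) = (phi \o L s) (cGamma (alpha + 1) * cpow s (- (alpha + 1)))).
    by rewrite /= /L -scalerA opprD.
  rewrite -(integral_eint (z := alpha + 1) s0) ?ReD ?Re1; last by rewrite addr_gt0.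
  by rewrite h; apply: rint_eq => t t0; exact: kE.
have [Cp Cp0 hCp] := rfunctional_bound hphi.
pose p := complex.Re alpha.
(* The same t-integral for |t^alpha| = t^p, together with the bound of phi. It is integrable in s
   because [H] is O(s) at 0 and bounded. *)
pose B s := Cp * cabs (eint 1 p%:C) * rnorm ((expR ((- p - 1) * ln s))%:C *: H s).
have [D3 [a3 d3]] : dom (fun s => (expR ((- p - 1) * ln s))%:C *: H s).
  by apply: (dom_pow _ _ cH C0 b1 b2); rewrite /p; lra.
have iB : (@lebesgue_measure R).-integrable `]0, +oo[ (EFin \o B).
  have [a30 c3 h3] := d3.
  have Q0 : 0 <= Cp * cabs (eint 1 p%:C) by rewrite mulr_ge0 ?cabs_ge0.
  apply: (@integrable_dominated _ (Cp * cabs (eint 1 p%:C) * D3) a3) => //.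
    by move=> r r0; apply: cvgM; [exact: cvg_cst|apply: rnorm_cvg; exact: c3].
  move=> r r0; rewrite ger0_norm ?mulr_ge0 ?rnorm_ge0 ?cabs_ge0 //.
  by rewrite -[leRHS]mulrA ler_wpM2l // h3.
have ik2 s : 0 < s -> (@lebesgue_measure R).-integrable `]0, +oo[ (EFin \o k^~ s).
  move=> s0; have := integrable_functional (domk2 s s0) (hphiL s).
  by apply: eq_integrable => // t _; rewrite /= kE.
transitivity (rint (fun t => rint (k t))).
  by apply: rint_eq => t t0; exact: k1.
transitivity (rint (fun s => rint (k^~ s))); last first.
  by apply: rint_eq => s s0; exact: k2.
apply: (@rint_Fubini _ k B) => //.
- have kE2 : k = fun t s => expR (- (t * s)) * (complex.Re (cpow t alpha) * phi (H s) + complex.Im (cpow t alpha) * phi ('i *: H s)).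
    by apply/funext => t; apply/funext => s; rewrite /k rfunctionalZ // rfunctional_scaleE.
  rewrite kE2.
  have cphi (psi : X -> R) : rfunctional psi -> cont_pos (fun s => psi (H s)).
    by move=> hpsi r r0; apply: rfunctional_cvg => //; exact: cH.
  apply: (@measurable_exp_prod R (fun t => complex.Re (cpow t alpha)) (fun s => phi (H s))
    (fun t => complex.Im (cpow t alpha)) (fun s => phi ('i *: H s))).
  + by move=> r r0; apply: (rfunctional_cvg (@rfunctional_Re R)); exact: cont_pos_cpow.
  + exact: cphi.
  + apply: (@cont_pos_eq _ _ (fun t => complex.Re ((- 'i : R[i]) *: (cpow t alpha : Cx R)))).
      by move=> r r0; case: (cpow r alpha) => u v; rewrite /GRing.scale /=; ring.
    move=> r r0; apply: (rfunctional_cvg (rfunctional_scale (- 'i) (@rfunctional_Re R))).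
    exact: cont_pos_cpow.
  + by apply: (cphi (fun v => phi ('i *: v))); exact: rfunctional_scale.
- by move=> t t0; exact: integrable_functional (domk1 t t0) hphi.
- move=> s s0.
  have d4 : @dom R (Cx R) (ekern s p%:C) by apply: dom_ekern => //=; rewrite /p; lra.
  have K0 : 0 <= Cp * rnorm (H s) by rewrite mulr_ge0 ?rnorm_ge0.
  have hpsi := rfunctional_scale (Cp * rnorm (H s))%:C (@rfunctional_Re R).
  have [D4 [a4 d4']] := d4.
  have h4 := integral_pos_functional d4' hpsi.
  have i4 := integrable_functional d4 hpsi.
  have e4 t : complex.Re ((Cp * rnorm (H s))%:C *: ekern s p%:C t) =
      Cp * rnorm (H s) * (expR (- (s * t)) * expR (p * ln t)).
    by rewrite /ekern cpow_real /GRing.scale /=; ring.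
  apply: (@le_trans _ _ (rint ((fun c : Cx R => complex.Re ((Cp * rnorm (H s))%:C *: c)) \o ekern s p%:C))%:E).
    rewrite -(rintE i4); apply: ge0_le_integral => //.
    + exact: (measurableT_comp (f := abse) _ (measurable_int _ (ik2 s s0))).
    + exact: measurable_int i4.
    + move=> t /posP t0; rewrite lee_fin; apply: (@le_trans _ _ (Cp * rnorm (H s) * (expR (- (s * t)) * expR (p * ln t)))); last by rewrite -e4.
      rewrite /k; apply: le_trans (hCp _) _.
      rewrite rnormZR rnormZ cabs_cpow ger0_norm ?expR_ge0 // [t * s]mulrC.
      by rewrite le_eqVlt; apply/orP; left; apply/eqP; rewrite -/p; ring.
  rewrite lee_fin -h4 -/(eint s p%:C) eint_scale //; last by rewrite /= /p; lra.
  apply: le_trans (ler_norm _) _; apply: le_trans (cabs_Re _) _.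
  have cZ (u v w : R[i]) : cabs (u *: ((v * w : R[i]) : Cx R)) = cabs u * cabs v * cabs w.
    by rewrite -[X in cabs X]/(u * (v * w)) !cabsM mulrA.
  rewrite cZ cabs_real ger0_norm // cabs_cpow /B rnormZR ger0_norm ?expR_ge0 //.
  have -> : complex.Re (- (p%:C + 1)) = - p - 1 by rewrite /=; ring.
  by rewrite le_eqVlt; apply/orP; left; apply/eqP; ring.
Qed.

End Balakrishnan.

(** * Comparison of the closures *)

Lemma closure_graphP {R : realType} {X : normedModType R[i]} (B : operator X) (x y : X) :
  closure (op_graph B) (x, y) <-> forall e : R, 0 < e ->
    exists u, [/\ opdom B u, rnorm (u - x) <= e & rnorm (B u - y) <= e].
Proof.
split=> [h e e0|h N [[P Q] /= [nP nQ] sN]].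
  have cxP (z : X) : nbhs z [set v | rnorm (v - z) <= e].
    have /cvgr_rnormP/(_ e e0) : v @[v --> z] --> z by exact: cvg_id.
    by [].
  have [|[u w] /= [[/= du ->] [h1 h2]]] := h ([set v | rnorm (v - x) <= e] `*` [set v | rnorm (v - y) <= e]).
    by exists ([set v | rnorm (v - x) <= e], [set v | rnorm (v - y) <= e]) => //=; split; exact: cxP.
  by exists u.
have nb (z : X) (S : set X) : nbhs z S -> exists2 e : R, 0 < e & forall v, rnorm (v - z) <= e -> S v.
  move=> /nbhs_ballP [e /= e0 hS].
  have eE : e = (complex.Re e)%:C by rewrite RRe_real // gtr0_real.
  have e0' : 0 < complex.Re e by rewrite -ltcR -eE.
  exists (complex.Re e / 2); first by rewrite divr_gt0.
  move=> v hv; apply: hS; rewrite -ball_normE /= distrC eE -rnorm_lt.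
  by apply: le_lt_trans hv _; rewrite ltr_pdivrMr // ltr_pMr // ltr1n.
have [e1 e10 h1] := nb _ _ nP; have [e2 e20 h2] := nb _ _ nQ.
have e0 : 0 < Num.min e1 e2 by rewrite lt_min e10 e20.
have [u [du hu1 hu2]] := h _ e0; exists (u, B u); split=> //=.
apply: sN; split=> /=.
  by apply: h1; apply: le_trans hu1 _; rewrite ge_min lexx.
by apply: h2; apply: le_trans hu2 _; rewrite ge_min lexx orbT.
Qed.

Lemma Lam_eq {R : realType} {X : completeNormedModType R[i]} (alpha : R[i]) (f g : R -> X) (s C : R) :
  0 < complex.Re alpha < 1 -> 0 < s -> cont_pos g -> (forall r, 0 < r -> rnorm (g r) <= C) ->
  (forall r, 0 < r -> f r = g r) -> Lam alpha f s = Lam alpha g s.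
Proof.
move=> a01 s0 cg bg e.
have h w : complex.Re w < -1 -> kint f w s = kint g w s.
  move=> w1; apply/esym/integral_pos_eq; last exact: (dom_kint w1 s0 cg bg).
  by move=> r r0; rewrite e.
by rewrite /Lam !h //; move: a01; case: (alpha) => a b /= /andP[]; lra.
Qed.

Section ClosureComparison.
Context {R : realType} {X : completeNormedModType R[i]}.
Variables (A : operator X) (alpha : R[i]) (T : R -> X -> X).
Hypothesis alpha01 : 0 < complex.Re alpha < 1.
Hypothesis Alin : linear_operator A.
Hypothesis Ann : nonnegative A.
Local Notation D := (closure (opdom A)).
Hypothesis TC0 : bounded_C0_semigroup D T.
Hypothesis Tgen : op_eq (generator D T) (scale_op (-1) (part_op A D)).
Implicit Types (x y : X) (t : R).

Let g x (t : R) : X :=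
  - (cpow t (1 - 2 * alpha) *: real_derive (fun s => U alpha T s x) t).

Lemma DtN_quotientE x t : D x -> 0 < t -> g x t = - (Kc alpha *: Lam alpha (T ^~ x) (t ^+ 2 / 4)).
Proof.
move=> dx t0; have [M M0 hM] := semigroup_bound TC0.
have cT := cont_pos_semigroup Alin TC0 dx.
have bT r : 0 < r -> rnorm (T r x) <= M * rnorm x by move=> r0; rewrite hM // ltW.
rewrite /g; apply: (real_derive_Uf alpha01 t0 cT bT) => v v0.
have z1 : complex.Re (- alpha - 1) < -1 by move: alpha01; case: (alpha) => a b /= /andP[]; lra.
have s0 : 0 < v ^+ 2 / 4 by rewrite divr_gt0 // exprn_gt0.
have e : integral_pos (fun r => (cpow r (- alpha) * (expR (- (v ^+ 2 / (4 * r))))%:C * (r^-1)%:C) *: T r x) =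
    kint (T ^~ x) (- alpha - 1) (v ^+ 2 / 4).
  apply/esym/integral_pos_eq; last exact: (dom_kint z1 s0 cT bT).
  move=> r r0; rewrite scalerA; congr (_ *: _).
  have -> : v ^+ 2 / 4 * r^-1 = v ^+ 2 / (4 * r) by field; rewrite gt_eqF.
  by rewrite -(cpow_pred (- alpha) r0); ring.
by rewrite /U (gt_eqF v0) e /Uf.
Qed.

Lemma cvg_sqr4 : t ^+ 2 / 4 @[t --> (0 : R)^'+] --> (0 : R)^'+.
Proof.
move=> P [d /= d0 hP]; exists (Num.min 1 d); first by rewrite /= lt_min ltr01.
move=> t /=; rewrite sub0r normrN lt_min => /andP[t1 td] t0.
rewrite gtr0_norm // in t1 td; have t2 : 0 < t ^+ 2 / 4 by rewrite divr_gt0 // exprn_gt0.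
by apply: hP => //=; rewrite sub0r normrN gtr0_norm //; nra.
Qed.

Lemma DtN_dom x : opdom A x ->
  g x t @[t --> 0^'+] --> (Kc alpha * (2 * alpha)) *: integral_pos (fun s => cpow s (- alpha - 1) *: (x - T s x)).
Proof.
move=> dx; have dDx := closure_dom dx.
have [cH [C C0 [b1 b2]]] := defect_bounds Alin Ann TC0 Tgen dx.
have [M M0 hM] := semigroup_bound TC0.
have cT := cont_pos_semigroup Alin TC0 dDx.
have bT r : 0 < r -> rnorm (T r x) <= M * rnorm x by move=> r0; rewrite hM // ltW.
have h := cvg_comp _ _ cvg_sqr4 (Lam_cvg alpha01 cH C0 b1 b2).
have {}h : Kc alpha *: Lam alpha (fun r => x - T r x) (t ^+ 2 / 4) @[t --> (0 : R)^'+] -->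
   Kc alpha *: ((2 * alpha) *: integral_pos (fun s => cpow s (- alpha - 1) *: (x - T s x))).
  by apply: (cvg_scale (c0 := Kc alpha)); [exact: cvg_cst|exact: h].
rewrite scalerA in h; move: h; apply: cvg_near_eq; near=> t.
have t0 : 0 < t by near: t; exact: nbhs_right_gt.
have s0 : 0 < t ^+ 2 / 4 by rewrite divr_gt0 // exprn_gt0.
by rewrite DtN_quotientE // (LamB_cst alpha01 x s0 cT bT) scalerN.
Unshelve. all: by end_near.
Qed.

(** By the reflection formula both values are factors of pi. *)
Lemma cGamma_alpha_neq0 : cGamma alpha != 0 /\ cGamma (1 - alpha) != 0.
Proof.
have h := gamma_reflection alpha01.
have p0 : pi%:C != 0 :> R[i].
  by rewrite -(rmorph0 (real_complex R)) (inj_eq (@complexI R)) gt_eqF // pi_gt0.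
by split; apply: contraNneq p0 => e; rewrite -h e ?mulr0 ?mul0r.
Qed.

(** With Gamma(alpha + 1) = alpha Gamma(alpha), the two constants agree exactly when Gamma(alpha)
    Gamma(1 - alpha) sin(alpha pi) = pi. *)
Lemma c_alpha_J x : opdom A x ->
  c_ alpha *: J alpha A x =
  (Kc alpha * (2 * alpha)) *: integral_pos (fun s => cpow s (- alpha - 1) *: (x - T s x)).
Proof.
move=> dx; rewrite JE (integral_balakrishnan Alin Ann alpha01 TC0 Tgen dx) !scalerA.
congr (_ *: _); have /andP[a0 _] := alpha01.
have h := gamma_reflection alpha01; have [g0 g1] := cGamma_alpha_neq0.
have p0 : pi%:C != 0 :> R[i].
  by rewrite -(rmorph0 (real_complex R)) (inj_eq (@complexI R)) gt_eqF // pi_gt0.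
rewrite /c_ /Kc (cGammaS a0) cpowD !cpowN.
have c1 : cpow (2 : R) (1 : R[i]) = 2 by rewrite cpow1 // rmorph_nat.
rewrite c1; have q0 := cpow_neq0 (2 : R) (2 * alpha).
move: (csin (alpha * pi%:C)) h => s h; move: (cGamma alpha) (cGamma (1 - alpha)) h g0 g1 => G G' h g0 g1.
move: (pi%:C : R[i]) (cpow 2 (2 * alpha)) h p0 q0 => p q h p0 q0.
transitivity (2 * alpha * (G * G' * s) / (p * q * G)); first by field; rewrite p0 q0 g0.
by rewrite h; field; rewrite p0 q0 g0.
Qed.

Lemma c_alpha_neq0 : c_ alpha != 0.
Proof.
have [g0 g1] := cGamma_alpha_neq0.
rewrite /c_; apply: mulf_neq0; first exact: g1.
by apply: invr_neq0; apply: mulf_neq0; [exact: cpow_neq0|exact: g0].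
Qed.

Lemma DtN_on_dom x : opdom A x ->
  opdom (DtN alpha D T) x /\ DtN alpha D T x = c_ alpha *: J alpha A x.
Proof.
move=> dx; have h := DtN_dom dx; rewrite -(c_alpha_J dx) in h.
split; first by split; [exact: closure_dom|apply/cvg_ex; eexists; exact: h].
by apply: cvg_lim h; exact: norm_hausdorff.
Qed.

(** Needed for l R(l) T_alpha x -> T_alpha x, a convergence available on D. It holds because [Lam]
    takes values in the closed subspace D. *)
Lemma DtN_mem x : opdom (DtN alpha D T) x -> D (DtN alpha D T x).
Proof.
move=> [dx cx]; have [M M0 hM] := semigroup_bound TC0.
have cT := cont_pos_semigroup Alin TC0 dx.
have bT r : 0 < r -> rnorm (T r x) <= M * rnorm x by move=> r0; rewrite hM // ltW.
apply: (closed_cvg_mem (f := g x) (F := (0 : R)^'+)) cx; near=> t.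
have t0 : 0 < t by near: t; exact: nbhs_right_gt.
have s0 : 0 < t ^+ 2 / 4 by rewrite divr_gt0 // exprn_gt0.
have [u [v [du dv e]]] : exists u v, [/\ closure D u, closure D v &
    Lam alpha (T ^~ x) (t ^+ 2 / 4) = (2 * alpha) *: u - (2 * (t ^+ 2 / 4))%:C *: v].
  apply: (Lam_mem alpha01 s0 cT bT); first exact: closure_dom0.
    by move=> a y z; exact: closure_comb.
  by move=> r r0; apply: (semigroup_mem TC0) => //; exact: ltW.
have cD : closure D = D by apply: esym; apply/closure_id; exact: closed_closure.
rewrite cD in du dv.
rewrite DtN_quotientE // e -scaleNr; apply: (closureZ Alin).
by apply: (closureB Alin); exact: (closureZ Alin).
Unshelve. all: by end_near.
Qed.

(** R(l) is bounded and commutes with every T(r), so it passes through the integrals in [Lam] and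
    through the limit t -> 0+. *)
Lemma DtN_resolvent l x : 0 < l -> opdom (DtN alpha D T) x ->
  DtN alpha D T (l%:C *: resolvent A l x) = l%:C *: resolvent A l (DtN alpha D T x).
Proof.
move=> l0 hx; have [dx cx] := hx; have [M M0 hM] := semigroup_bound TC0.
have cT := cont_pos_semigroup Alin TC0 dx.
have bT r : 0 < r -> rnorm (T r x) <= M * rnorm x by move=> r0; rewrite hM // ltW.
have [K hK] := resolvent_lcont Ann l0.
pose L u := l%:C *: resolvent A l u.
have lin (a : R[i]) u v : L (a *: u + v) = a *: L u + L v.
  by rewrite /L resolvent_comb // scalerDr !scalerA mulrC.
have bL u : rnorm (L u) <= l * K * rnorm u.
  by rewrite /L rnormZR gtr0_norm // -mulrA ler_wpM2l ?hK // ltW.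
have [du _] := resolventP Ann x l0; have [dLx _] := opappZ Alin l%:C du.
have h : L (g x t) @[t --> 0^'+] --> L (DtN alpha D T x).
  exact: (bounded_linear_cvg lin bL cx).
apply: cvg_lim; first exact: norm_hausdorff.
rewrite -/(L _) -/(L _); move: h; apply: cvg_near_eq; near=> t.
have t0 : 0 < t by near: t; exact: nbhs_right_gt.
have s0 : 0 < t ^+ 2 / 4 by rewrite divr_gt0 // exprn_gt0.
have key : L (Lam alpha (T ^~ x) (t ^+ 2 / 4)) = Lam alpha (T ^~ (L x)) (t ^+ 2 / 4).
  rewrite -(Lam_linear alpha01 s0 cT bT lin bL); apply: (Lam_eq alpha01 s0).
  - exact: (cont_pos_semigroup Alin TC0 (closure_dom dLx)).
  - by move=> r r0; apply: hM (ltW r0) (closure_dom dLx).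
  move=> r r0; rewrite -[LHS]/(l%:C *: resolvent A l (T r x)) /L (semigroupZ Alin TC0 _ (ltW r0) (closure_dom du)).
  by rewrite (resolvent_semigroup Alin Ann TC0 Tgen l0 (ltW r0) dx).
have L0 : L 0 = 0 by have := resolventB Alin Ann 0 0 l0; rewrite !subrr /L => ->; rewrite scaler0.
have linZ (b : R[i]) v : L (b *: v) = b *: L v by have := lin b v 0; rewrite L0 !addr0.
rewrite -[RHS]/(g (L x) t) (DtN_quotientE dx t0) (DtN_quotientE (closure_dom dLx) t0).
by rewrite -[X in L X]scaleNr linZ key scaleNr.
Unshelve. all: by end_near.
Qed.

Lemma graph_closureE x y :
  closure (op_graph (J alpha A)) (x, y) <-> closure (op_graph (DtN alpha D T)) (x, c_ alpha *: y).
Proof.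
have c0 := c_alpha_neq0.
have m0 : 0 < cabs (c_ alpha).
  by rewrite lt0r cabs_ge0 andbT; apply: contraNneq c0 => /cabs_eq0 ->.
split=> /closure_graphP h; apply/closure_graphP => e e0.
  pose d := Num.min e (e / cabs (c_ alpha)).
  have d0 : 0 < d by rewrite lt_min e0 divr_gt0.
  have [u [du h1 h2]] := h d d0; have [du' eu] := DtN_on_dom du.
  exists u; split=> //; first by apply: le_trans h1 _; rewrite ge_min lexx.
  rewrite eu -scalerBr rnormZ mulrC -ler_pdivlMr //.
  by apply: le_trans h2 _; rewrite ge_min lexx orbT.
(* Each component of the graph receives two errors, from u and from l R(l) u. Those of the second
   component are divided by |c_alpha|. *)
pose d := Num.min (e / 2) (cabs (c_ alpha) * (e / 2)).
have e2 : 0 < e / 2 by rewrite divr_gt0.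
have d0 : 0 < d by rewrite lt_min e2 mulr_gt0.
have [u [hu h1 h2]] := h d d0.
have c1 := resolvent_approx Alin Ann hu.1.
have c2 := resolvent_approx Alin Ann (DtN_mem hu).
have /cvgr_rnormP/(_ d d0) n1 := c1; have /cvgr_rnormP/(_ d d0) n2 := c2.
have [l [l0 l1 l2]] : exists l : R, [/\ 0 < l, rnorm (l%:C *: resolvent A l u - u) <= d &
   rnorm (l%:C *: resolvent A l (DtN alpha D T u) - DtN alpha D T u) <= d].
  near (+oo : set_system R) => l; exists l; split.
  - by near: l; exact: nbhs_pinfty_gt.
  - by near: l; exact: n1.
  - by near: l; exact: n2.
have [dR _] := resolventP Ann u l0; have [dv ev] := opappZ Alin l%:C dR.
pose v := l%:C *: resolvent A l u.
have [_ eJ] := DtN_on_dom dv.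
exists v; split=> //.
  apply: le_trans (rnorm_triangle _ u _) _; rewrite [leRHS]splitr lerD //.
    by apply: le_trans l1 _; rewrite ge_min lexx.
  by apply: le_trans h1 _; rewrite ge_min lexx.
have eB : c_ alpha *: (J alpha A v - y) = l%:C *: resolvent A l (DtN alpha D T u) - c_ alpha *: y.
  by rewrite scalerBr -eJ /v (DtN_resolvent l0 hu).
have : rnorm (c_ alpha *: (J alpha A v - y)) <= cabs (c_ alpha) * e.
  rewrite eB; apply: le_trans (rnorm_triangle _ (DtN alpha D T u) _) _.
  have -> : cabs (c_ alpha) * e = cabs (c_ alpha) * (e / 2) + cabs (c_ alpha) * (e / 2) by field.
  rewrite lerD //; [apply: le_trans l2 _|apply: le_trans h2 _]; by rewrite ge_min lexx orbT.
by rewrite rnormZ ler_pM2l.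
Unshelve. all: by end_near.
Qed.

Lemma J_closable x y z : closure (op_graph (J alpha A)) (x, y) ->
  closure (op_graph (J alpha A)) (x, z) -> y = z.
Proof.
move=> /closure_graphP hy /closure_graphP hz.
have [K K0 hK] := resolvent_J_bound Alin Ann alpha01.
have [N hN] := resolvent_lcont Ann ltr01.
suff e0 : rnorm (resolvent A 1 (y - z)) = 0.
  have /(resolvent_injective Alin Ann ltr01) := rnorm_eq0 e0.
  exact: subr0_eq.
apply/eqP; rewrite eq_le rnorm_ge0 andbT; apply/ler_addgt0Pl => e e0; rewrite addr0.
(* The three terms below contribute 2 K d, |N| d and |N| d; the summand 1 keeps the denominator
   positive. *)
pose d := e / (2 * (`|N| + K) + 1).
have P0 : 0 < 2 * (`|N| + K) + 1 by rewrite ltr_wpDl // mulr_ge0 // addr_ge0.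
have d0 : 0 < d by rewrite divr_gt0.
have [u [du u1 u2]] := hy d d0; have [v [dv v1 v2]] := hz d d0.
have [duv eJ] := JB Alin Ann alpha01 du dv.
have lB a b := resolventB Alin Ann a b ltr01.
have hN' w : rnorm w <= d -> rnorm (resolvent A 1 w) <= `|N| * d.
  move=> wd; apply: le_trans (hN w) _; apply: (@le_trans _ _ (`|N| * rnorm w)).
    by rewrite ler_wpM2r ?rnorm_ge0 // ler_norm.
  by rewrite ler_wpM2l.
have -> : y - z = (J alpha A (u - v) - (J alpha A u - y)) + (J alpha A v - z).
  rewrite eJ; move: (J alpha A u) (J alpha A v) => p q.
  by rewrite opprB [p - q + _]addrC [_ + (p - q)]addrA subrK addrA subrK.
have -> : resolvent A 1 (J alpha A (u - v) - (J alpha A u - y) + (J alpha A v - z)) =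
    resolvent A 1 (J alpha A (u - v)) - resolvent A 1 (J alpha A u - y) + resolvent A 1 (J alpha A v - z).
  rewrite -lB; have := resolvent_comb Alin Ann 1 (J alpha A (u - v) - (J alpha A u - y)) (J alpha A v - z) ltr01.
  by rewrite !scale1r.
have b1 := hN' _ u2; have b2 := hN' _ v2.
have b3 : rnorm (resolvent A 1 (J alpha A (u - v))) <= K * (d + d).
  apply: le_trans (hK _ duv) _; rewrite ler_wpM2l //.
  by apply: le_trans (rnorm_triangle _ x _) _; rewrite lerD // rnorm_distC.
have dE : (2 * (`|N| + K) + 1) * d = e by rewrite /d mulrC divfK // gt_eqF.
apply: le_trans (rnormD _ _) _; have := rnormB (resolvent A 1 (J alpha A (u - v))) (resolvent A 1 (J alpha A u - y)).
by lra.
Qed.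

End ClosureComparison.

Theorem theorem3p10 (R : realType) (X : completeNormedModType R[i])
    (alpha : R[i]) (A : operator X) (T : R -> X -> X) :
  0 < complex.Re alpha < 1 ->
  linear_operator A ->
  nonnegative A ->
  bounded_C0_semigroup (closure (opdom A)) T ->
  op_eq (generator (closure (opdom A)) T)
        (scale_op (-1) (part_op A (closure (opdom A)))) ->
  op_eq (scale_op (c_ alpha) (closure_op (J alpha A)))
        (closure_op (DtN alpha (closure (opdom A)) T)).
Proof.
move=> alpha01 Alin Ann TC0 Tgen.
have c0 := c_alpha_neq0 alpha01.
have gE x y := graph_closureE alpha01 Alin Ann TC0 Tgen x y.
have cK (w : X) : c_ alpha *: ((c_ alpha)^-1 *: w) = w by rewrite scalerA divff // scale1r.
split.
  apply/seteqP; split=> x [y hy]; first by exists (c_ alpha *: y); apply/gE.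
  by exists ((c_ alpha)^-1 *: y); apply/gE; rewrite cK.
move=> x [y hy]; rewrite [LHS]/=.
have [B1 B2] : (exists y, closure (op_graph (J alpha A)) (x, y)) /\
    (exists y, closure (op_graph (DtN alpha (closure (opdom A)) T)) (x, y)).
  by split; eexists; [exact: hy|exact: (gE x y).1 hy].
have h1 := xgetPex point B1; have h2 := xgetPex point B2.
(* Both sides are choices by [get]; closability of J identifies the left one with c_alpha^-1 times
   the right one. *)
rewrite [RHS]/= -[RHS]cK; congr (_ *: _); apply: (J_closable alpha01 Alin Ann h1).
by apply/gE; rewrite cK; exact: h2.
Qed.
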